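(* Let $(X,0) \hookrightarrow (\mathbb{C}^n,0)$ be an inclusion of germs of complex spaces, and let $I_X\subset \mathcal{O}_{\mathbb{C}^n,0}$ be the ideal defining $(X,0)$. Suppose that $G$ is a compact complex Lie group acting holomorphically on $(\mathbb{C}^n,0)$ and leaving $(X,0)$ invariant. Then there exists a $G$-equivariant resolution of the structure sheaf $\mathcal{O}_{X,0}$ $$\mathcal{F}^\bullet:\quad 0 \longrightarrow \mathcal{F}^r \overset{\varphi_r}{\longrightarrow}\mathcal{F}^{r-1} \overset{\varphi_{r-1}}{\longrightarrow}\cdots \overset{\varphi_{1}}{\longrightarrow} \mathcal{F}^0 \overset{\pi}{\longrightarrow} \mathcal{O}_{X,0}= \mathcal{O}_{\mathbb{C}^n,0}/I_X\longrightarrow 0$$ with $\mathcal{F}^i \cong \mathcal{O}_{\mathbb{C}^n,0}^{\oplus m_i}$ for some $m_i \in \mathbb{N}$, for every $i$.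
   Context: The group $G$ acts on $\mathcal{O}_{\mathbb{C}^n,0}$ by $(g\cdot f)(z)=f(g^{-1}\cdot z)$; since $(X,0)$ is invariant, $I_X$ is $G$-stable and $G$ acts on $\mathcal{O}_{X,0}=\mathcal{O}_{\mathbb{C}^n,0}/I_X$. A $G$-equivariant (free) resolution of $\mathcal{O}_{X,0}$ is an exact sequence of $\mathcal{O}_{\mathbb{C}^n,0}$-modules as displayed, in which each $\mathcal{F}^i$ is a free $\mathcal{O}_{\mathbb{C}^n,0}$-module of finite rank equipped with a $G$-action compatible with the module structure (that is, additive with $g\cdot(fe)=(g\cdot f)(g\cdot e)$ for $f\in\mathcal{O}_{\mathbb{C}^n,0}$, $e\in\mathcal{F}^i$), and all the maps $\varphi_i$ and $\pi$ are $G$-equivariant. *)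

(* Defs.v *)
From HB Require Import structures.
From mathcomp Require Import all_boot all_order all_algebra ring_quotient.
From mathcomp Require Import complex.
From mathcomp Require Import all_classical all_reals all_analysis.

Set Implicit Arguments.
Unset Strict Implicit.
Unset Printing Implicit Defensive.

Import Order.TTheory GRing.Theory Num.Theory.
Import numFieldNormedType.Exports.

Local Open Scope classical_set_scope.
Local Open Scope quotient_scope.
Local Open Scope ring_scope.

(* Everything below is developed over a numFieldType K with its normed topology,
   and is used with K = R[i], the complex numbers, for R : realType.  There
   [differentiable] between normed K-modules is complex (Frechet)
   differentiability, and a map is holomorphic on an open set when it is
   differentiable at each point of that set. *)

(* A chart is given by total functions, of which only the values of [cfun] on
   the open set [cdom] and of [cinv] on the open set [cfun @` cdom] matter. *)
Record chart (K : numFieldType) (M : topologicalType) (E : normedModType K) :=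
  Chart {
    cdom : set M;
    cfun : M -> E;
    cinv : E -> M;
    cdom_open : open cdom;
    cimg_open : open (cfun @` cdom);
    cfunK : forall x, cdom x -> cinv (cfun x) = x;
    cfun_cts : forall x, cdom x -> {for x, continuous cfun};
    cinv_cts : forall x, cdom x -> {for cfun x, continuous cinv}
  }.

Section Charts.
Variable K : numFieldType.

Definition model_chart (E : normedModType K) : chart E E.
Proof.
refine (@Chart K E E setT id id openT _ (fun _ _ => erefl) _ _).
- by rewrite image_id; exact: openT.
- by move=> x _; exact: cvg_id.
- by move=> x _; exact: cvg_id.
Defined.

Lemma openX (M N : topologicalType) (A : set M) (B : set N) :
  open A -> open B -> open (A `*` B).
Proof.
rewrite !openE => oA oB [x y] /= [Ax By].
by exists (A, B) => //=; split; [exact: oA|exact: oB].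
Qed.

Definition prod_chart (M N : topologicalType) (E F : normedModType K)
  (a : chart M E) (b : chart N F) : chart (M * N)%type (E * F)%type.
Proof.
refine (@Chart K (M * N)%type (E * F)%type (cdom a `*` cdom b)
  (fun p => (cfun a p.1, cfun b p.2)) (fun q => (cinv a q.1, cinv b q.2))
  _ _ _ _ _).
- exact: openX (cdom_open a) (cdom_open b).
- suff -> : [set (cfun a p.1, cfun b p.2) | p in cdom a `*` cdom b] =
            (cfun a @` cdom a) `*` (cfun b @` cdom b).
    exact: openX (cimg_open a) (cimg_open b).
  apply/seteqP; split=> [_ [[x y] /= [ax b_y] <-]|[_ _] /= [[x ax <-] [y b_y <-]]].
    by split; [exists x|exists y].
  by exists (x, y).
- by case=> x y /= [ax b_y]; rewrite !cfunK.
- case=> x y /= [ax b_y]; rewrite /prop_for /continuous_at.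
  apply: (@cvg_pair _ _ _ _ (nbhs (cfun a x)) (nbhs (cfun b y))).
  + exact: (cvg_comp fst (cfun a) cvg_fst (cfun_cts ax)).
  + exact: (cvg_comp snd (cfun b) cvg_snd (cfun_cts b_y)).
- case=> x y /= [ax b_y]; rewrite /prop_for /continuous_at.
  apply: (@cvg_pair _ _ _ _ (nbhs (cinv a (cfun a x))) (nbhs (cinv b (cfun b y)))).
  + exact: (cvg_comp fst (cinv a) cvg_fst (cinv_cts ax)).
  + exact: (cvg_comp snd (cinv b) cvg_snd (cinv_cts b_y)).
Defined.

Definition model_atlas (E : normedModType K) : set (chart E E) :=
  [set model_chart E].

Definition prod_atlas (M N : topologicalType) (E F : normedModType K)
    (A : set (chart M E)) (B : set (chart N F)) :
    set (chart (M * N)%type (E * F)%type) :=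
  [set c | exists a b, [/\ A a, B b & c = prod_chart a b]].

Definition cdifferentiable_at (M N : topologicalType) (E F : normedModType K)
    (A : set (chart M E)) (B : set (chart N F)) (f : M -> N) (x : M) : Prop :=
  {for x, continuous f} /\
  forall a b, A a -> B b -> cdom a x -> cdom b (f x) ->
    differentiable (cfun b \o f \o cinv a) (cfun a x).

End Charts.

Arguments model_atlas {K} E.

HB.mixin Record isComplexManifold (K : numFieldType) (d : nat) M & Topological M := {
  atlas : set (chart M 'rV[K]_d);
  atlas_cover : forall x : M, exists2 a, atlas a & cdom a x;
  atlas_compatible : forall a b, atlas a -> atlas b ->
    forall x : M, cdom a x -> cdom b x ->
      differentiable (cfun b \o cinv a) (cfun a x);
  manifold_hausdorff : hausdorff_space M;
  manifold_second_countable : @second_countable M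
}.

#[short(type="complexManifoldType")]
HB.structure Definition ComplexManifold (K : numFieldType) (d : nat) :=
  {M of Topological M & isComplexManifold K d M}.

Arguments atlas {K d} s.

HB.mixin Record isComplexLieGroup (K : numFieldType) (d : nat) G
    & ComplexManifold K d G & Group G := {
  mulg_holomorphic : forall p : G * G,
    cdifferentiable_at (prod_atlas (atlas G) (atlas G)) (atlas G)
      (fun q => (q.1 * q.2)%g) p;
  invg_holomorphic : forall x : G,
    cdifferentiable_at (atlas G) (atlas G) (fun y => (y^-1)%g) x
}.

#[short(type="complexLieGroupType")]
HB.structure Definition ComplexLieGroup (K : numFieldType) (d : nat) :=
  {G of ComplexManifold K d G & Group G & isComplexLieGroup K d G}.

Section HolomorphicGerms.
Variables (K : numFieldType) (n : nat).

Definition holo0 : {pred 'rV[K]_n -> K} :=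
  fun f => `[< \forall z \near (0 : 'rV[K]_n), differentiable f z >].

Fact holo0_subring : subring_closed holo0.
Proof.
split=> [|f g /asboolP hf /asboolP hg|f g /asboolP hf /asboolP hg].
- by apply/asboolP; near=> z; exact: differentiable_cst.
- by apply/asboolP; near=> z; apply: differentiableB; near: z.
- by apply/asboolP; near=> z; apply: differentiableM; near: z.
Unshelve. all: by end_near. Qed.

HB.instance Definition _ :=
  GRing.isSubringClosed.Build ('rV[K]_n -> K) holo0 holo0_subring.

Record holoFun := HoloFun { holo_fun :> 'rV[K]_n -> K; _ : holo_fun \in holo0 }.

HB.instance Definition _ := [isSub for holo_fun].
HB.instance Definition _ := [Choice of holoFun by <:].
HB.instance Definition _ := [SubChoice_isSubComNzRing of holoFun by <:].

Lemma holoFunP (f : holoFun) : \forall z \near (0 : 'rV[K]_n), differentiable f z.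
Proof. by case: f => f /= /asboolP. Qed.

Definition null_germ : {pred holoFun} :=
  fun f => `[< \forall z \near (0 : 'rV[K]_n), f z = 0 >].

Fact null_germ_ideal : idealr_closed null_germ.
Proof.
split=> [||a f g /asboolP hf /asboolP hg].
- by apply/asboolP; near=> z.
- apply/asboolP => /nbhs_singleton h.
  have /eqP : 1 = 0 :> K by exact: h.
  by rewrite oner_eq0.
- apply/asboolP; near=> z.
  have -> : (a * f + g) z = a z * f z + g z by [].
  by rewrite (near hf z) // (near hg z) // mulr0 addr0.
Unshelve. all: by end_near. Qed.

HB.instance Definition _ := isIdealr.Build holoFun null_germ null_germ_ideal.

(* The ring of germs: functions holomorphic near 0, identified when they agree
   on a neighbourhood of 0. *)
Definition germ := {ideal_quot null_germ}.
HB.instance Definition _ := GRing.ComNzRing.on germ.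
HB.instance Definition _ := EqQuotient.on germ.

Definition germ_of (f : holoFun) : germ := \pi_germ f.

Lemma germ_ofP (x : germ) : exists f, x = germ_of f.
Proof. by exists (repr x); rewrite /germ_of reprK. Qed.

Lemma germ_of_eq (f g : holoFun) :
  germ_of f = germ_of g <-> \forall z \near (0 : 'rV[K]_n), f z = g z.
Proof.
rewrite /germ_of; split.
  move=> /eqP; rewrite -Quotient.idealrBE => /asboolP h.
  near=> z; apply/eqP; rewrite -subr_eq0; apply/eqP.
  exact: (near h z).
move=> h; apply/eqP; rewrite -Quotient.idealrBE; apply/asboolP.
by near=> z; apply/eqP; rewrite subr_eq0; apply/eqP; near: z.
Unshelve. all: by end_near. Qed.

Lemma germ_of_is_zmod_morphism : zmod_morphism germ_of.
Proof. by move=> f g; rewrite /germ_of !piE. Qed.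

Lemma germ_of_is_monoid_morphism : monoid_morphism germ_of.
Proof. by split=> [|f g]; rewrite /germ_of !piE. Qed.

HB.instance Definition _ :=
  GRing.isZmodMorphism.Build holoFun germ germ_of germ_of_is_zmod_morphism.
HB.instance Definition _ :=
  GRing.isMonoidMorphism.Build holoFun germ germ_of germ_of_is_monoid_morphism.

End HolomorphicGerms.

Record ringAction (G : groupType) (O : comNzRingType) := RingAction {
  ract :> G -> O -> O;
  ract1 : forall f, ract 1%g f = f;
  ractM : forall g h f, ract (g * h)%g f = ract g (ract h f);
  ractB : forall g, zmod_morphism (ract g);
  ract_mul : forall g, monoid_morphism (ract g)
}.

Record equivModule (G : groupType) (O : comNzRingType) (rho : ringAction G O) :=
  EquivModule {
    emod :> lmodType O;
    eact : G -> emod -> emod;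
    eact1 : forall e, eact 1%g e = e;
    eactM : forall g h e, eact (g * h)%g e = eact g (eact h e);
    eactD : forall g e e', eact g (e + e') = eact g e + eact g e';
    eactZ : forall g f e, eact g (f *: e) = rho g f *: eact g e
  }.

Definition equivariant (G : groupType) (O : comNzRingType) (rho : ringAction G O)
    (M N : equivModule rho) (phi : M -> N) : Prop :=
  forall g e, phi (eact g e) = eact g (phi e).

Definition free_of_rank (O : comNzRingType) (M : lmodType O) (m : nat) : Prop :=
  exists e : {linear M -> 'rV[O]_m}, bijective e.

Section QuotientModule.
Variables (O : comNzRingType) (I : idealr O).

Definition quot_mod := {ideal_quot I}.
HB.instance Definition _ := GRing.ComNzRing.on quot_mod.
HB.instance Definition _ := EqQuotient.on quot_mod.

Definition quot_of (f : O) : quot_mod := \pi_quot_mod f.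
Definition quot_scale (f : O) (x : quot_mod) : quot_mod := quot_of f * x.

Lemma quot_of_is_zmod_morphism : zmod_morphism quot_of.
Proof. by move=> f g; rewrite /quot_of !piE. Qed.
Lemma quot_of_is_monoid_morphism : monoid_morphism quot_of.
Proof. by split=> [|f g]; rewrite /quot_of !piE. Qed.
HB.instance Definition _ :=
  GRing.isZmodMorphism.Build O quot_mod quot_of quot_of_is_zmod_morphism.
HB.instance Definition _ :=
  GRing.isMonoidMorphism.Build O quot_mod quot_of quot_of_is_monoid_morphism.

Fact quot_scaleA a b v : quot_scale a (quot_scale b v) = quot_scale (a * b) v.
Proof. by rewrite /quot_scale rmorphM mulrA. Qed.
Fact quot_scale1 : left_id 1 quot_scale.
Proof. by move=> x; rewrite /quot_scale rmorph1 mul1r. Qed.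
Fact quot_scaleDr : right_distributive quot_scale +%R.
Proof. by move=> a x y; rewrite /quot_scale mulrDr. Qed.
Fact quot_scaleDl v : {morph quot_scale^~ v : a b / a + b}.
Proof. by move=> a b; rewrite /quot_scale rmorphD mulrDl. Qed.

HB.instance Definition _ := GRing.Zmodule_isLmodule.Build O quot_mod
  quot_scaleA quot_scale1 quot_scaleDr quot_scaleDl.

Lemma quot_ofP (x : quot_mod) : exists f, x = quot_of f.
Proof. by exists (repr x); rewrite /quot_of reprK. Qed.

Lemma quot_of_eq (f g : O) : quot_of f = quot_of g <-> f - g \in (I : pred O).
Proof.
by rewrite /quot_of; split=> [/eqP|h]; rewrite -?Quotient.idealrBE //;
  apply/eqP; rewrite -Quotient.idealrBE.
Qed.

Variables (G : groupType) (rho : ringAction G O).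

Definition stable_ideal : Prop := forall g f, f \in (I : pred O) -> rho g f \in (I : pred O).

Definition quot_act (g : G) (x : quot_mod) : quot_mod := quot_of (rho g (repr x)).

Hypothesis stI : stable_ideal.

Lemma quot_actE g f : quot_act g (quot_of f) = quot_of (rho g f).
Proof.
rewrite /quot_act; apply/quot_of_eq; rewrite -(ractB rho).
by apply: stI; apply/quot_of_eq; rewrite /quot_of reprK.
Qed.

Fact quot_act1 x : quot_act 1%g x = x.
Proof. by have [f ->] := quot_ofP x; rewrite quot_actE ract1. Qed.
Fact quot_actM g h x : quot_act (g * h)%g x = quot_act g (quot_act h x).
Proof. by have [f ->] := quot_ofP x; rewrite !quot_actE ractM. Qed.
Fact quot_actD g x y : quot_act g (x + y) = quot_act g x + quot_act g y.
Proof.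
have [f ->] := quot_ofP x; have [f' ->] := quot_ofP y.
rewrite -rmorphD !quot_actE -rmorphD; congr quot_of.
have rN u : rho g (- u) = - rho g u.
  have := ractB rho g 0 u; rewrite !sub0r => ->.
  by rewrite -{1}(subrr 0) (ractB rho) subrr sub0r.
by rewrite -{1}[f']opprK (ractB rho) rN opprK.
Qed.
Fact quot_actZ g f x : quot_act g (f *: x) = rho g f *: quot_act g x.
Proof.
have [f' ->] := quot_ofP x.
have scE a u : a *: quot_of u = quot_of (a * u) by rewrite rmorphM.
by rewrite scE !quot_actE scE (ract_mul rho g).2.
Qed.

Definition quot_equivModule : equivModule rho :=
  @EquivModule G O rho quot_mod quot_act quot_act1 quot_actM quot_actD quot_actZ.

End QuotientModule.

(* An equivariant free resolution
     0 -> F r -> ... -> F 1 -> F 0 -> X -> 0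
   written as a complex indexed by nat, with F i = 0 for i > r; the map called
   [phi i] goes from F (i + 1) to F i.  Exactness at F r thus says that the last
   map is injective. *)
Record is_equiv_free_resolution (G : groupType) (O : comNzRingType)
    (rho : ringAction G O) (X : equivModule rho) (r : nat) (m : nat -> nat)
    (F : nat -> equivModule rho) (phi : forall i, {linear F i.+1 -> F i})
    (pi : {linear F 0%N -> X}) : Prop := {
  res_free : forall i, (i <= r)%N -> free_of_rank (F i) (m i);
  res_bounded : forall i, (r < i)%N -> forall x : F i, x = 0;
  res_equiv : forall i, equivariant (phi i);
  res_aug_equiv : equivariant pi;
  res_aug_surj : forall x : X, exists y, pi y = x;
  res_exact0 : forall x, pi x = 0 <-> exists y, phi 0%N y = x;
  res_exact : forall i x, phi i x = 0 <-> exists y, phi i.+1 y = x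
}.

(* Only the germ of [gact_fun] along G x {0} matters: the action laws are
   identities of germs at 0 of maps (C^n, 0) -> (C^n, 0). *)
Record germAction (K : numFieldType) (d : nat) (G : complexLieGroupType K d) (n : nat) :=
  GermAction {
    gact_fun :> G -> 'rV[K]_n -> 'rV[K]_n;
    gact_holomorphic : forall g : G, \forall p \near ((g, 0) : G * 'rV[K]_n),
      cdifferentiable_at (prod_atlas (atlas G) (model_atlas 'rV[K]_n))
        (model_atlas 'rV[K]_n) (fun q => gact_fun q.1 q.2) p;
    gact_fix0 : forall g, gact_fun g 0 = 0;
    gact_id : \forall z \near (0 : 'rV[K]_n), gact_fun 1%g z = z;
    gact_mul : forall g h : G, \forall z \near (0 : 'rV[K]_n),
      gact_fun (g * h)%g z = gact_fun g (gact_fun h z)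
  }.

Section GermAction.
Variables (K : numFieldType) (d : nat) (G : complexLieGroupType K d) (n : nat).
Variable Phi : germAction G n.
Local Notation Cn := 'rV[K]_n.

Lemma gact_differentiable g : \forall z \near (0 : Cn), differentiable (Phi g) z.
Proof.
have h : \forall z \near (0 : Cn),
    cdifferentiable_at (prod_atlas (atlas G) (model_atlas Cn))
        (model_atlas Cn) (fun q => Phi q.1 q.2) (g, z).
  have /= := gact_holomorphic Phi g.
  by move=> /(cvg_pair (cvg_cst g) (@cvg_id _ (nbhs (0 : Cn)))).
apply: filterS h => z [_ hz].
have [a atl_a ag] := @atlas_cover K d G g.
have /= := hz _ _ (ex_intro _ a (ex_intro _ (model_chart Cn)
  (And3 atl_a erefl erefl))) erefl (conj ag I) I.
move=> dz.
have -> : Phi g = (id \o (fun q => Phi q.1 q.2) \o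
    (fun q : 'rV[K]_d * Cn => (cinv a q.1, q.2))) \o (fun w => (cfun a g, w)).
  by apply/funext => w /=; rewrite cfunK.
by apply: differentiable_comp.
Qed.

Lemma gact_cvg0 g : Phi g z @[z --> (0 : Cn)] --> (0 : Cn).
Proof.
have c : {for (0 : Cn), continuous (Phi g)}.
  exact: differentiable_continuous (nbhs_singleton (gact_differentiable g)).
by move: c; rewrite /prop_for /continuous_at (gact_fix0 Phi).
Qed.

Fact pull_subproof g (f : holoFun K n) : (f \o Phi g) \in @holo0 K n.
Proof.
have hf : \forall z \near (0 : Cn), differentiable f (Phi g z).
  exact: gact_cvg0 (holoFunP f).
apply/asboolP; apply: filterS2 hf (gact_differentiable g) => z dfz dgz.
exact: differentiable_comp dgz dfz.
Qed.

Definition pull g (f : holoFun K n) : holoFun K n := HoloFun (pull_subproof g f).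

(* (g . f)(z) = f (g^-1 . z) *)
Definition germ_act (g : G) (x : germ K n) : germ K n :=
  germ_of (pull g^-1%g (repr x)).

Lemma germ_actE g f : germ_act g (germ_of f) = germ_of (pull g^-1%g f).
Proof.
apply/germ_of_eq => /=.
have : germ_of (repr (germ_of f)) = germ_of f by rewrite /germ_of reprK.
by move=> /germ_of_eq /(@gact_cvg0 g^-1%g).
Qed.

Fact germ_act1 x : germ_act 1%g x = x.
Proof.
have [f ->] := germ_ofP x; rewrite germ_actE; apply/germ_of_eq.
have h := gact_id Phi; rewrite invg1.
by near=> z; rewrite /= (near h z).
Unshelve. all: by end_near. Qed.

Fact germ_actM g h x : germ_act (g * h)%g x = germ_act g (germ_act h x).
Proof.
have [f ->] := germ_ofP x; rewrite !germ_actE; apply/germ_of_eq.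
have e := gact_mul Phi h^-1%g g^-1%g; rewrite invgM.
by near=> z; rewrite /= (near e z).
Unshelve. all: by end_near. Qed.

Fact germ_actB g : zmod_morphism (germ_act g).
Proof.
move=> x y; have [f ->] := germ_ofP x; have [f' ->] := germ_ofP y.
by rewrite -rmorphB !germ_actE -rmorphB; apply/germ_of_eq; near=> z.
Unshelve. all: by end_near. Qed.

Fact germ_act_mul g : monoid_morphism (germ_act g).
Proof.
split=> [|x y].
  by rewrite -(rmorph1 (@germ_of K n)) germ_actE; apply/germ_of_eq; near=> z.
have [f ->] := germ_ofP x; have [f' ->] := germ_ofP y.
by rewrite -rmorphM !germ_actE -rmorphM; apply/germ_of_eq; near=> z.
Unshelve. all: by end_near. Qed.

Definition germ_ringAction : ringAction G (germ K n) :=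
  RingAction germ_act1 germ_actM germ_actB germ_act_mul.

End GermAction.

(* Main.v *)
(* A compact complex Lie group G acts on O = O_{C^n,0} through a finite quotient:
   in a chart the entries of the differential of g at 0 are holomorphic in g, so by
   compactness and the maximum principle they are constant on a nonempty open set,
   and finitely many cosets of N = {h | d(h)_0 = id} cover G.  All powers of h in N
   are bounded on one common ball, so h acts as the identity by Cartan's uniqueness
   theorem.

   O is Noetherian by Weierstrass division.  A stable submodule of an equivariant
   free module is thus covered by the permutation module on the finite set of
   translates of its generators; when it is free, it is its own cover.  The
   coordinates form a regular sequence generating the maximal ideal, each syzygy
   step makes one more of them regular modulo the kernel, and so the kernel becomes
   free after n steps, where the resolution stops.

   The analysis rests on Cauchy's theorem for squares, used to divide f - f(0) by
   the coordinate on a disc without shrinking the disc. *)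

Require Import Defs.
From HB Require Import structures.
From mathcomp Require Import all_boot all_order all_algebra ring_quotient.
From mathcomp Require Import complex.
From mathcomp Require Import all_classical all_reals all_analysis.
From mathcomp Require Import ring lra.

Set Implicit Arguments.
Unset Strict Implicit.
Unset Printing Implicit Defensive.

Import Order.TTheory GRing.Theory Num.Theory.
Import numFieldNormedType.Exports.
Import Normc.

Local Open Scope classical_set_scope.
Local Open Scope complex_scope.
Local Open Scope ring_scope.

Local Notation Re := complex.Re.
Local Notation Im := complex.Im.

(** * Complex integrals *)

(** A permutation module has finite rank only if the translates of a generator form a finite set.
    Every module of the resolution therefore keeps the invariant [st_triv]: elements acting
    trivially on germs act trivially on it, so that coset representatives already produce all
    translates. A free kernel instead receives its action by transport along a basis, whose elements
    may be moved to arbitrary combinations.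

    Taylor coefficients appear throughout as values at 0 of iterated quotients by a coordinate. The
    constant 64 comes from the disc of radius 2: outside radius 1/16 the quotient is at most [2 * M]
    divided by 1/16, that is [32 * M], and rescaling the radius from 2 to [r] multiplies this by
    [2 / r]. Squares serve as contours because their integrals are real integrals over segments, and
    the winding number only has to be bounded away from 0.

    The maximum principle and Cartan's theorem share one mechanism: powers, respectively iterates,
    stay bounded while their leading Taylor term grows linearly with the exponent, so this term is
    0. *)

Section ComplexNorm.
Variable R : realType.
Local Notation C := R[i].
Implicit Types z w : C.

Lemma normc_ge0 z : 0 <= normc z.
Proof. by case: z => a b; exact: sqrtr_ge0. Qed.

Lemma normc_eq0 z : (normc z == 0) = (z == 0).
Proof.
apply/eqP/eqP => [|->]; first exact: eq0_normc.
exact: normc0.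
Qed.

Lemma normc_gt0 z : (0 < normc z) = (z != 0).
Proof. by rewrite lt_def normc_ge0 andbT normc_eq0. Qed.

Lemma le_normcB z w : normc (z - w) <= normc z + normc w.
Proof. by rewrite -(normcN w); exact: le_normcD. Qed.

Lemma normcBC z w : normc (z - w) = normc (w - z).
Proof. by rewrite -normcN opprB. Qed.

Lemma normc_sub_ge z w : normc z - normc w <= normc (z - w).
Proof. by rewrite lerBlDr; have := le_normcD (z - w) w; rewrite subrK. Qed.

Lemma normcX z k : normc (z ^+ k) = normc z ^+ k.
Proof. by elim: k => [|k IH]; rewrite ?normc1 // !exprS normcM IH. Qed.

Lemma normcR (x : R) : normc x%:C = `|x|.
Proof. by rewrite /= expr0n addr0 sqrtr_sqr. Qed.

Lemma normc_nat k : normc (k%:R : C) = k%:R.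
Proof. by rewrite -(rmorph_nat (real_complex R)) normcR ger0_norm. Qed.

Lemma normci z : normc ('i%C * z) = normc z.
Proof. by rewrite normcM /= expr0n expr1n add0r sqrtr1 mul1r. Qed.

Lemma le_Re_normc z : `|Re z| <= normc z.
Proof.
case: z => a b /=; rewrite -sqrtr_sqr ler_wsqrtr // lerDl; exact: sqr_ge0.
Qed.

Lemma le_Im_normc z : `|Im z| <= normc z.
Proof.
case: z => a b /=; rewrite -sqrtr_sqr ler_wsqrtr // lerDr; exact: sqr_ge0.
Qed.

Lemma ComplexE (a b : R) : a +i* b = a%:C + 'i%C * b%:C.
Proof.
by apply/eqP; rewrite eq_complex /=; apply/andP; split; apply/eqP; ring.
Qed.

Lemma le_normc_ReIm (a b : R) : normc (a +i* b) <= `|a| + `|b|.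
Proof.
rewrite ComplexE.
by apply: le_trans (le_normcD _ _) _; rewrite normci !normcR.
Qed.

Lemma real_complexD (x y : R) : (x + y)%:C = x%:C + y%:C.
Proof. exact: rmorphD. Qed.

Lemma real_complexM (x y : R) : (x * y)%:C = x%:C * y%:C.
Proof. exact: rmorphM. Qed.

Lemma real_complexB (x y : R) : (x - y)%:C = x%:C - y%:C.
Proof. exact: rmorphB. Qed.

Lemma normc_small z (B : R) : 0 <= B ->
  (forall e : R, 0 < e -> normc z <= e * B) -> z = 0.
Proof.
move=> B0 h; apply: eq0_normc; apply/eqP; rewrite eq_le normc_ge0 andbT.
apply/ler_addgt0Pl => e e0; rewrite addr0.
apply: le_trans (h (e / (B + 1)) _) _; first by apply: divr_gt0 => //; lra.
by rewrite mulrAC ler_pdivrMr; nra.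
Qed.

End ComplexNorm.

Section Integral.
Variable R : realType.
Local Notation C := R[i].
Local Notation mu := (@lebesgue_measure R).
Implicit Types (phi psi : R -> C) (a b t : R).

(** Continuity is two-sided, even at the end points of a segment: the integrands are restrictions of
    functions continuous in the plane. *)
Definition ccts phi t := forall e : R, 0 < e -> exists2 d : R, 0 < d &
  forall s, `|s - t| < d -> normc (phi s - phi t) < e.

Definition ccts_on a b phi := forall t, a <= t <= b -> ccts phi t.

Definition cint a b phi : C :=
  (\int[mu]_(t in `[a, b]) Re (phi t)) +i* (\int[mu]_(t in `[a, b]) Im (phi t)).

Lemma ccts_part (p : C -> R) phi t : (forall z w, p (z - w) = p z - p w) ->
  (forall z, `|p z| <= normc z) -> ccts phi t ->
  {for t, continuous (fun s => p (phi s))}.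
Proof.
move=> pB ple h; apply/cvgrPdist_lt => e e0.
have [d d0 hd] := h _ e0.
near=> s; rewrite -pB; apply: le_lt_trans (ple _) _.
rewrite normcBC; apply: hd; rewrite distrC.
by near: s; apply: (@cvgr_dist_lt _ _ _ (nbhs t) _ id) => //; exact: cvg_id.
Unshelve. all: by end_near. Qed.

Lemma ReB' (z w : C) : Re (z - w) = Re z - Re w.
Proof. by case: z w => ? ? [? ?]. Qed.
Lemma ImB' (z w : C) : Im (z - w) = Im z - Im w.
Proof. by case: z w => ? ? [? ?]. Qed.

Lemma ccts_integrable (p : C -> R) phi a b : (forall z w, p (z - w) = p z - p w) ->
  (forall z, `|p z| <= normc z) -> ccts_on a b phi ->
  mu.-integrable `[a, b] (EFin \o (fun s => p (phi s))).
Proof.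
move=> pB ple h; apply: continuous_compact_integrable; first exact: segment_compact.
apply: continuous_in_subspaceT => t; rewrite inE /= in_itv /= => /h.
exact: ccts_part.
Qed.

Let Rei phi a b := @ccts_integrable _ phi a b ReB' (@le_Re_normc R).
Let Imi phi a b := @ccts_integrable _ phi a b ImB' (@le_Im_normc R).

Lemma cintD a b phi psi : ccts_on a b phi -> ccts_on a b psi ->
  cint a b (fun t => phi t + psi t) = cint a b phi + cint a b psi.
Proof.
move=> h k; apply/eqP; rewrite eq_complex /= -!RintegralD //; last 4 first.
- exact: Imi.
- exact: Imi.
- exact: Rei.
- exact: Rei.
by apply/andP; split; apply/eqP; apply: eq_Rintegral => t _; case: (phi t) (psi t) => ? ? [].
Qed.

Lemma cintZ a b c phi : ccts_on a b phi ->
  cint a b (fun t => c * phi t) = c * cint a b phi.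
Proof.
move=> h; have hR := Rei h; have hI := Imi h.
have mD : measurable (`[a, b] : set (measurableTypeR R)) by exact: measurable_itv.
case: c => c d; apply/eqP; rewrite eq_complex /=; apply/andP; split; apply/eqP.
- rewrite -!RintegralZl // -RintegralB //; last 2 first.
  + exact: (integrableZl mD c hR).
  + exact: (integrableZl mD d hI).
  by apply: eq_Rintegral => t _; case: (phi t).
- rewrite -!RintegralZl // -RintegralD //; last 2 first.
  + exact: (integrableZl mD c hI).
  + exact: (integrableZl mD d hR).
  by apply: eq_Rintegral => t _; case: (phi t).
Qed.

Lemma cint_split a b c phi : a <= c -> c <= b -> ccts_on a b phi ->
  cint a b phi = cint a c phi + cint c b phi.
Proof.
move=> ac cb h.
have key (p : C -> R) : (forall z w, p (z - w) = p z - p w) ->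
    (forall z, `|p z| <= normc z) ->
  \int[mu]_(t in `[a, b]) p (phi t) = \int[mu]_(t in `[a, c]) p (phi t) +
     \int[mu]_(t in `[c, b]) p (phi t).
  move=> pB ple; have hi := ccts_integrable pB ple h.
  rewrite -(Rintegral_itv_obnd_cbnd (r := c)); last first.
    by apply: integrableS hi => //; move=> x /=; rewrite !in_itv /= => /andP[? ->]; rewrite andbT; lra.
  by rewrite -(Rintegral_itvB hi (x := c)) ?bnd_simp //; lra.
apply/eqP; rewrite eq_complex /= (key (@Re R)) ?(key (@Im R)) ?eqxx //.
- exact: ImB'.
- exact: le_Im_normc.
- exact: ReB'.
- exact: le_Re_normc.
Qed.

Lemma cint_cst a b c : a <= b -> cint a b (fun _ => c) = (b - a)%:C * c.
Proof.
move=> ab; case: c => c d; apply/eqP; rewrite eq_complex /= !Rintegral_cst //=.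
rewrite !lebesgue_measure_itv /= !mul0r subr0 addr0 !lte_fin.
have [->|] := eqVneq a b; first by rewrite ltxx subrr !mulr0 !mul0r !eqxx.
by move=> nab; rewrite lt_neqAle nab ab /= mulrC eqxx mulrC eqxx.
Qed.

(** The map [p] stands for plus or minus the real or imaginary part, so that this single lower bound
    yields both sides of both estimates in [cint_le]. *)
Lemma cint_ge (p : C -> R) a b phi m : (forall z w, p (z - w) = p z - p w) ->
  (forall z, `|p z| <= normc z) -> a <= b -> ccts_on a b phi ->
  (forall t, a <= t <= b -> m <= p (phi t)) ->
  m * (b - a) <= \int[mu]_(t in `[a, b]) p (phi t).
Proof.
move=> pB ple ab h hm; have hi := ccts_integrable pB ple h.
have -> : m * (b - a) = \int[mu]_(t in `[a, b]) m.
  rewrite Rintegral_cst //= lebesgue_measure_itv /= lte_fin.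
  have [->|nab] := eqVneq a b; first by rewrite ltxx subrr.
  by rewrite lt_neqAle nab ab.
have hc : mu.-integrable `[a, b] (EFin \o (fun _ : R => m)).
  apply: continuous_compact_integrable; first exact: segment_compact.
  by apply: continuous_in_subspaceT => t _; exact: cvg_cst.
by apply: (le_Rintegral _ hc hi) => // x /=; rewrite in_itv /= => /hm.
Qed.

(** The factor 2 is the price of estimating real and imaginary parts separately; it only affects
    numerical constants. *)
Lemma cint_le a b phi M : a <= b -> ccts_on a b phi ->
  (forall t, a <= t <= b -> normc (phi t) <= M) ->
  normc (cint a b phi) <= 2 * M * (b - a).
Proof.
move=> ab h hM; apply: le_trans (le_normc_ReIm _ _) _.
have key (p : C -> R) : (forall z w, p (z - w) = p z - p w) ->
    (forall z, `|p z| <= normc z) ->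
   `|\int[mu]_(t in `[a, b]) p (phi t)| <= M * (b - a).
  move=> pB ple; rewrite ler_norml -mulNr; apply/andP; split.
    apply: (cint_ge pB ple ab h) => t /hM; have := ple (phi t).
    by rewrite ler_norml => /andP[? ?]; lra.
  rewrite -lerN2 -mulNr.
  have pB' z w : - p (z - w) = - p z - - p w by rewrite pB opprD.
  have := @cint_ge (fun z => - p z) a b phi (- M) pB'.
  have -> : \int[mu]_(t in `[a, b]) - p (phi t) = - \int[mu]_(t in `[a, b]) p (phi t).
    under eq_Rintegral do rewrite -mulN1r.
    rewrite RintegralZl ?mulN1r //.
    exact: ccts_integrable pB ple h.
  apply=> //; first by move=> z; rewrite normrN.
  by move=> t /hM; have := ple (phi t); rewrite ler_norml => /andP[? ?]; lra.
have := key _ ReB' (@le_Re_normc R); have := key _ ImB' (@le_Im_normc R).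
lra.
Qed.

End Integral.

Lemma addrDB (V : zmodType) (z h : V) : z + h - z = h.
Proof. by rewrite addrAC subrr add0r. Qed.

(** * Real-valued norms, limits with explicit error, Frechet derivatives *)

Section RealNorm.
Variable R : realType.
Local Notation C := R[i].
Variable V : normedModType C.
Implicit Types (x y h : V).

(** Norms of modules over [C] take values in [C]; the real part is the same number in the ordered
    field [R]. *)
Definition nm x : R := Re `|x|.

Lemma nmE x : `|x| = (nm x)%:C.
Proof. by rewrite /nm RRe_real // normr_real. Qed.

Lemma nm_ge0 x : 0 <= nm x.
Proof. by rewrite -(lecR 0) -nmE normr_ge0. Qed.

Lemma nmD x y : nm (x + y) <= nm x + nm y.
Proof. by rewrite -lecR real_complexD -!nmE ler_normD. Qed.

Lemma nmN x : nm (- x) = nm x.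
Proof. by rewrite /nm normrN. Qed.

Lemma nmZ (a : C) x : nm (a *: x) = normc a * nm x.
Proof.
by rewrite /nm normrZ nmE normc_def -real_complexM; case: a.
Qed.

Lemma nm0 : nm 0 = 0.
Proof. by rewrite /nm normr0. Qed.

Lemma nm_eq0 x : (nm x == 0) = (x == 0).
Proof.
apply/eqP/eqP => [h|->]; last exact: nm0.
by apply/eqP; rewrite -normr_eq0 nmE h.
Qed.

Lemma nm_gt0 x : (0 < nm x) = (x != 0).
Proof. by rewrite lt_def nm_ge0 andbT nm_eq0. Qed.

Lemma near_nmP x (P : V -> Prop) : (\forall y \near x, P y) <->
  exists2 d : R, 0 < d & forall y, nm (y - x) < d -> P y.
Proof.
split.
  move=> /(@nbhs_normP C V x)[/= d d0 hd].
  have dE : d = (Re d)%:C by rewrite RRe_real // gtr0_real.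
  exists (Re d); first by rewrite -ltcR -dE.
  by move=> y hy; apply: hd => /=; rewrite distrC nmE dE ltcR.
move=> [d d0 hd]; apply/(@nbhs_normP C V x); exists d%:C => /=.
  by rewrite ltcR.
by move=> y /=; rewrite distrC nmE ltcR; exact: hd.
Qed.

Lemma near0P (P : V -> Prop) : (\forall x \near (0 : V), P x) <->
  exists2 d : R, 0 < d & forall x, nm x < d -> P x.
Proof.
split=> [/near_nmP[d d0 hd]|[d d0 hd]]; last apply/near_nmP.
  by exists d => // x hx; apply: hd; rewrite subr0.
by exists d => // x; rewrite subr0; exact: hd.
Qed.

Lemma near0_forall n (Q : 'I_n -> V -> Prop) :
  (forall i, exists2 d : R, 0 < d & forall x, nm x < d -> Q i x) ->
  exists2 d : R, 0 < d & forall x, nm x < d -> forall i, Q i x.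
Proof.
by move=> hQ; apply/near0P; apply: filter_forall => i; exact/near0P.
Qed.

End RealNorm.

Section Complete.
Variable R : realType.

(** The intervals of centre [u k] and radius [c k] meet pairwise, so the supremum of their left ends
    lies in all of them. *)
Lemma real_dist_limit (u c : nat -> R) :
  (forall j k, `|u j - u k| <= c j + c k) -> exists l, forall k, `|u k - l| <= c k.
Proof.
move=> h.
have H j k : u j - c j <= u k + c k.
  by have := h j k; rewrite ler_norml => /andP[_]; lra.
exists (sup (range (fun j => u j - c j))) => k.
have ub : has_ubound (range (fun j => u j - c j)).
  by exists (u 0%N + c 0%N) => _ [j _ <-].
have l1 : u k - c k <= sup (range (fun j => u j - c j)).
  by apply: ub_le_sup => //; exists k.
have l2 : sup (range (fun j => u j - c j)) <= u k + c k.
  by apply: ge_sup => [|_ [j _ <-]] //; exists (u 0%N - c 0%N); exists 0%N.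
by rewrite ler_norml; lra.
Qed.

Lemma complex_dist_limit (u : nat -> R[i]) (c : nat -> R) :
  (forall j k, normc (u j - u k) <= c j + c k) ->
  exists l, forall k, normc (u k - l) <= 2 * c k.
Proof.
move=> h.
have [a ha] : exists l, forall k, `|Re (u k) - l| <= c k.
  apply: (@real_dist_limit (fun j => Re (u j))) => j k.
  by rewrite -ReB'; apply: le_trans (h j k); exact: le_Re_normc.
have [b hb] : exists l, forall k, `|Im (u k) - l| <= c k.
  apply: (@real_dist_limit (fun j => Im (u j))) => j k.
  by rewrite -ImB'; apply: le_trans (h j k); exact: le_Im_normc.
exists (a +i* b) => k; move: (ha k) (hb k); case: (u k) => x y /= h1 h2.
by have := le_normc_ReIm (x - a) (y - b); rewrite /=; lra.
Qed.

Lemma le_eps_nat (x y c : R) : (forall k : nat, x <= y + c / k.+1%:R) -> x <= y.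
Proof.
move=> h; apply/ler_addgt0Pl => e e0; have c0 : 0 < `|c| + 1 by rewrite ltr_wpDl.
have [k /= hk] := filter_ex (near_infty_natSinv_lt (PosNum (divr_gt0 e0 c0))).
apply: le_trans (h k) _; rewrite addrC lerD2r; move: hk; rewrite ltr_pdivlMr // => hk.
have k0 : 0 <= k.+1%:R^-1 :> R by rewrite invr_ge0.
have h1 := ler_wpM2r k0 (ler_norm c).
move: hk h1 k0; set u := _^-1; clear; nra.
Qed.

End Complete.

Section Frechet.
Variable R : realType.
Local Notation C := R[i].

(** An unbundled predicate, because derivatives also arise as pointwise limits picked by choice. *)
Definition clinear (V W : lmodType C) (L : V -> W) := forall a u v, L (a *: u + v) = a *: L u + L v.

Lemma clinear0 (V W : lmodType C) (L : V -> W) : clinear L -> L 0 = 0.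
Proof.
move=> hL; have := hL 1 0 0; rewrite !scale1r addr0 => /eqP.
by rewrite -subr_eq subrr eq_sym => /eqP.
Qed.

Lemma clinearD (V W : lmodType C) (L : V -> W) u v : clinear L -> L (u + v) = L u + L v.
Proof. by move=> hL; have := hL 1 u v; rewrite !scale1r. Qed.

Lemma clinearZ (V W : lmodType C) (L : V -> W) a u : clinear L -> L (a *: u) = a *: L u.
Proof. by move=> hL; have := hL a u 0; rewrite (clinear0 hL) !addr0. Qed.

Lemma clinearB (V W : lmodType C) (L : V -> W) u v : clinear L -> L (u - v) = L u - L v.
Proof. by move=> hL; rewrite clinearD // -scaleN1r clinearZ // scaleN1r. Qed.

Variable V : normedModType C.
Implicit Types (F G : V -> C) (L : V -> C^o) (x y h : V).

(** Complex Frechet differentiability with real epsilons, equivalent to [differentiable] by [cdfP];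
    the bound on [L] expresses its continuity. *)
Definition cfder F x L := [/\ clinear L, exists B : R, forall h, normc (L h) <= B * nm h &
  forall e : R, 0 < e -> exists2 d : R, 0 < d &
    forall h, nm h < d -> normc (F (x + h) - F x - L h) <= e * nm h].

Definition cdf F x := exists L, cfder F x L.

Lemma nm_normc (z : C) : nm (z : C^o) = normc z.
Proof. by rewrite /nm normc_def; case: z. Qed.

Let pack_linear (L : V -> C^o) (lf : linear L) : {linear V -> C^o} :=
  HB.pack L (GRing.isLinear.Build _ _ _ _ _ lf).

Lemma differentiable_cfder F x :
  differentiable (F : V -> C^o) x -> cfder F x ('d (F : V -> C^o) x).
Proof.
move=> df; have /diff_locallyP [cdL hdL] := df; split.
- by move=> a u v; rewrite linearP.
- have /linear_boundedP [y [yr hy]] := continuous_linear_bounded 0 (cdL 0).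
  exists (Re (y + 1)) => h; rewrite -lecR real_complexM -[normc _]nm_normc -!nmE.
  have yr1 : y + 1 \is Num.real by apply: realD => //; exact: real1.
  rewrite RRe_real //; apply: hy => //.
  by rewrite ltrDl.
- move=> e e0; move: hdL => /eqaddoP /(_ e%:C); rewrite ltcR => /(_ e0).
  move=> /near_nmP[d d0 hd]; exists d => // h hh.
  have := hd h; rewrite subr0 => /(_ hh).
  rewrite nmE nm_normc nmE -real_complexM lecR; apply: le_trans.
  by rewrite /= !fctE opprD addrA [h + x]addrC.
Qed.

Lemma cfder_differentiable F x L : cfder F x L ->
  differentiable (F : V -> C^o) x /\ 'd (F : V -> C^o) x = L :> (V -> C^o).
Proof.
move=> [linL [B hB] hL]; pose D := @pack_linear L linL.
have cD : continuous D.
  apply: bounded_linear_continuous; apply/linear_boundedP.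
  near=> r => h /=; apply: (@le_trans _ _ (B * nm h)%:C).
    by rewrite nmE nm_normc lecR.
  rewrite real_complexM -nmE; apply: ler_wpM2r; first exact: normr_ge0.
  near: r; apply: nbhs_pinfty_ge.
  by apply/complex_realP; exists B.
have hD : (F : V -> C^o) \o shift x = cst (F x : C^o) + D +o_ 0 id.
  apply/eqaddoP => e e0.
  have eE : e = (Re e)%:C by rewrite RRe_real // gtr0_real.
  have [|d d0 hd] := hL (Re e); first by rewrite -ltcR -eE.
  apply/near_nmP; exists d => // h; rewrite subr0 => /hd H.
  rewrite eE nmE nm_normc nmE -real_complexM lecR; apply: le_trans H.
  by rewrite /= !fctE opprD addrA [h + x]addrC.
have dE := diff_unique cD hD; split; last by rewrite dE.
by apply/diff_locallyP; rewrite dE; split.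
Unshelve. all: by end_near. Qed.

Lemma cdfP F x : cdf F x <-> differentiable (F : V -> C^o) x.
Proof.
split=> [[L /cfder_differentiable[]] //|/differentiable_cfder h].
by exists ('d (F : V -> C^o) x).
Qed.

Lemma cfder_near F G x L (d : R) : 0 < d -> (forall y, nm (y - x) < d -> F y = G y) ->
  cfder F x L -> cfder G x L.
Proof.
move=> d0 FG [linL bL hL]; split => // e /hL[d' d'0 hd'].
exists (Num.min d d'); first by rewrite lt_min d0.
move=> h; rewrite lt_min => /andP[u /hd']; rewrite !FG //.
  by rewrite subrr nm0.
by rewrite addrDB.
Qed.

Lemma cfder_uniq F x L L' : cfder F x L -> cfder F x L' -> L = L'.
Proof. by move=> /cfder_differentiable[_ <-] /cfder_differentiable[_ <-]. Qed.

End Frechet.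

Section Calculus.
Variable R : realType.
Local Notation C := R[i].
Variables V W : normedModType C.
Implicit Types (F G : V -> C) (x y h : V).

Lemma cdf_cst (c : C) x : cdf (fun _ : V => c) x.
Proof. by apply/cdfP; exact: (@differentiable_cst C V C^o). Qed.

Lemma cdfD F G x : cdf F x -> cdf G x -> cdf (fun y => F y + G y) x.
Proof.
move=> /cdfP hF /cdfP hG; apply/cdfP.
exact: (@differentiableD C V C^o F G x hF hG).
Qed.

Lemma cdfM F G x : cdf F x -> cdf G x -> cdf (fun y => F y * G y) x.
Proof.
move=> /cdfP hF /cdfP hG; apply/cdfP.
exact: (@differentiableM C V F G x hF hG).
Qed.

Lemma cdfN F x : cdf F x -> cdf (fun y => - F y) x.
Proof.
move=> /cdfP hF; apply/cdfP; exact: (@differentiableN C V C^o F x hF).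
Qed.

Lemma cdfB F G x : cdf F x -> cdf G x -> cdf (fun y => F y - G y) x.
Proof. by move=> hF hG; apply: cdfD => //; exact: cdfN. Qed.

Lemma cdfV F x : F x != 0 -> cdf F x -> cdf (fun y => (F y)^-1) x.
Proof.
move=> nz /cdfP hF; apply/cdfP; exact: (@differentiableV C V F x hF nz).
Qed.

Lemma cdfX F x k : cdf F x -> cdf (fun y => F y ^+ k) x.
Proof.
move=> hF; elim: k => [|k IH]; first exact: cdf_cst.
by have := cdfM hF IH; congr cdf; apply/funext => y; rewrite exprS.
Qed.

Lemma cdf_sum (I : Type) (s : seq I) (f : I -> V -> C) x :
  (forall i, cdf (f i) x) -> cdf (fun y => \sum_(i <- s) f i y) x.
Proof.
move=> hf; elim: s => [|i s IH].
  by have := cdf_cst 0 x; congr cdf; apply/funext => y; rewrite big_nil.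
by have := cdfD (hf i) IH; congr cdf; apply/funext => y; rewrite big_cons.
Qed.

(** The chain rule for an affine inner map with bounded linear part [T0]: translations, dilations,
    projections and slices all have this form. The bound is replaced by [b >= 1] so that one may
    divide by it. *)
Lemma cdf_affine (T T0 : V -> W) (F : W -> C) x (B : R) :
  clinear T0 -> (forall h, nm (T0 h) <= B * nm h) ->
  (forall h, T (x + h) = T x + T0 h) -> cdf F (T x) -> cdf (fun y => F (T y)) x.
Proof.
move=> lT bT hT [L [linL [B' hB'] hL]].
pose b := Num.max B 1; have b0 : 0 < b by rewrite lt_max ltr01 orbT.
have bT' h : nm (T0 h) <= b * nm h.
  by apply: le_trans (bT h) _; rewrite ler_wpM2r ?nm_ge0 // le_max lexx.
pose b' := Num.max B' 0; have b'0 : 0 <= b' by rewrite le_max lexx orbT.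
exists (fun h => L (T0 h)); split.
- by move=> a u v; rewrite lT linL.
- exists (b' * b) => h; apply: le_trans (hB' _) _; apply: (@le_trans _ _ (b' * nm (T0 h))).
    by rewrite ler_wpM2r ?nm_ge0 // le_max lexx.
  by rewrite -mulrA ler_wpM2l.
- move=> e e0; have [|d d0 hd] := hL (e / b); first exact: divr_gt0.
  exists (d / b); first exact: divr_gt0.
  move=> h; rewrite ltr_pdivlMr // => hh; rewrite hT.
  have bh := bT' h; have /hd H : nm (T0 h) < d by lra.
  apply: le_trans H _; rewrite mulrAC ler_pdivrMr //; have := nm_ge0 h; nra.
Qed.

Lemma cfder_lin (L : V -> C) x (B : R) : clinear (L : V -> C^o) ->
  (forall h, normc (L h) <= B * nm h) -> cfder L x L.
Proof.
move=> lL hB; split => //; first by exists B.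
move=> e e0; exists 1 => // h _; rewrite (clinearD _ _ lL).
by rewrite [L x + L h]addrC addrK subrr normc0 mulr_ge0 ?nm_ge0 // ltW.
Qed.

Lemma cdf_lin (L : V -> C) x (B : R) : clinear (L : V -> C^o) ->
  (forall h, normc (L h) <= B * nm h) -> cdf L x.
Proof. by move=> lL hB; exists L; exact: cfder_lin hB. Qed.

Lemma cfder_cts F x L : cfder F x L -> exists B : R, exists2 d : R, 0 < d &
  forall h, nm h < d -> normc (F (x + h) - F x) <= B * nm h.
Proof.
move=> [_ [B hB] hL]; have [d d0 hd] := hL 1 ltr01.
exists (B + 1), d => // h /hd H.
have := le_normcD (F (x + h) - F x - L h) (L h); rewrite subrK.
have := hB h; lra.
Qed.

Lemma cdf_cts F x : cdf F x -> forall e : R, 0 < e -> exists2 d : R, 0 < d &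
  forall h, nm h < d -> normc (F (x + h) - F x) < e.
Proof.
move=> [L /cfder_cts[B [d d0 hd]]] e e0.
pose b := Num.max B 1; have b0 : 0 < b by rewrite lt_max ltr01 orbT.
exists (Num.min d (e / b)); first by rewrite lt_min d0 divr_gt0.
move=> h; rewrite lt_min ltr_pdivlMr // => /andP[/hd H h2].
apply: le_lt_trans H _; apply: le_lt_trans h2; rewrite mulrC.
by rewrite ler_wpM2l ?nm_ge0 // le_max lexx.
Qed.

Lemma cdf_near F G x (d : R) : 0 < d -> (forall y, nm (y - x) < d -> F y = G y) ->
  cdf F x -> cdf G x.
Proof. by move=> d0 FG [L hL]; exists L; exact: cfder_near d0 FG hL. Qed.

End Calculus.

(** * Cauchy's theorem on squares *)

Lemma exists_lt_exp2 (R : realType) (M : R) : exists k, M < 2 ^+ k.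
Proof. by exists (Num.bound M); exact: upper_nthrootP. Qed.

(* A property of rectangles that passes from the four quarters of a rectangle to
   the rectangle holds as soon as it holds locally: otherwise repeated quartering
   produces nested counterexamples shrinking to a point. *)
Lemma rect_cousin (R : realType) (P : R -> R -> R -> R -> Prop) (x1 x2 y1 y2 : R) :
  x1 <= x2 -> y1 <= y2 ->
  (forall a b c d, a <= b -> c <= d -> x1 <= a -> b <= x2 -> y1 <= c -> d <= y2 ->
     P a ((a + b) / 2) c ((c + d) / 2) -> P ((a + b) / 2) b c ((c + d) / 2) ->
     P a ((a + b) / 2) ((c + d) / 2) d -> P ((a + b) / 2) b ((c + d) / 2) d ->
     P a b c d) ->
  (forall p q, x1 <= p <= x2 -> y1 <= q <= y2 -> exists2 e : R, 0 < e &
     forall a b c d, x1 <= a -> b <= x2 -> y1 <= c -> d <= y2 ->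
       a <= p <= b -> c <= q <= d -> b - a < e -> d - c < e -> P a b c d) ->
  P x1 x2 y1 y2.
Proof.
move=> hx hy hsplit hloc; apply: contrapT => nP.
pose w k : R := (x2 - x1) / 2 ^+ k; pose h k : R := (y2 - y1) / 2 ^+ k.
have w2 k : w k = 2 * w k.+1 by rewrite /w exprS; field; rewrite expf_neq0.
have h2 k : h k = 2 * h k.+1 by rewrite /h exprS; field; rewrite expf_neq0.
have w0 k : 0 <= w k by rewrite divr_ge0 ?exprn_ge0 //; lra.
have h0 k : 0 <= h k by rewrite divr_ge0 ?exprn_ge0 //; lra.
(* A rectangle of generation [k] has sides [w k] and [h k], so its lower left corner determines
   it. *)
pose good k (s : R * R) := [/\ x1 <= s.1, s.1 + w k <= x2, y1 <= s.2, s.2 + h k <= y2 &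
   ~ P s.1 (s.1 + w k) s.2 (s.2 + h k)].
have step (ks : nat * (R * R)) : exists s' : R * R, good ks.1 ks.2 ->
    [/\ good ks.1.+1 s', ks.2.1 <= s'.1, s'.1 + w ks.1.+1 <= ks.2.1 + w ks.1,
     ks.2.2 <= s'.2 & s'.2 + h ks.1.+1 <= ks.2.2 + h ks.1].
  case: ks => k [x y] /=.
  have [|ng] := pselect (good k (x, y)); last by exists (0, 0).
  case=> /= gx1 gx2 gy1 gy2 nPk.
  have := hsplit x (x + w k) y (y + h k).
  have -> : (x + (x + w k)) / 2 = x + w k.+1 by rewrite w2; field.
  have -> : (y + (y + h k)) / 2 = y + h k.+1 by rewrite h2; field.
  have ww := w0 k.+1; have hh := h0 k.+1; have wk := w2 k; have hk := h2 k.
  have -> : x + w k = x + w k.+1 + w k.+1 by rewrite w2; ring.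
  have -> : y + h k = y + h k.+1 + h k.+1 by rewrite h2; ring.
  move=> hs.
  (* Any quarter on which [P] fails can serve as the next rectangle; if [P] held on all four,
     [hsplit] would give it on the whole. *)
  have wit x' y' : ~ P x' (x' + w k.+1) y' (y' + h k.+1) -> x <= x' -> x' <= x + w k.+1 ->
      y <= y' -> y' <= y + h k.+1 -> exists s' : R * R, good k (x, y) -> [/\ good k.+1 s',
        x <= s'.1, s'.1 + w k.+1 <= x + w k.+1 + w k.+1, y <= s'.2
        & s'.2 + h k.+1 <= y + h k.+1 + h k.+1].
    move=> nP' ? ? ? ?; exists (x', y') => _; clear hs hsplit hloc nPk.
    by split; rewrite /good /=; try split => //; lra.
  have [p1|/wit] := pselect (P x (x + w k.+1) y (y + h k.+1)); last by apply; lra.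
  have [p2|/wit] := pselect (P (x + w k.+1) (x + w k.+1 + w k.+1) y (y + h k.+1)); last by apply; lra.
  have [p3|/wit] := pselect (P x (x + w k.+1) (y + h k.+1) (y + h k.+1 + h k.+1)); last by apply; lra.
  have [p4|/wit] := pselect (P (x + w k.+1) (x + w k.+1 + w k.+1) (y + h k.+1) (y + h k.+1 + h k.+1));
    last by apply; lra.
  exfalso; apply: nPk; rewrite w2 h2.
  have -> : x + 2 * w k.+1 = x + w k.+1 + w k.+1 by ring.
  have -> : y + 2 * h k.+1 = y + h k.+1 + h k.+1 by ring.
  by apply: hs => //; lra.
have [nx hnx] := choice step.
pose s := fix s k : R * R := if k is k'.+1 then nx (k', s k') else (x1, y1).
have gs k : good k (s k).
  elim: k => [|k IH]; last by have [] := hnx (k, s k) IH.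
  have -> : s 0%N = (x1, y1) by [].
  rewrite /good /= /w /h expr0 !divr1 (_ : x1 + _ = x2); last by ring.
  by rewrite (_ : y1 + _ = y2); last by ring.
have ss k : [/\ (s k).1 <= (s k.+1).1, (s k.+1).1 + w k.+1 <= (s k).1 + w k,
     (s k).2 <= (s k.+1).2 & (s k.+1).2 + h k.+1 <= (s k).2 + h k].
  by have [] := hnx (k, s k) (gs k).
have fa k : (s k).1 <= (s k.+1).1 by have [] := ss k.
have fb k : (s k.+1).1 + w k.+1 <= (s k).1 + w k by have [] := ss k.
have fc k : (s k).2 <= (s k.+1).2 by have [] := ss k.
have fd k : (s k.+1).2 + h k.+1 <= (s k).2 + h k by have [] := ss k.
clear ss hsplit step hnx.
have mono (f g : nat -> R) : (forall k, f k <= f k.+1) -> (forall k, g k.+1 <= g k) ->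
    (forall k, f k <= g k) -> exists p, forall k, f k <= p <= g k.
  move=> hf hg fg.
  have fm : {homo f : j k / (j <= k)%N >-> j <= k} by apply/nondecreasing_seqP.
  have gm : {homo g : j k / (j <= k)%N >-> k <= j} by apply/nonincreasing_seqP.
  have fgjk j k : f j <= g k.
    case: (leqP j k) => [jk|/ltnW kj]; first exact: le_trans (fm _ _ jk) (fg _).
    exact: le_trans (fg _) (gm _ _ kj).
  exists (sup (range f)) => k; apply/andP; split.
    apply: ub_le_sup; last by exists k.
    by exists (g k) => _ [j _ <-].
  by apply: ge_sup => [|_ [j _ <-]]; [exists (f 0%N); exists 0%N|].
have [p hp] : exists p, forall k, (s k).1 <= p <= (s k).1 + w k.
  by apply: (mono _ _ fa fb) => k; rewrite lerDl.
have [q hq] : exists q, forall k, (s k).2 <= q <= (s k).2 + h k.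
  by apply: (mono _ _ fc fd) => k; rewrite lerDl.
have hp0 : x1 <= p <= x2 by have := hp 0%N; rewrite /= /w expr0 divr1; lra.
have hq0 : y1 <= q <= y2 by have := hq 0%N; rewrite /= /h expr0 divr1; lra.
have [e e0 he] := hloc p q hp0 hq0.
have [k hk] := exists_lt_exp2 ((x2 - x1 + (y2 - y1)) / e).
have [g1 g2 g3 g4] := gs k; apply.
have k0 : 0 < 2 ^+ k :> R by rewrite exprn_gt0.
move: hk; rewrite ltr_pdivrMr // => hk.
apply: he => //; rewrite addrAC subrr add0r /w /h ltr_pdivrMr //; lra.
Qed.

Section Rectangles.
Variable R : realType.
Local Notation C := R[i].
Implicit Types (f g : C -> C) (z w h : C).

Definition cder f z (a : C) := forall e : R, 0 < e -> exists2 d : R, 0 < d &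
  forall h, normc h < d -> normc (f (z + h) - f z - a * h) <= e * normc h.

Definition zcts f z := forall e : R, 0 < e -> exists2 d : R, 0 < d &
  forall h, normc h < d -> normc (f (z + h) - f z) < e.

Lemma cderP f z a : cder f z a <-> cfder (f : C^o -> C) z (fun h => a * h : C^o).
Proof.
split=> [ha|[_ _ hL]].
  split.
  - by move=> c u v; rewrite mulrDr -[c *: u]/(c * u) mulrCA.
  - by exists (normc a) => h; rewrite nm_normc normcM.
  - by move=> e /ha[d d0 hd]; exists d => // h; rewrite nm_normc; exact: hd.
by move=> e /hL[d d0 hd]; exists d => // h hh; have := hd h; rewrite nm_normc; exact.
Qed.

Lemma cder_zcts f z a : cder f z a -> zcts f z.
Proof.
move=> /cderP h e e0; have [d d0 hd] := @cdf_cts R C^o f z (ex_intro _ _ h) e e0.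
by exists d => // k; rewrite -nm_normc; exact: hd.
Qed.

Lemma zcts_horiz f x y : zcts f (x +i* y) -> ccts (fun t => f (t +i* y)) x.
Proof.
move=> h e /h[d d0 hd]; exists d => // s hs.
have := hd (s - x)%:C; rewrite normcR => /(_ hs).
suff -> : (x +i* y) + (s - x)%:C = s +i* y by [].
by apply/eqP; rewrite eq_complex /=; apply/andP; split; apply/eqP; ring.
Qed.

Lemma zcts_vert f x y : zcts f (x +i* y) -> ccts (fun t => f (x +i* t)) y.
Proof.
move=> h e /h[d d0 hd]; exists d => // s hs.
have := hd ('i%C * (s - y)%:C); rewrite normci normcR => /(_ hs).
suff -> : (x +i* y) + 'i%C * (s - y)%:C = x +i* s by [].
by apply/eqP; rewrite eq_complex /=; apply/andP; split; apply/eqP; ring.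
Qed.

Lemma cctsB (phi psi : R -> C) t : ccts phi t -> ccts psi t ->
  ccts (fun s => phi s - psi s) t.
Proof.
move=> h k e e0; have e20 : 0 < e / 2 by lra.
have [d d0 hd] := h _ e20; have [d' d'0 hd'] := k _ e20.
exists (Num.min d d'); first by rewrite lt_min d0.
move=> s; rewrite lt_min => /andP[/hd a /hd' b].
rewrite (_ : _ - _ = (phi s - phi t) - (psi s - psi t)); last by ring.
apply: le_lt_trans (le_normcB _ _) _; lra.
Qed.

(** The counterclockwise contour integral of [f(z) dz], with opposite sides grouped. *)
Definition rint f (x1 x2 y1 y2 : R) : C :=
  cint x1 x2 (fun x => f (x +i* y1) - f (x +i* y2)) +
  'i%C * cint y1 y2 (fun y => f (x2 +i* y) - f (x1 +i* y)).

Definition horiz_cts f x1 x2 y := forall x, x1 <= x <= x2 -> zcts f (x +i* y).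
Definition vert_cts f x y1 y2 := forall y, y1 <= y <= y2 -> zcts f (x +i* y).
Definition bdy_cts f x1 x2 y1 y2 :=
  [/\ horiz_cts f x1 x2 y1, horiz_cts f x1 x2 y2, vert_cts f x1 y1 y2
    & vert_cts f x2 y1 y2].

Lemma horiz_ccts f x1 x2 y y' : horiz_cts f x1 x2 y -> horiz_cts f x1 x2 y' ->
  ccts_on x1 x2 (fun x => f (x +i* y) - f (x +i* y')).
Proof. by move=> h k t ht; apply: cctsB; apply: zcts_horiz; [exact: h|exact: k]. Qed.

Lemma vert_ccts f x x' y1 y2 : vert_cts f x y1 y2 -> vert_cts f x' y1 y2 ->
  ccts_on y1 y2 (fun y => f (x +i* y) - f (x' +i* y)).
Proof. by move=> h k t ht; apply: cctsB; apply: zcts_vert; [exact: h|exact: k]. Qed.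

Lemma rintD f g x1 x2 y1 y2 : bdy_cts f x1 x2 y1 y2 -> bdy_cts g x1 x2 y1 y2 ->
  rint (fun z => f z + g z) x1 x2 y1 y2 = rint f x1 x2 y1 y2 + rint g x1 x2 y1 y2.
Proof.
move=> [a b c d] [a' b' c' d']; rewrite /rint.
have -> : (fun x => f (x +i* y1) + g (x +i* y1) - (f (x +i* y2) + g (x +i* y2))) =
  (fun x => (f (x +i* y1) - f (x +i* y2)) + (g (x +i* y1) - g (x +i* y2))).
  by apply/funext => x; ring.
have -> : (fun y => f (x2 +i* y) + g (x2 +i* y) - (f (x1 +i* y) + g (x1 +i* y))) =
  (fun y => (f (x2 +i* y) - f (x1 +i* y)) + (g (x2 +i* y) - g (x1 +i* y))).
  by apply/funext => x; ring.
rewrite (cintD (horiz_ccts a b) (horiz_ccts a' b')) (cintD (vert_ccts d c) (vert_ccts d' c')).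
by ring.
Qed.

Lemma rintZ f c x1 x2 y1 y2 : bdy_cts f x1 x2 y1 y2 ->
  rint (fun z => c * f z) x1 x2 y1 y2 = c * rint f x1 x2 y1 y2.
Proof.
move=> [a b e d]; rewrite /rint.
under [X in cint x1 x2 X]funext do rewrite -mulrBr.
under [X in cint y1 y2 X]funext do rewrite -mulrBr.
by rewrite (cintZ _ (horiz_ccts a b)) (cintZ _ (vert_ccts d e)); ring.
Qed.

Lemma rint_le f x1 x2 y1 y2 M : x1 <= x2 -> y1 <= y2 -> bdy_cts f x1 x2 y1 y2 ->
  (forall x, x1 <= x <= x2 -> normc (f (x +i* y1)) <= M /\ normc (f (x +i* y2)) <= M) ->
  (forall y, y1 <= y <= y2 -> normc (f (x1 +i* y)) <= M /\ normc (f (x2 +i* y)) <= M) ->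
  normc (rint f x1 x2 y1 y2) <= 4 * M * (x2 - x1 + (y2 - y1)).
Proof.
move=> hx hy [a b c d] hM kM.
apply: le_trans (le_normcD _ _) _; rewrite normci.
have := @cint_le _ _ _ (fun x => f (x +i* y1) - f (x +i* y2)) (2 * M) hx (horiz_ccts a b).
have := @cint_le _ _ _ (fun y => f (x2 +i* y) - f (x1 +i* y)) (2 * M) hy (vert_ccts d c).
have h1 : forall t, y1 <= t <= y2 -> normc (f (x2 +i* t) - f (x1 +i* t)) <= 2 * M.
  by move=> t /kM[? ?]; apply: le_trans (le_normcB _ _) _; lra.
have h2 : forall t, x1 <= t <= x2 -> normc (f (t +i* y1) - f (t +i* y2)) <= 2 * M.
  by move=> t /hM[? ?]; apply: le_trans (le_normcB _ _) _; lra.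
by move=> /(_ h1) ? /(_ h2) ?; lra.
Qed.

Lemma rint_affine (a c : C) x1 x2 y1 y2 : x1 <= x2 -> y1 <= y2 ->
  rint (fun z => c + a * z) x1 x2 y1 y2 = 0.
Proof.
move=> hx hy; rewrite /rint.
have -> : (fun x => c + a * (x +i* y1) - (c + a * (x +i* y2))) =
    (fun _ => a * 'i%C * (y1 - y2)%:C).
  by apply/funext => x; rewrite (ComplexE x y1) (ComplexE x y2) real_complexB; ring.
have -> : (fun y => c + a * (x2 +i* y) - (c + a * (x1 +i* y))) =
    (fun _ => a * (x2 - x1)%:C).
  by apply/funext => y; rewrite (ComplexE x1 y) (ComplexE x2 y) real_complexB; ring.
by rewrite !cint_cst // !real_complexB; ring.
Qed.

Lemma rint_splitx f x1 m x2 y1 y2 : x1 <= m -> m <= x2 ->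
  horiz_cts f x1 x2 y1 -> horiz_cts f x1 x2 y2 ->
  vert_cts f x1 y1 y2 -> vert_cts f m y1 y2 -> vert_cts f x2 y1 y2 ->
  rint f x1 x2 y1 y2 = rint f x1 m y1 y2 + rint f m x2 y1 y2.
Proof.
move=> h1 h2 a b c d e; rewrite /rint.
rewrite (cint_split h1 h2 (horiz_ccts a b)).
have -> : (fun y => f (x2 +i* y) - f (x1 +i* y)) =
  (fun y => (f (m +i* y) - f (x1 +i* y)) + (f (x2 +i* y) - f (m +i* y))).
  by apply/funext => y; ring.
by rewrite (cintD (vert_ccts d c) (vert_ccts e d)); ring.
Qed.

Lemma rint_splity f x1 x2 y1 m y2 : y1 <= m -> m <= y2 ->
  vert_cts f x1 y1 y2 -> vert_cts f x2 y1 y2 ->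
  horiz_cts f x1 x2 y1 -> horiz_cts f x1 x2 m -> horiz_cts f x1 x2 y2 ->
  rint f x1 x2 y1 y2 = rint f x1 x2 y1 m + rint f x1 x2 m y2.
Proof.
move=> h1 h2 a b c d e; rewrite /rint.
rewrite (cint_split h1 h2 (vert_ccts b a)).
have -> : (fun x => f (x +i* y1) - f (x +i* y2)) =
  (fun x => (f (x +i* y1) - f (x +i* m)) + (f (x +i* m) - f (x +i* y2))).
  by apply/funext => y; ring.
by rewrite (cintD (horiz_ccts c d) (horiz_ccts d e)); ring.
Qed.

Lemma zctsP f z : zcts f z <-> {for z : C^o, continuous (f : C^o -> C^o)}.
Proof.
split=> [h A /near_nmP[e e0 he]|h e e0].
  suff : \forall w \near (z : C^o), A (f w) by [].
  have [d d0 hd] := h e e0; apply/near_nmP; exists d => // w; rewrite nm_normc => /hd.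
  by rewrite subrKC => H; apply: he; rewrite nm_normc.
have : \forall w \near (f z : C^o), nm (w - f z : C^o) < e by apply/near_nmP; exists e.
move=> /h /near_nmP[d d0 hd]; exists d => // k hk; have := hd (z + k).
by rewrite addrDB !nm_normc; exact.
Qed.

Lemma zctsB f g z : zcts f z -> zcts g z -> zcts (fun z => f z - g z) z.
Proof. by move=> /zctsP hf /zctsP hg; apply/zctsP; exact: (continuousB hf hg). Qed.

Lemma zctsD f g z : zcts f z -> zcts g z -> zcts (fun z => f z + g z) z.
Proof. by move=> /zctsP hf /zctsP hg; apply/zctsP; exact: (continuousD hf hg). Qed.

Lemma zctsM f g z : zcts f z -> zcts g z -> zcts (fun z => f z * g z) z.
Proof. by move=> /zctsP hf /zctsP hg; apply/zctsP; exact: (@continuousM C C^o f g z hf hg). Qed.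

Lemma zctsV f z : f z != 0 -> zcts f z -> zcts (fun z => (f z)^-1) z.
Proof. by move=> fz /zctsP hf; apply/zctsP; exact: (@continuousV C C^o f z fz hf). Qed.

Lemma zcts_cst (c : C) z : zcts (fun _ => c) z.
Proof. by move=> e e0; exists 1 => // h _; rewrite subrr normc0. Qed.

Lemma zcts_id z : zcts id z.
Proof. by move=> e e0; exists e => // h; rewrite addrDB. Qed.

(** The property given to [rect_cousin] is that the integral is at most [e] times the square of the
    half-perimeter. Quartering divides this bound by exactly 4, so it adds up. Locally [f] is
    compared with its affine approximation, whose integral vanishes. *)
Theorem goursat f x1 x2 y1 y2 : x1 <= x2 -> y1 <= y2 ->
  (forall x y, x1 <= x <= x2 -> y1 <= y <= y2 -> exists a, cder f (x +i* y) a) ->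
  rint f x1 x2 y1 y2 = 0.
Proof.
move=> hx hy hf.
have fcts x y : x1 <= x <= x2 -> y1 <= y <= y2 -> zcts f (x +i* y).
  by move=> /hf/[apply] -[a]; exact: cder_zcts.
have fh a b y : x1 <= a -> b <= x2 -> y1 <= y <= y2 -> horiz_cts f a b y.
  by move=> xa bx yy t ht; apply: fcts => //; clear -xa bx ht; lra.
have fv x c d : y1 <= c -> d <= y2 -> x1 <= x <= x2 -> vert_cts f x c d.
  by move=> yc dy xx t ht; apply: fcts => //; clear -yc dy ht; lra.
have bc a b c d : x1 <= a -> b <= x2 -> y1 <= c -> d <= y2 -> a <= b -> c <= d ->
    bdy_cts f a b c d.
  move=> xa bx yc dy ab cd; split; [apply: fh|apply: fh|apply: fv|apply: fv] => //.
  - by rewrite yc (le_trans cd dy).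
  - by rewrite dy (le_trans yc cd).
  - by rewrite xa (le_trans ab bx).
  - by rewrite bx (le_trans xa ab).
have sq : 0 <= (x2 - x1 + (y2 - y1)) ^+ 2 by exact: sqr_ge0.
apply: (normc_small sq) => e e0.
pose P a b c d := normc (rint f a b c d) <= e * (b - a + (d - c)) ^+ 2.
apply: (@rect_cousin R P) => //.
  move=> a b c d ab cd xa bx yc dy; rewrite /P => h1 h2 h3 h4.
  set m := (a + b) / 2 in h1 h2 h3 h4; set k := (c + d) / 2 in h1 h2 h3 h4.
  have [am mb ck kd] : [/\ a <= m, m <= b, c <= k & k <= d] by rewrite /m /k; clear -ab cd; split; lra.
  have [mx ky] : x1 <= m <= x2 /\ y1 <= k <= y2.
    by rewrite (le_trans xa am) (le_trans mb bx) (le_trans yc ck) (le_trans kd dy).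
  have [ax bx'] : x1 <= a <= x2 /\ x1 <= b <= x2.
    by rewrite xa bx (le_trans ab bx) (le_trans xa ab).
  have [cy dy'] : y1 <= c <= y2 /\ y1 <= d <= y2.
    by rewrite yc dy (le_trans cd dy) (le_trans yc cd).
  rewrite (@rint_splitx f a m b) //; [|exact: fh|exact: fh|exact: fv|exact: fv|exact: fv].
  have [mx1 mx2] := andP mx; have [ky1 ky2] := andP ky.
  rewrite (@rint_splity f a m c k d) //; [|exact: fv|exact: fv|exact: fh|exact: fh|exact: fh].
  rewrite (@rint_splity f m b c k d) //; [|exact: fv|exact: fv|exact: fh|exact: fh|exact: fh].
  have am2 : b - a = 2 * (m - a) by rewrite /m; field.
  have bm2 : b - m = m - a by rewrite /m; field.
  have ck2 : d - c = 2 * (k - c) by rewrite /k; field.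
  have dk2 : d - k = k - c by rewrite /k; field.
  rewrite am2 ck2; rewrite bm2 in h2 h4; rewrite dk2 in h3 h4.
  apply: le_trans (le_normcD _ _) _.
  have t1 := le_normcD (rint f a m c k) (rint f a m k d).
  have t2 := le_normcD (rint f m b c k) (rint f m b k d).
  have -> : (2 * (m - a) + 2 * (k - c)) ^+ 2 = 4 * (m - a + (k - c)) ^+ 2 by ring.
  by clear -h1 h2 h3 h4 t1 t2; lra.
move=> p q hp hq; have [A hA] := hf p q hp hq.
(* The quarter compensates the factor 4 of [rint_le]. *)
have e40 : 0 < e / 4 by lra.
have [d d0 hd] := hA _ e40.
exists (d / 2); first by lra.
move=> a b c c' xa bx yc dy hap hcq ba dc; rewrite /P.
have ab : a <= b by lra. have cc : c <= c' by lra.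
pose z0 := p +i* q.
pose g z := (f z0 - A * z0) + A * z.
have cg z : zcts g z by apply: zctsD; [exact: zcts_cst|apply: zctsM; [exact: zcts_cst|exact: zcts_id]].
have bg : bdy_cts g a b c c' by split=> ? ?.
have bf := bc a b c c' xa bx yc dy ab cc.
have bfg : bdy_cts (fun z => f z - g z) a b c c'.
  by case: bf => ? ? ? ?; split=> t ht; apply: zctsB => //; auto.
have -> : rint f a b c c' = rint (fun z => f z - g z) a b c c'.
  have fE : f = fun z => (f z - g z) + g z by apply/funext => z; rewrite subrK.
  by rewrite {1}fE (rintD bfg bg) (rint_affine _ _ ab cc) addr0.
have est x y : a <= x <= b -> c <= y <= c' ->
    normc (f (x +i* y) - g (x +i* y)) <= e / 4 * (b - a + (c' - c)).
  move=> hx' hy'.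
  have hh : normc ((x - p) +i* (y - q)) <= b - a + (c' - c).
    apply: le_trans (le_normc_ReIm _ _) _.
    have : `|x - p| <= b - a by rewrite ler_norml; lra.
    have : `|y - q| <= c' - c by rewrite ler_norml; lra.
    lra.
  have := hd ((x - p) +i* (y - q)).
  have E : z0 + ((x - p) +i* (y - q)) = x +i* y.
    by apply/eqP; rewrite eq_complex /=; apply/andP; split; apply/eqP; ring.
  rewrite E => H; have {}H := H ltac:(lra).
  have -> : f (x +i* y) - g (x +i* y) = f (x +i* y) - f z0 - A * ((x - p) +i* (y - q)).
    by rewrite -E /g; ring.
  by apply: le_trans H _; rewrite ler_pM2l //; lra.
have := rint_le ab cc bfg (M := e / 4 * (b - a + (c' - c))).
move=> H; apply: le_trans (H _ _) _.
- by move=> x hx'; split; apply: est => //; lra.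
- by move=> y hy'; split; apply: est => //; lra.
- by rewrite expr2; lra.
Qed.

End Rectangles.

Section OneVariable.
Variable R : realType.
Local Notation C := R[i].
Implicit Types (f g : C -> C) (z w h : C).

Lemma cder_uniq f z a b : cder f z a -> cder f z b -> a = b.
Proof.
move=> /cderP ha /cderP hb; have := cfder_uniq ha hb.
by move=> /(congr1 (fun k => k 1)); rewrite !mulr1.
Qed.

Lemma cder_cdf f z : (exists a, cder f z a) <-> cdf (f : C^o -> C) z.
Proof.
split=> [[a /cderP ha]|[L hL]]; first by eexists; exact: ha.
have [lin _ _] := hL; exists (L 1); apply/cderP; rewrite (_ : (fun _ => _) = L) //.
by apply/funext => h; rewrite -[h in RHS]mulr1 (clinearZ _ _ lin) [RHS]mulrC.
Qed.

Lemma cdf_zcts f z : cdf (f : C^o -> C) z -> zcts f z.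
Proof. by move=> /cder_cdf[a]; exact: cder_zcts. Qed.

Lemma cdf_id z : cdf (id : C^o -> C) z.
Proof. by apply: (@cdf_lin R C^o id z 1) => // h; rewrite nm_normc mul1r. Qed.

Lemma normc_rect_lt1 (a b : R) : normc (a +i* b) < 1 -> [/\ -1 < a, a < 1, -1 < b & b < 1].
Proof.
have := le_Re_normc (a +i* b); have := le_Im_normc (a +i* b).
set n := normc _; rewrite [Re _]/= [Im _]/=.
by rewrite !ler_norml => /andP[? ?] /andP[? ?] h; split; lra.
Qed.

(** The difference quotient is bounded near [z]. By [goursat] its integral equals that over an
    arbitrarily small square around [z], hence is smaller than any positive number. *)
Lemma cauchy_square f z : normc z < 1 ->
  (forall x y : R, -1 <= x <= 1 -> -1 <= y <= 1 -> cdf (f : C^o -> C) (x +i* y)) ->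
  rint (fun w => (f w - f z) / (w - z)) (-1) 1 (-1) 1 = 0.
Proof.
case: z => a b /normc_rect_lt1[a1 a2 b1 b2] hf; set z := a +i* b.
set g := fun w => _.
have gd (x y : R) : -1 <= x <= 1 -> -1 <= y <= 1 -> (x != a) || (y != b) ->
    cdf (g : C^o -> C) (x +i* y).
  move=> hx hy ne; have nz : x +i* y - z != 0.
    by rewrite subr_eq0 eq_complex /= negb_and.
  apply: cdfM; first by apply: cdfB; [exact: hf|exact: cdf_cst].
  by apply: cdfV nz _; apply: cdfB; [exact: cdf_id|exact: cdf_cst].
have gc (x y : R) : -1 <= x <= 1 -> -1 <= y <= 1 -> (x != a) || (y != b) -> zcts g (x +i* y).
  by move=> hx hy ne; apply: cdf_zcts; exact: gd.
have [A hA] : exists c, cder f z c by apply/cder_cdf; apply: hf; lra.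
have [d d0 hd] := hA 1 ltr01.
have B0 := normc_ge0 A; pose B := normc A + 1.
have gB x y : normc ((x +i* y) - z) < d -> normc (g (x +i* y)) <= B.
  move=> u; rewrite /g.
  (* At [z] itself the quotient is [0 / 0], which is 0. *)
  have [->|nz] := eqVneq (x +i* y) z; first by rewrite !subrr mul0r normc0 /B; lra.
  have n0 : 0 < normc (x +i* y - z) by rewrite normc_gt0 subr_eq0.
  rewrite normcM normcV ler_pdivrMr // /B.
  have := hd _ u; rewrite subrKC => H.
  have := le_normcD (f (x +i* y) - f z - A * (x +i* y - z)) (A * (x +i* y - z)).
  rewrite subrK normcM; lra.
(* The square of half-side [e] around [z] is cut out: two vertical cuts, then two horizontal ones in
   the middle strip, leave four rectangles that avoid [z]. *)
have key (e : R) : 0 < e -> 2 * e < d -> -1 <= a - e -> a + e <= 1 -> -1 <= b - e -> b + e <= 1 ->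
    normc (rint g (-1) 1 (-1) 1) <= e * (16 * B).
  move=> e0 ed h1 h2 h3 h4.
  have nl : (a - e != a) by rewrite lt_eqF //; lra.
  have nr : (a + e != a) by rewrite gt_eqF //; lra.
  have nb : (b - e != b) by rewrite lt_eqF //; lra.
  have nt : (b + e != b) by rewrite gt_eqF //; lra.
  have nm1 : (-1 != a :> R) by rewrite lt_eqF.
  have n1 : (1 != a :> R) by rewrite gt_eqF.
  have nm1' : (-1 != b :> R) by rewrite lt_eqF.
  have n1' : (1 != b :> R) by rewrite gt_eqF.
  have H (x1 x2 y : R) : -1 <= x1 -> x2 <= 1 -> -1 <= y <= 1 -> y != b -> horiz_cts g x1 x2 y.
    by move=> ? ? ? yb t ht; apply: gc => //; [clear gd; lra|rewrite yb orbT].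
  have V (x y1 y2 : R) : -1 <= y1 -> y2 <= 1 -> -1 <= x <= 1 -> x != a -> vert_cts g x y1 y2.
    by move=> ? ? ? xa t ht; apply: gc => //; [clear gd; lra|rewrite xa].
  have i1 : (-1 : R) <= 1 by clear -R; lra.
  have i2 : -1 <= (-1 : R) <= 1 by rewrite lexx i1.
  have i3 : -1 <= (1 : R) <= 1 by rewrite lexx i1.
  have i4 : -1 <= a - e <= 1 by lra.
  have i5 : -1 <= a + e <= 1 by lra.
  have i6 : -1 <= b - e <= 1 by lra.
  have i7 : -1 <= b + e <= 1 by lra.
  have i8 : a - e <= a + e by lra.
  have i9 : b - e <= b + e by lra.
  have j4 := andP i4; have j5 := andP i5; have j6 := andP i6; have j7 := andP i7.
  case: j4 j5 j6 j7 => [k4 l4] [k5 l5] [k6 l6] [k7 l7].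
  have G (x1 x2 y1 y2 : R) : x1 <= x2 -> y1 <= y2 -> -1 <= x1 -> x2 <= 1 -> -1 <= y1 -> y2 <= 1 ->
      (forall x y, x1 <= x <= x2 -> y1 <= y <= y2 -> (x != a) || (y != b)) ->
      rint g x1 x2 y1 y2 = 0.
    move=> ? ? ? ? ? ? nab; apply: goursat => // x y hx hy; apply/cder_cdf; apply: gd; last exact: nab.
      by clear gc nab H V; lra.
    by clear gc nab H V; lra.
  rewrite (@rint_splitx _ g (-1) (a - e) 1) //; [|exact: H|exact: H|exact: V|exact: V|exact: V].
  rewrite (G (-1) (a - e)) //; last first.
    by move=> x y hx _; rewrite lt_eqF //; clear -hx e0; lra.
  rewrite (@rint_splitx _ g (a - e) (a + e) 1) //; [|exact: H|exact: H|exact: V|exact: V|exact: V].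
  rewrite (G (a + e) 1) //; last first.
    by move=> x y hx _; rewrite gt_eqF //; clear -hx e0; lra.
  rewrite (@rint_splity _ g (a - e) (a + e) (-1) (b - e) 1) //;
    [|exact: V|exact: V|exact: H|exact: H|exact: H].
  rewrite (G (a - e) (a + e) (-1) (b - e)) //; last first.
    by move=> x y _ hx; rewrite orbC lt_eqF //; clear -hx e0; lra.
  rewrite (@rint_splity _ g (a - e) (a + e) (b - e) (b + e) 1) //;
    [|exact: V|exact: V|exact: H|exact: H|exact: H].
  rewrite (G (a - e) (a + e) (b + e) 1) //; last first.
    by move=> x y _ hx; rewrite orbC gt_eqF //; clear -hx e0; lra.
  rewrite !add0r !addr0.
  have bc : bdy_cts g (a - e) (a + e) (b - e) (b + e).
    by split; [apply: H|apply: H|apply: V|apply: V].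
  have nn x y : `|x - a| <= e -> `|y - b| <= e -> normc (g (x +i* y)) <= B.
    move=> hx hy; apply: gB.
    have := le_normc_ReIm (x - a) (y - b); set u := normc _ => hu.
    by change (u < d); clear -hx hy hu ed; lra.
  have nn2 (x c : R) : c - e <= x <= c + e -> `|x - c| <= e.
    by move=> ?; rewrite ler_norml; lra.
  have := rint_le i8 i9 bc (M := B).
  have E : 4 * B * (a + e - (a - e) + (b + e - (b - e))) = e * (16 * B) by ring.
  rewrite E; apply.
  - move=> x /nn2 hx; split; apply: nn => //; apply: nn2; clear -e0; lra.
  - move=> x /nn2 hx; split; apply: nn => //; apply: nn2; clear -e0; lra.
(* The term [d / 3] ensures [2 * e < d]; the other terms keep the small square inside the large
   one. *)
have [m [m0 hm]] : exists m : R, 0 < m /\ forall e, 0 < e -> e <= m ->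
    [/\ 2 * e < d, -1 <= a - e, a + e <= 1, -1 <= b - e & b + e <= 1].
  exists (Num.min (d / 3) (Num.min (Num.min (a + 1) (1 - a)) (Num.min (b + 1) (1 - b)))).
  split; first by rewrite !lt_min; clear -d0 a1 a2 b1 b2; lra.
  move=> e e0; rewrite !le_min => /andP[? /andP[/andP[? ?] /andP[? ?]]].
  by clear gd gc gB hd key; split; lra.
apply: (@normc_small _ _ (16 * B)); first by rewrite /B; lra.
move=> e e0; have em0 : 0 < Num.min e m by rewrite lt_min e0.
have [|q1 q2 q3 q4 q5] := hm _ em0; first by rewrite ge_min lexx orbT.
apply: le_trans (key _ em0 q1 q2 q3 q4 q5) _.
rewrite ler_wpM2r //; first by rewrite /B; lra.
by rewrite ge_min lexx.
Qed.

End OneVariable.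

(** * Division by the coordinate on a disc *)

Section Factor.
Variable R : realType.
Local Notation C := R[i].
Implicit Types (f g : C -> C) (z w h : C).

Definition onsq z := [&& `|Re z| <= 1, `|Im z| <= 1 & (`|Re z| == 1) || (`|Im z| == 1)].
Definition sqint f : C := rint f (-1) 1 (-1) 1.
Definition sqcts f := forall w, onsq w -> zcts f w.

Lemma onsq_norm w : onsq w -> 1 <= normc w.
Proof.
case/and3P=> _ _ /orP[] /eqP <-; [exact: le_Re_normc|exact: le_Im_normc].
Qed.

Let onsq_sides (x : R) : -1 <= x <= 1 ->
  [/\ onsq (x +i* (-1)), onsq (x +i* 1), onsq ((-1) +i* x) & onsq (1 +i* x)].
Proof.
by move=> hx; split; rewrite /onsq /= ?normrN normr1 lexx eqxx /= ?orbT ?andbT ler_norml.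
Qed.

Lemma sqcts_bdy f : sqcts f -> bdy_cts f (-1) 1 (-1) 1.
Proof.
by move=> hf; split=> x /onsq_sides[? ? ? ?]; exact: hf.
Qed.

Lemma sqintD f g : sqcts f -> sqcts g -> sqint (fun w => f w + g w) = sqint f + sqint g.
Proof. by move=> hf hg; exact: rintD (sqcts_bdy hf) (sqcts_bdy hg). Qed.

Lemma sqintZ f c : sqcts f -> sqint (fun w => c * f w) = c * sqint f.
Proof. by move=> hf; exact: rintZ (sqcts_bdy hf). Qed.

Lemma sqint_le f M : sqcts f -> (forall w, onsq w -> normc (f w) <= M) ->
  normc (sqint f) <= 16 * M.
Proof.
move=> hf hM; have le11 : (-1 : R) <= 1 by lra.
have := rint_le le11 le11 (sqcts_bdy hf) (M := M).
have -> : 4 * M * (1 - -1 + (1 - -1)) = 16 * M by ring.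
by apply=> x /onsq_sides[? ? ? ?]; split; exact: hM.
Qed.

Lemma eq_sqint f g : (forall w, onsq w -> f w = g w) -> sqint f = sqint g.
Proof.
move=> fg; rewrite /sqint /rint /cint.
have H (x : R) : x \in `[-1, 1]%classic -> -1 <= x <= 1 by rewrite inE /= in_itv.
by congr (_ +i* _ + 'i%C * (_ +i* _)); apply: eq_Rintegral => x /H/onsq_sides[? ? ? ?];
  rewrite !fg.
Qed.

Definition kern z w : C := (w - z)^-1.

Lemma onsq_far z w : normc z < 1 -> onsq w -> 1 - normc z <= normc (w - z).
Proof. by move=> hz /onsq_norm hw; have := normc_sub_ge w z; lra. Qed.

Lemma onsq_neq z w : normc z < 1 -> onsq w -> w - z != 0.
Proof. by move=> hz hw; rewrite -normc_gt0; have := onsq_far hz hw; lra. Qed.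

Lemma sqcts_kern z : normc z < 1 -> sqcts (kern z).
Proof.
move=> hz w /(onsq_neq hz) nz; apply: (@zctsV _ (fun w => w - z)) => //.
by apply: zctsB; [exact: zcts_id|exact: zcts_cst].
Qed.

Lemma sqctsM f g : sqcts f -> sqcts g -> sqcts (fun w => f w * g w).
Proof. by move=> hf hg w hw; apply: zctsM; [exact: hf|exact: hg]. Qed.

(** The Cauchy transform of [f] along the square, without the factor [1 / (2 pi i)]. *)
Definition ctrans f z : C := sqint (fun w => f w * kern z w).

Lemma normc_kern z w : normc z < 1 -> onsq w -> normc (kern z w) <= (1 - normc z)^-1.
Proof.
move=> hz hw; rewrite normcV lef_pV2 ?posrE ?onsq_far ?normc_gt0 ?onsq_neq //.
by lra.
Qed.

Lemma ctrans_le f z M : 0 <= M -> normc z < 1 -> sqcts f ->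
  (forall w, onsq w -> normc (f w) <= M) ->
  normc (ctrans f z) <= 16 * (M / (1 - normc z)).
Proof.
move=> M0 hz hf hM; apply: sqint_le; first exact: sqctsM (sqcts_kern hz).
move=> w hw; rewrite normcM; apply: ler_pM; rewrite ?normc_ge0 //; first exact: hM.
exact: normc_kern.
Qed.

(** Differentiation under the integral sign, by the exact expansion of [kern (z + h)] as
    [kern z + h * kern z ^+ 2] plus [h ^+ 2 * kern (z + h) * kern z ^+ 2]. *)
Lemma ctrans_cdf f z M : 0 <= M -> normc z < 1 -> sqcts f ->
  (forall w, onsq w -> normc (f w) <= M) -> cdf (ctrans f : C^o -> C) z.
Proof.
move=> M0 hz hf hM; apply/cder_cdf.
have ck := sqcts_kern hz.
exists (sqint (fun w => f w * kern z w * kern z w)) => e e0.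
pose d := 1 - normc z; have d0 : 0 < d by rewrite /d; lra.
(* The distance to the square is at least [d] from [z], and at least [d / 2] from [z + h] once [h]
   is shorter than [d / 2]. *)
pose K := 16 * (M / (d / 2) / d / d).
have K0 : 0 <= K by rewrite /K; apply: mulr_ge0 => //; rewrite !divr_ge0 //; lra.
exists (Num.min (d / 2) (e / (K + 1))).
  by rewrite lt_min !divr_gt0 //; lra.
move=> h; rewrite lt_min => /andP[hd]; rewrite ltr_pdivlMr; last by lra.
move=> hK.
have hz' : normc (z + h) < 1 by have := le_normcD z h; rewrite /d in hd; lra.
have ck' := sqcts_kern hz'.
have E : ctrans f (z + h) = sqint (fun w => (f w * kern z w + h * (f w * kern z w * kern z w)) +
   (h * h) * (f w * kern (z + h) w * kern z w * kern z w)).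
  apply: eq_sqint => w hw; rewrite /kern; field.
  by rewrite (onsq_neq hz' hw) (onsq_neq hz hw).
have c1 : sqcts (fun w => f w * kern z w * kern z w) by do !apply: sqctsM.
have c2 : sqcts (fun w => f w * kern (z + h) w * kern z w * kern z w).
  by do !apply: sqctsM.
have cZ c g : sqcts g -> sqcts (fun w => c * g w).
  by move=> cg; apply: sqctsM => // w _; exact: zcts_cst.
have -> : ctrans f (z + h) - ctrans f z - sqint (fun w => f w * kern z w * kern z w) * h =
    h * h * sqint (fun w => f w * kern (z + h) w * kern z w * kern z w).
  rewrite E sqintD; [|move=> w hw; apply: zctsD; [exact: (sqctsM hf ck)|exact: (cZ h _ c1)]|exact: cZ].
  rewrite sqintD; [|exact: sqctsM|exact: cZ].
  by rewrite !sqintZ // /ctrans; ring.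
rewrite !normcM.
have B : normc (sqint (fun w => f w * kern (z + h) w * kern z w * kern z w)) <= K.
  apply: sqint_le => // w hw; rewrite !normcM.
  have k1 := normc_kern hz hw; have k2 := normc_kern hz' hw; rewrite -/d in k1.
  do 2 (apply: ler_pM; rewrite ?mulr_ge0 ?normc_ge0 //).
  apply: ler_pM; rewrite ?normc_ge0 //; first exact: hM.
  apply: le_trans k2 _; rewrite lef_pV2 ?posrE.
  + by have := le_normcD z h; rewrite /d in hd *; lra.
  + by have := le_normcD z h; rewrite /d in hd *; lra.
  + by lra.
have n0 := normc_ge0 h; rewrite -mulrA mulrC ler_wpM2r //; nra.
Qed.

(** The exact value is 2 pi. Each pair of opposite sides contributes the integral of
    [2 / (t ^+ 2 + 1)], which is at least 1 on a segment of length 2. *)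
Lemma winding_ge : 4 <= Im (sqint (kern 0)).
Proof.
have zl : normc (0 : C) < 1 by rewrite normc0.
have bc := sqcts_bdy (sqcts_kern zl).
case: bc => a b c d.
have le11 : (-1 : R) <= 1 by lra.
have H := cint_ge (@ImB' R) (@le_Im_normc R) le11 (horiz_ccts a b) (m := 1).
have V := cint_ge (@ReB' R) (@le_Re_normc R) le11 (vert_ccts d c) (m := 1).
have -> : Im (sqint (kern 0)) =
  Im (cint (-1) 1 (fun x => kern 0 (x +i* (-1)) - kern 0 (x +i* 1))) +
  Re (cint (-1) 1 (fun y => kern 0 (1 +i* y) - kern 0 ((-1) +i* y))).
  by rewrite /sqint /rint /=; ring.
have bnd (t : R) : -1 <= t <= 1 -> 1 <= (1 / (t ^+ 2 + 1)) *+ 2.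
  move=> ht; rewrite -mulr_natr mulrAC ler_pdivlMr; nra.
have H1 := H _; have V1 := V _.
rewrite (_ : (4 : R) = 1 * (1 - -1) + 1 * (1 - -1)); last by ring.
apply: lerD; [apply: H|apply: V] => t ht; apply: le_trans (bnd t ht) _;
  rewrite /kern !subr0 /= le_eqVlt; apply/orP; left; apply/eqP; field; nra.
Qed.

Lemma normc_Im_ge z (m : R) : m <= Im z -> m <= normc z.
Proof. by move=> h; have := le_Im_normc z; rewrite ler_norml => /andP[_]; lra. Qed.

(** Subtracting the identities of [cauchy_square] at [z] and at 0 gives
    [W z * (f z - f 0) = z * ctrans phi z], where [W] is the Cauchy transform of 1. Near 0, where
    [W] is bounded below, the quotient is thus [ctrans phi / W], holomorphic at 0 as well; away from
    0 it is the plain difference quotient. *)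
Lemma factor2 f (M : R) : (forall z, normc z < 2 -> cdf (f : C^o -> C) z) ->
  (forall z, normc z < 2 -> normc (f z) <= M) ->
  exists q : C -> C, forall z, normc z < 2 ->
    [/\ cdf (q : C^o -> C) z, f z = f 0 + z * q z & normc (q z) <= 32 * M].
Proof.
move=> df hM.
have n02 : normc (0 : C) < 2 by rewrite normc0.
have M0 : 0 <= M by apply: le_trans (hM 0 n02); exact: normc_ge0.
have M20 : 0 <= 2 * M by exact: mulr_ge0.
have sqlt2 (x y : R) : -1 <= x <= 1 -> -1 <= y <= 1 -> normc (x +i* y) < 2.
  move=> hx hy.
  have -> : (2 : R) = Num.sqrt (2 ^+ 2) by rewrite sqrtr_sqr ger0_norm.
  by rewrite /= ltr_sqrt; nra.
have on2 w : onsq w -> normc w < 2.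
  by case: w => x y /and3P[/= + + _]; rewrite !ler_norml; exact: sqlt2.
have dsq (x y : R) : -1 <= x <= 1 -> -1 <= y <= 1 -> cdf (f : C^o -> C) (x +i* y).
  by move=> hx hy; apply: df; exact: sqlt2.
have cf : sqcts f by move=> w /on2/df; exact: cdf_zcts.
have c1 : sqcts (fun _ => 1) by move=> w _; exact: zcts_cst.
have zl : normc (0 : C) < 1 by rewrite normc0.
have ck := sqcts_kern zl.
pose phi w := (f w - f 0) * kern 0 w.
have cf0 : sqcts (fun w => f w - f 0).
  by move=> w hw; apply: zctsB; [exact: cf|exact: zcts_cst].
have cphi : sqcts phi by exact: sqctsM.
have bphi w : onsq w -> normc (phi w) <= 2 * M.
  move=> hw; rewrite normcM /kern normcV subr0.
  have w1 := onsq_norm hw; rewrite ler_pdivrMr; last by lra.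
  apply: le_trans (le_normcB _ _) _; have := hM _ n02; have := hM _ (on2 _ hw); nra.
have bk w : onsq w -> normc ((fun _ => 1) w : C) <= 1 by rewrite normc1.
pose W := ctrans (fun _ => 1).
have WE z : W z = sqint (kern z) by apply: eq_sqint => w _; rewrite mul1r.
have W0 : 4 <= normc (W 0) by rewrite WE; apply: normc_Im_ge; exact: winding_ge.
have Wdiff z : normc z < 1 -> W z - W 0 = z * sqint (fun w => kern 0 w * kern z w).
  move=> hz; have ckz := sqcts_kern hz.
  rewrite !WE -sqintZ; last exact: sqctsM.
  have -> : sqint (kern z) = sqint (fun w => kern 0 w + z * (kern 0 w * kern z w)).
    apply: eq_sqint => w hw; rewrite /kern subr0; field.
    by rewrite (onsq_neq hz hw) -[w]subr0 (onsq_neq zl hw).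
  rewrite sqintD; [by rewrite addrDB| |] => //.
  by apply: (@sqctsM (fun _ => z)); [move=> w _; exact: zcts_cst|exact: sqctsM].
(* By [Wdiff] the variation of [W] is at most [16 * |z| / (1 - |z|)], below 2, which is half of the
   lower bound 4 for [W 0]. *)
have W2 z : normc z < 1 / 16 -> 2 <= normc (W z).
  move=> hz; have hz1 : normc z < 1 by lra.
  have B : normc (sqint (fun w => kern 0 w * kern z w)) <= 16 * (1 / (1 - normc z)).
    by apply: ctrans_le => // w hw; have := normc_kern zl hw; rewrite normc0 subr0 invr1.
  have : normc (W 0 - W z) <= 2.
    rewrite normcBC Wdiff // normcM; apply: le_trans (ler_wpM2l (normc_ge0 _) B) _.
    rewrite mulrA mulrA ler_pdivrMr; lra.
  move: (normc_sub_ge (W 0) (W z)) W0.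
  by move: (normc (W 0)) (normc (W z)) (normc _) => u v x; clear -R; lra.
have key z : normc z < 1 -> W z * (f z - f 0) = z * ctrans phi z.
  move=> hz; have ckz := sqcts_kern hz.
  have e1 := cauchy_square hz dsq; have e0 := cauchy_square zl dsq.
  have cfz : sqcts (fun w => (f w - f 0) * kern z w) by exact: sqctsM.
  have cf00 : sqcts (fun w => (f w - f 0) * kern 0 w) by exact: sqctsM.
  have cc (c : C) g : sqcts g -> sqcts (fun w => c * g w).
    by move=> cg; apply: sqctsM => // w _; exact: zcts_cst.
  (* Both integrands equal [(f w - f 0) * kern z w]. On each side the first summand integrates to 0
     by [cauchy_square]. *)
  have : sqint (fun w => (f w - f z) * kern z w + (f z - f 0) * kern z w) =
         sqint (fun w => (f w - f 0) * kern 0 w + z * (phi w * kern z w)).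
    apply: eq_sqint => w hw; rewrite /phi /kern subr0; field.
    by rewrite (onsq_neq hz hw) -[w]subr0 (onsq_neq zl hw).
  rewrite sqintD; last 2 first.
  - apply: sqctsM => // w hw; apply: zctsB; [exact: cf|exact: zcts_cst].
  - exact: cc.
  rewrite sqintD //; last by apply: cc; exact: sqctsM.
  rewrite !sqintZ //; last exact: sqctsM.
  by rewrite /sqint e1 e0 !add0r -[rint (kern z) _ _ _ _]WE mulrC.
have kq z : normc z < 1 / 16 -> z != 0 -> (f z - f 0) / z = ctrans phi z / W z.
  move=> hz z0; have hW := W2 z hz.
  have Wz : W z != 0 by rewrite -normc_gt0; lra.
  apply: (mulfI Wz); rewrite mulrA key; last by lra.
  by field; rewrite z0 Wz.
pose q z := if z == 0 then ctrans phi 0 / W 0 else (f z - f 0) / z.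
have qE z : normc z < 1 / 16 -> q z = ctrans phi z / W z.
  by move=> hz; rewrite /q; case: eqVneq => [->|z0] //; exact: kq.
exists q => z hz; split.
- have [->|z0] := eqVneq z 0.
    have Wz : W 0 != 0 by rewrite -normc_gt0; lra.
    apply: (@cdf_near R C^o (fun z => ctrans phi z / W z) q 0 (1 / 16)) => //.
      by move=> w; rewrite subr0 nm_normc => /qE ->.
    apply: cdfM; first exact: ctrans_cdf cphi bphi.
    by apply: cdfV Wz _; exact: ctrans_cdf c1 bk.
  apply: (@cdf_near R C^o (fun z => (f z - f 0) / z) q z (normc z)).
  + by rewrite normc_gt0.
  + move=> w; rewrite nm_normc => hw; rewrite /q; case: eqVneq => // w0.
    by move: hw; rewrite w0 sub0r normcN ltxx.
  + apply: cdfM; first by apply: cdfB; [exact: df|exact: cdf_cst].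
    by apply: cdfV z0 _; exact: cdf_id.
- have [->|z0] := eqVneq z 0; first by rewrite mul0r addr0.
  by rewrite /q (negPf z0) mulrC divfK // subrKC.
(* The radius 1/16 separates the two descriptions of [q]; the weaker bound, from the outer region,
   is [2 * M] over 1/16. *)
- case: (ltP (normc z) (1 / 16)) => hz2.
    have B : normc (ctrans phi z) <= 16 * (2 * M / (1 - normc z)).
      by apply: ctrans_le => //; lra.
    rewrite qE // normcM normcV; have hW := W2 z hz2.
    rewrite ler_pdivrMr; last by lra.
    apply: le_trans B _; rewrite mulrA ler_pdivrMr; last by lra.
    have n0 := normc_ge0 z.
    have : 0 <= M * normc z by exact: mulr_ge0.
    have : M * normc z <= M / 16 by nra.
    have : 32 * M * 2 <= 32 * M * normc (W z) by rewrite ler_wpM2l //; lra.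
    set ww := 32 * M * normc (W z) => u1 u2 u3.
    have : 64 * M * (1 - normc z) <= ww * (1 - normc z) by rewrite ler_wpM2r //; lra.
    lra.
  have z0 : z != 0 by rewrite -normc_gt0; lra.
  rewrite /q (negPf z0) normcM normcV ler_pdivrMr; last by lra.
  apply: le_trans (le_normcB _ _) _; have := hM _ hz; have := hM _ n02.
  have : M * (1 / 16) <= M * normc z by rewrite ler_wpM2l.
  lra.
Qed.

Definition holo_disc f (r M : R) := forall z, normc z < r ->
  cdf (f : C^o -> C) z /\ normc (f z) <= M.

(* The estimate behind everything else: dividing [f - f 0] by the coordinate
   costs a factor [64 / r] in the sup norm and no domain. *)
Theorem disc_factor f r M : 0 < r -> holo_disc f r M ->
  exists2 q : C -> C, holo_disc q r (64 / r * M) &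
    forall z, normc z < r -> f z = f 0 + z * q z.
Proof.
move=> r0 hf; pose s : C := (r / 2)%:C.
have ns : normc s = r / 2 by rewrite normcR ger0_norm //; lra.
have s0 : s != 0 by rewrite -normc_gt0 ns; lra.
have dil z : normc z < 2 -> normc (s * z) < r by rewrite normcM ns; nra.
have dil' (c : C) g w : cdf (g : C^o -> C) (c * w) -> cdf (fun x : C^o => g (c * x)) w.
  apply: (@cdf_affine R C^o C^o ( *%R c) ( *%R c) g w (normc c)) => [k u v|h|h].
  - by rewrite mulrDr -[k *: u]/(k * u) mulrCA.
  - by rewrite !nm_normc normcM.
  - exact: mulrDr.
have [||q hq] := @factor2 (fun z => f (s * z)) M.
- by move=> z /dil/hf[h _]; exact: dil'.
- by move=> z /dil/hf[].
have lid z : normc z < r -> normc (s^-1 * z) < 2.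
  by move=> hz; rewrite normcM normcV ns ltr_pdivrMl //; lra.
exists (fun z => s^-1 * q (s^-1 * z)).
  move=> z /lid/hq[h _ B]; split; first by apply: cdfM; [exact: cdf_cst|exact: dil'].
  rewrite normcM normcV ns.
  rewrite (_ : 64 / r * M = (r / 2)^-1 * (32 * M)); last by field; lra.
  by rewrite ler_wpM2l // invr_ge0; lra.
move=> z /lid/hq[_ + _]; rewrite mulr0 mulVKf // => ->.
by rewrite mulrCA mulrA.
Qed.

End Factor.

(** * Holomorphic functions on normed spaces *)

Section Lines.
Variable R : realType.
Local Notation C := R[i].
Variable V : normedModType C.
Implicit Types (F G : V -> C) (x y h : V).

Lemma cfder_line F x h (t0 : C) L : cfder F (x + t0 *: h) L ->
  cder (fun t => F (x + t *: h)) t0 (L h).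
Proof.
move=> [linL _ hL] e e0; have n0 := nm_ge0 h.
have [|d d0 hd] := hL (e / (nm h + 1)); first by rewrite divr_gt0 //; lra.
exists (d / (nm h + 1)); first by rewrite divr_gt0 //; lra.
move=> t; rewrite ltr_pdivlMr; last by lra.
move=> ht; have t0' := normc_ge0 t.
have /hd H : nm (t *: h) < d by rewrite nmZ; nra.
rewrite scalerDl addrA mulrC -[t * L h](clinearZ t h linL).
apply: le_trans H _; rewrite nmZ mulrAC ler_pdivrMr; last by lra.
by rewrite mulrA mulrAC -!mulrA ler_pM2l //; nra.
Qed.

Definition holo_ball F x (r M : R) := forall y, nm (y - x) < r -> cdf F y /\ normc (F y) <= M.

Lemma holo_line F x h (r M rho : R) : 0 < r -> 0 < rho -> rho * nm h <= r ->
  holo_ball F x r M -> holo_disc (fun t => F (x + t *: h)) rho M.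
Proof.
move=> r0 rho0 hr hF t ht.
have : nm (x + t *: h - x) < r.
  rewrite addrDB nmZ; have [->|h0] := eqVneq h 0; first by rewrite nm0 mulr0.
  by apply: lt_le_trans hr; rewrite ltr_pM2r // nm_gt0.
move=> /hF[[L hL] hM]; split => //; apply/cder_cdf; exists (L h).
exact: cfder_line.
Qed.

(** Derivatives are handled as values of quotients: this carries the sup bound of [disc_factor], and
    later holomorphy in parameters, over to them. *)
Lemma disc_factor_der (f q : C -> C) (r : R) a : 0 < r -> cder f 0 a ->
  cdf (q : C^o -> C) 0 -> (forall z, normc z < r -> f z = f 0 + z * q z) -> q 0 = a.
Proof.
move=> r0 ha /cdf_zcts cq fq; apply: cder_uniq ha => e /cq[d d0 hd].
exists (Num.min d r); first by rewrite lt_min d0.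
move=> h; rewrite lt_min add0r => /andP[/hd + /fq ->]; rewrite add0r => hh.
rewrite (_ : _ - _ = (q h - q 0) * h); last by ring.
by rewrite normcM ler_wpM2r ?normc_ge0 // ltW.
Qed.

(** The restriction of [F] to the line through [x] and [x + h] lives on a disc of radius [r / nm h].
    Each division there costs [64 / r * nm h]; the first quotient at 0 is [L h], the second at 1 is
    the remainder. *)
Lemma second_order F x (r M : R) L h : 0 < r -> holo_ball F x r M -> cfder F x L ->
  nm h < r -> normc (L h) <= 64 / r * M * nm h /\
    normc (F (x + h) - F x - L h) <= (64 / r) ^+ 2 * M * nm h ^+ 2.
Proof.
move=> r0 hF hL hh; have [->|h0] := eqVneq h 0.
  have [linL _ _] := hL.
  by rewrite addr0 subrr (clinear0 linL) nm0 expr0n subr0 normc0 !mulr0.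
have n0 : 0 < nm h by rewrite nm_gt0.
pose rho := r / nm h; have rho0 : 0 < rho by exact: divr_gt0.
have rho1 : 1 < rho by rewrite /rho ltr_pdivlMr // mul1r.
have hl : holo_disc (fun t => F (x + t *: h)) rho M.
  by apply: (holo_line r0) => //; rewrite /rho divfK // gt_eqF.
have n00 : normc (0 : C) < rho by rewrite normc0.
have n01 : normc (1 : C) < rho by rewrite normc1.
have [q hq fq] := disc_factor rho0 hl.
have [q1 hq1 fq1] := disc_factor rho0 hq.
have q0 : q 0 = L h.
  apply: (disc_factor_der rho0 _ (hq 0 n00).1 fq).
  by apply: cfder_line; rewrite scale0r addr0.
have E1 : 64 / rho = 64 / r * nm h by rewrite /rho; field; rewrite !gt_eqF.
have := (hq 0 n00).2; rewrite q0 E1 mulrAC => ->; split=> //.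
have := fq 1 n01; have := fq1 1 n01; rewrite !scale1r !scale0r !addr0 !mul1r q0 => -> ->.
have -> : F x + (L h + q1 1) - F x - L h = q1 1 by ring.
by apply: le_trans (hq1 1 n01).2 _; rewrite E1; set a := 64 / r; rewrite le_eqVlt; apply/orP; left; apply/eqP; ring.
Qed.

Lemma holo_ballS F x (r r' M : R) : r' <= r -> holo_ball F x r M -> holo_ball F x r' M.
Proof. by move=> hr hF y hy; apply: hF; exact: lt_le_trans hr. Qed.

Lemma cfderB F G x L L' : cfder F x L -> cfder G x L' ->
  cfder (fun y => F y - G y) x (fun h => L h - L' h).
Proof.
move=> /cfder_differentiable[dF eF] /cfder_differentiable[dG eG].
have H := differentiable_cfder (differentiableB dF dG).
have E : 'd ((F : V -> C^o) - (G : V -> C^o)) x = (L : V -> C^o) - (L' : V -> C^o) :> (V -> C^o).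
  by apply: etrans (diffB dF dG) _; congr (_ - _).
by move: H; rewrite E.
Qed.

(** Stability under uniform limits. Applied to differences of approximants, [second_order] makes
    their derivatives at [x] a Cauchy family; applied to each approximant, it gives a quadratic
    remainder independent of the index, which survives in the limit. *)
Lemma cdf_limit F x (r : R) : 0 < r ->
  (forall e : R, 0 < e -> exists G M, holo_ball G x r M /\
      forall y, nm (y - x) < r -> normc (F y - G y) <= e) ->
  cdf F x.
Proof.
move=> r0 H.
have [G0 [M0 [hG0 hFG0]]] := H 1 ltr01.
(* A common bound: [G] is within 1 of [F], which is within 1 of [G0], which is bounded by [M0]. *)
pose M := M0 + 2.
have eps0 k : 0 < k.+1%:R^-1 :> R by rewrite invr_gt0 ltr0n.
have eps1 k : k.+1%:R^-1 <= 1 :> R by rewrite invf_le1 ?ltr0n // ler1n.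
have HM k : exists G, holo_ball G x r M /\
    forall y, nm (y - x) < r -> normc (F y - G y) <= k.+1%:R^-1.
  have [G [M' [hG hFG]]] := H _ (eps0 k).
  exists G; split => // y hy; split; first by case: (hG y hy).
  have e1 := hFG y hy; have e2 := hFG0 y hy; have [_ e3] := hG0 y hy.
  have := le_normcD (G y - F y) (F y); rewrite subrK normcBC.
  have := le_normcD (F y - G0 y) (G0 y); rewrite subrK.
  have := eps1 k; rewrite /M; set ek := k.+1%:R^-1 in e1 *; lra.
have [G hG] := choice HM.
have hx : nm (x - x) < r by rewrite subrr nm0.
have HL k : exists L, cfder (G k) x L by have [/(_ x hx)[]] := hG k.
have [L hL] := choice HL.
have linL k : clinear (L k) by have [] := hL k.
pose c h k := 64 / r * k.+1%:R^-1 * nm h.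
have Ldist h j k : normc (L j h - L k h) <= c h j + c h k.
  have [->|h0] := eqVneq h 0; first by rewrite /c !(clinear0 (linL _)) nm0 subrr normc0 !mulr0 addr0.
  have n0 : 0 < nm h by rewrite nm_gt0.
  have hB : holo_ball (fun y => G j y - G k y) x r (j.+1%:R^-1 + k.+1%:R^-1).
    move=> y hy; have [gj fj] := hG j; have [gk fk] := hG k; split.
      by apply: cdfB; [case: (gj y hy)|case: (gk y hy)].
    have -> : G j y - G k y = (F y - G k y) - (F y - G j y) by ring.
    by apply: le_trans (le_normcB _ _) _; have := fj y hy; have := fk y hy; set ej := j.+1%:R^-1; set ek := k.+1%:R^-1; lra.
  (* The estimate holds only inside the ball, so [h] is rescaled to length [r / 2] and linearity
     brings it back. *)
  pose s := r / 2 / nm h; have s0 : 0 < s by rewrite !divr_gt0.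
  have ns : normc (s%:C) = s by rewrite normcR ger0_norm // ltW.
  have hs : nm (s%:C *: h) < r by rewrite nmZ ns /s divfK ?gt_eqF //; lra.
  have [+ _] := second_order r0 hB (cfderB (hL j) (hL k)) hs.
  have -> : L j (s%:C *: h) - L k (s%:C *: h) = s%:C * (L j h - L k h).
    by rewrite !(clinearZ _ _ (linL _)) -scalerBr.
  rewrite nmZ normcM ns /c mulrCA ler_pM2l //.
  by rewrite mulrDr mulrDl.
have Hl h : exists l, forall k, normc (L k h - l) <= 2 * c h k.
  exact: complex_dist_limit.
have [l hl] := choice Hl.
have lim0 (z : C) (K : R) : (forall k : nat, normc z <= K * k.+1%:R^-1) -> z = 0.
  move=> hz; apply: eq0_normc; apply/eqP; rewrite eq_le normc_ge0 andbT.
  by apply: (@le_eps_nat _ _ _ K) => k; rewrite add0r.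
have linl : clinear (l : V -> C^o).
  move=> a u v; apply/eqP; rewrite -subr_eq0; apply/eqP.
  apply: (lim0 _ (2 * (64 / r) * (nm (a *: u + v) + normc a * nm u + nm v))) => k.
  have -> : l (a *: u + v) - (a *: (l u : C^o) + l v) =
     (- (L k (a *: u + v) - l (a *: u + v))) + (a * (L k u - l u) + (L k v - l v)).
    rewrite (linL k) /GRing.scale /=; ring.
  apply: le_trans (le_normcD _ _) _; rewrite normcN.
  have := le_normcD (a * (L k u - l u)) (L k v - l v); rewrite normcM.
  have := hl (a *: u + v) k; have := hl u k; have := hl v k; rewrite /c.
  set p := normc (L k v - l v); set q := normc (L k u - l u); set s := normc (L k (a *: u + v) - _).
  move=> e1 e2 e3 e4.
  have : normc a * q <= normc a * (2 * (64 / r * k.+1%:R^-1 * nm u)).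
    by rewrite ler_wpM2l ?normc_ge0.
  set ek := k.+1%:R^-1 in e1 e2 e3 *; set D := 64 / r in e1 e2 e3 *; lra.
have M_ge0 : 0 <= M.
  by have [_ e3] := hG0 x hx; have := normc_ge0 (G0 x); rewrite /M; lra.
exists l; split => //.
- exists (64 / r * M + 2 * (64 / r)) => h.
  have [->|h0] := eqVneq h 0; first by rewrite (clinear0 linl) normc0 nm0 mulr0.
  have n0 : 0 < nm h by rewrite nm_gt0.
  pose s := r / 2 / nm h; have s0 : 0 < s by rewrite !divr_gt0.
  have ns : normc (s%:C) = s by rewrite normcR ger0_norm // ltW.
  have hs : nm (s%:C *: h) < r by rewrite nmZ ns /s divfK ?gt_eqF //; lra.
  have [+ _] := second_order r0 (hG 0%N).1 (hL 0%N) hs.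
  rewrite (clinearZ _ _ (linL _)) nmZ normcM ns mulrCA ler_pM2l // => e1.
  have := hl h 0%N; rewrite /c invr1 mulr1 => e2.
  have := le_normcD (- (L 0%N h - l h)) (L 0%N h); rewrite normcN opprB subrK; lra.
- have est h : nm h < r -> normc (F (x + h) - F x - l h) <= (64 / r) ^+ 2 * M * nm h ^+ 2.
    move=> hh; apply: (@le_eps_nat _ _ _ (2 + 2 * (64 / r) * nm h)) => k.
    have [_] := second_order r0 (hG k).1 (hL k) hh.
    have hxh : nm (x + h - x) < r by rewrite addrDB.
    have := (hG k).2 _ hxh; have := (hG k).2 _ hx; have := hl h k; rewrite /c.
    have -> : F (x + h) - F x - l h = (F (x + h) - G k (x + h)) - (F x - G k x)
       + (L k h - l h) + (G k (x + h) - G k x - L k h) by ring.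
    set a := F (x + h) - _; set b := F x - _; set d := L k h - _; set e := G k _ - _ - _.
    move=> e1 e2 e3 e4; apply: le_trans (le_normcD _ _) _.
    have := le_normcD (a - b) d; have := le_normcB a b.
    set ek := k.+1%:R^-1 in e1 e2 e3 *; set D := 64 / r in e1 e2 e3 e4 *; lra.
  pose K := (64 / r) ^+ 2 * M; have K0 : 0 <= K by rewrite mulr_ge0 // sqr_ge0.
  move=> e e0; exists (Num.min r (e / (K + 1))).
    by rewrite lt_min r0 divr_gt0 //; lra.
  move=> h; rewrite lt_min => /andP[/est H1]; rewrite ltr_pdivlMr; last by lra.
  move=> H2; apply: le_trans H1 _; rewrite -/K expr2 mulrA.
  by rewrite ler_wpM2r ?nm_ge0 //; have := nm_ge0 h; lra.
Qed.

End Lines.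

(** * Weierstrass division *)

Section Direction.
Variable R : realType.
Local Notation C := R[i].
Variables (V : normedModType C) (lam : V -> C) (v : V) (Bl : R).
Hypothesis lam_lin : clinear (lam : V -> C^o).
Hypothesis lam_bnd : forall x, normc (lam x) <= Bl * nm x.
Hypothesis lam_v : lam v = 1.
Implicit Types (F G H : V -> C) (x y : V).

(** The projection onto the kernel of [lam] along [v]. The pair [lam], [v] acts as a distinguished
    coordinate with its axis, so that division works in any direction without a change of
    coordinates. *)
Definition dirproj x := x - lam x *: v.
Local Notation P := dirproj.

Lemma dirproj_lin : clinear P.
Proof.
move=> a x y; rewrite /P lam_lin scalerDl scalerBr -scalerA opprD.
by rewrite addrACA.
Qed.

Lemma dirprojE x : P x + lam x *: v = x.
Proof. by rewrite subrK. Qed.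

Lemma lam_line y (t : C) : lam (P y + t *: v) = t.
Proof.
rewrite (clinearD _ _ lam_lin) (clinearB _ _ lam_lin) !(clinearZ _ _ lam_lin) lam_v.
by rewrite /GRing.scale /= !mulr1 subrr add0r.
Qed.

Lemma lam_proj y : lam (P y) = 0.
Proof. by have := lam_line y 0; rewrite scale0r addr0. Qed.

Lemma dirproj_line y (t : C) : P (P y + t *: v) = P y.
Proof. by rewrite {1}/P lam_line addrK. Qed.

Lemma dirprojK y : P (P y) = P y.
Proof. by rewrite {1}/P lam_proj scale0r subr0. Qed.

Lemma dirproj0 : P 0 = 0.
Proof. exact: clinear0 dirproj_lin. Qed.

Let Bp := 1 + `|Bl| * nm v.

Lemma lam_bnd' x : normc (lam x) <= `|Bl| * nm x.
Proof. by apply: le_trans (lam_bnd x) _; rewrite ler_wpM2r ?nm_ge0 ?ler_norm. Qed.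

Lemma dirproj_bnd x : nm (P x) <= Bp * nm x.
Proof.
rewrite /P; apply: le_trans (nmD _ _) _; rewrite nmN nmZ /Bp mulrDl mul1r lerD2l.
by rewrite mulrAC ler_wpM2r ?nm_ge0 // lam_bnd'.
Qed.

(** A polydisc for the splitting [P x + lam x *: v]; it contains the whole disc of radius [r] on
    each line parallel to [v] that it meets. *)
Definition dom (rho r : R) x := nm (P x) < rho /\ normc (lam x) < r.

Definition holo_dom F (rho r M : R) := forall x, dom rho r x -> cdf F x /\ normc (F x) <= M.

Lemma dom_open rho r x : dom rho r x -> exists2 d : R, 0 < d &
  forall y, nm (y - x) < d -> dom rho r y.
Proof.
move=> [h1 h2].
have Bp0 : 0 < Bp by rewrite /Bp ltr_pwDl // mulr_ge0 ?nm_ge0.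
have Bl0 : 0 < `|Bl| + 1 by rewrite ltr_wpDl.
exists (Num.min ((rho - nm (P x)) / Bp) ((r - normc (lam x)) / (`|Bl| + 1))).
  by rewrite lt_min !divr_gt0 // subr_gt0.
move=> y; rewrite lt_min !ltr_pdivlMr // => /andP[u1 u2].
have -> : y = x + (y - x) by rewrite subrKC.
set h := y - x in u1 u2 *; split.
  rewrite (clinearD _ _ dirproj_lin); apply: le_lt_trans (nmD _ _) _.
  by have := dirproj_bnd h; lra.
rewrite (clinearD _ _ lam_lin); apply: le_lt_trans (le_normcD _ _) _.
have := lam_bnd' h; have := nm_ge0 h; lra.
Qed.

Lemma dom_proj rho r x : 0 < r -> dom rho r x -> dom rho r (P x).
Proof. by move=> r0 [h1 h2]; split; rewrite ?dirprojK // lam_proj normc0. Qed.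

Lemma dom_line rho r x (t : C) : dom rho r x -> normc t < r -> dom rho r (P x + t *: v).
Proof. by move=> [h1 h2] ht; split; rewrite ?dirproj_line ?lam_line. Qed.

Lemma dom_sub rho r rho' r' x : rho <= rho' -> r <= r' -> dom rho r x -> dom rho' r' x.
Proof. by move=> h1 h2 [a b]; split; [apply: lt_le_trans h1|apply: lt_le_trans h2]. Qed.

Lemma cdf_lam x : cdf lam x.
Proof. exact: cdf_lin lam_lin lam_bnd. Qed.

Lemma cdf_proj_line F x (t : C) : cdf F (P x + t *: v) -> cdf (fun y => F (P y + t *: v)) x.
Proof.
apply: (@cdf_affine _ _ _ (fun y => P y + t *: v) P F x Bp); first exact: dirproj_lin.
  exact: dirproj_bnd.
by move=> h; rewrite (clinearD _ _ dirproj_lin) addrAC.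
Qed.

Lemma cdf_proj F x : cdf F (P x) -> cdf (fun y => F (P y)) x.
Proof.
move=> hF; have := @cdf_proj_line F x 0; rewrite scale0r addr0 => /(_ hF).
by congr cdf; apply/funext => y; rewrite addr0.
Qed.

Lemma cdf_dom_limit F rho r x : dom rho r x ->
  (forall e : R, 0 < e -> exists G M, holo_dom G rho r M /\
      forall y, dom rho r y -> normc (F y - G y) <= e) -> cdf F x.
Proof.
move=> /dom_open[d d0 hd] hF; apply: (cdf_limit d0) => e /hF[G [M [hG hFG]]].
by exists G, M; split=> y /hd; [exact: hG|exact: hFG].
Qed.

(** The slice at 0 is the uniform limit of the slices at small [s != 0], since they differ by [s]
    times a bounded quotient. *)
Lemma cdf_slice0 (Q Q1 : V -> C -> C) rho r M K x : 0 < r -> 0 <= K ->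
  (forall y t, dom rho r (P y) -> normc t < r ->
     [/\ Q (P y) t = Q (P y) 0 + t * Q1 (P y) t, normc (Q1 (P y) t) <= K
      & normc (Q (P y) t) <= M]) ->
  (forall s, normc s < r -> s != 0 -> forall y, dom rho r y -> cdf (fun y => Q (P y) s) y) ->
  dom rho r x -> cdf (fun y => Q (P y) 0) x.
Proof.
move=> r0 K0 hQ hs hx; apply: (cdf_dom_limit hx) => e e0.
pose s := Num.min (r / 2) (e / (K + 1)).
have K1 : 0 < K + 1 by lra.
have s0 : 0 < s by rewrite lt_min !divr_gt0.
have sr : s < r by rewrite gt_min; apply/orP; left; lra.
have se : s * (K + 1) <= e by rewrite -ler_pdivlMr // ge_min lexx orbT.
have ns : normc (s%:C) = s by rewrite normcR ger0_norm // ltW.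
have sr' : normc (s%:C) < r by rewrite ns.
exists (fun y => Q (P y) s%:C), M; split=> y hy.
  split; last by have [] := hQ y s%:C (dom_proj r0 hy) sr'.
  by apply: hs => //; rewrite -normc_gt0 ns.
have [-> h _] := hQ y s%:C (dom_proj r0 hy) sr'.
rewrite opprD addNKr normcN normcM ns; nra.
Qed.

(** Applying [disc_factor] on each line parallel to [v] gives a quotient with no regularity across
    the lines. Off the hyperplane [lam = 0] it is a difference quotient, hence holomorphic; at the
    hyperplane it is compared with its first order expansion in [lam]. *)
Theorem dir_factor F rho r M : 0 < r -> holo_dom F rho r M ->
  exists2 H, holo_dom H rho r (64 / r * M) &
    forall x, dom rho r x -> F x = F (P x) + lam x * H x.
Proof.
move=> r0 hF.
have n0r : normc (0 : C) < r by rewrite normc0.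
have HF x : dom rho r x -> holo_disc (fun t => F (P x + t *: v)) r M.
  move=> hx t ht; have [[L hL] hM] := hF _ (dom_line hx ht); split => //.
  by apply/cder_cdf; exists (L v); exact: cfder_line.
(* Quotients are chosen for all lines at once; lines without the bound get the value 0. *)
have next (k : R) (p : V -> C -> C) : exists p1 : V -> C -> C,
    forall y, holo_disc (p y) r k -> holo_disc (p1 y) r (64 / r * k) /\
      forall t, normc t < r -> p y t = p y 0 + t * p1 y t.
  suff /choice[p1 hp1] : forall y, exists p1, holo_disc (p y) r k ->
      holo_disc p1 r (64 / r * k) /\ forall t, normc t < r -> p y t = p y 0 + t * p1 t.
    by exists p1.
  move=> y; have [hy|] := pselect (holo_disc (p y) r k); last by exists (fun _ => 0).
  by have [p1 h1 h2] := disc_factor r0 hy; exists p1.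
have [q hq] := next M (fun y t => F (P y + t *: v)).
have qP y : dom rho r (P y) -> holo_disc (q (P y)) r (64 / r * M) /\
    forall t, normc t < r -> F (P y + t *: v) = F (P y) + t * q (P y) t.
  by move=> hy; have := hq _ (HF _ hy); rewrite dirprojK scale0r addr0.
have [q1 hq1] := next (64 / r * M) q.
have [q2 hq2] := next (64 / r * (64 / r * M)) q1.
(* For [rho <= 0] the polydisc is empty and [M] could be negative. *)
have [dom0|ndom] := pselect (exists y, dom rho r y); last first.
  by exists (fun _ => 0) => x hx; exfalso; apply: ndom; exists x.
have M0 : 0 <= M.
  by have [y hy] := dom0; have [_] := hF y hy; apply: le_trans; exact: normc_ge0.
have D0 : 0 <= 64 / r by rewrite divr_ge0 // ltW.
have DM1 := mulr_ge0 D0 M0; have DM2 := mulr_ge0 D0 DM1; have DM3 := mulr_ge0 D0 DM2.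
have s1 s : normc s < r -> s != 0 -> forall y, dom rho r y -> cdf (fun y => q (P y) s) y.
  move=> hs s0 y hy; have [d d0 hd] := dom_open hy.
  apply: (@cdf_near _ _ (fun y => (F (P y + s *: v) - F (P y)) * s^-1) _ _ d d0).
    move=> z /hd hz; have [_ ->] := qP z (dom_proj r0 hz) => //.
    by rewrite addrDB mulrC mulKf.
  apply: cdfM; last exact: cdf_cst.
  apply: cdfB; first by apply: cdf_proj_line; case: (hF _ (dom_line hy hs)).
  by apply: cdf_proj; case: (hF _ (dom_proj r0 hy)).
have A0 y : dom rho r y -> cdf (fun y => q (P y) 0) y.
  apply: (@cdf_slice0 q q1 rho r (64 / r * M) (64 / r * (64 / r * M))) => //.
  move=> z t hz ht; have [hqz _] := qP z hz; have [h1 h2] := hq1 _ hqz.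
  by split; [exact: h2|case: (h1 t ht)|case: (hqz t ht)].
have s2 s : normc s < r -> s != 0 -> forall y, dom rho r y -> cdf (fun y => q1 (P y) s) y.
  move=> hs s0 y hy; have [d d0 hd] := dom_open hy.
  apply: (@cdf_near _ _ (fun y => (q (P y) s - q (P y) 0) * s^-1) _ _ d d0).
    move=> z /hd hz; have [hqz _] := qP z (dom_proj r0 hz).
    have [_ ->] := hq1 _ hqz => //.
    by rewrite addrDB mulrC mulKf.
  by apply: cdfM; [apply: cdfB; [exact: s1|exact: A0]|exact: cdf_cst].
have A1 y : dom rho r y -> cdf (fun y => q1 (P y) 0) y.
  apply: (@cdf_slice0 q1 q2 rho r (64 / r * (64 / r * M)) (64 / r * (64 / r * (64 / r * M)))) => //.
  move=> z t hz ht; have [hqz _] := qP z hz; have [h1 _] := hq1 _ hqz.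
  have [h3 h4] := hq2 _ h1.
  by split; [exact: h4|case: (h3 t ht)|case: (h1 t ht)].
pose H x := q (P x) (lam x).
have HE x : dom rho r x -> F x = F (P x) + lam x * H x.
  move=> hx; have [_ h] := qP x (dom_proj r0 hx); case: hx => _ /h.
  by rewrite dirprojE.
exists H => // x hx; have [hqx _] := qP x (dom_proj r0 hx); split; last first.
  by case: hx => _ /hqx[].
have [d d0 hd] := dom_open hx.
have [l0|l0] := eqVneq (lam x) 0; last first.
  have [d' d'0 hd'] := cdf_cts (cdf_lam x) (ltac:(by rewrite normc_gt0) : 0 < normc (lam x)).
  apply: (@cdf_near _ _ (fun y => (F y - F (P y)) * (lam y)^-1) _ _ (Num.min d d')).
  + by rewrite lt_min d0.
  + move=> y; rewrite lt_min => /andP[/hd hy /hd']; rewrite subrKC => hl.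
    have ly : lam y != 0 by apply/eqP => ly; move: hl; rewrite ly sub0r normcN ltxx.
    by rewrite (HE y hy) addrDB mulrC mulKf.
  + apply: cdfM; last by apply: cdfV => //; exact: cdf_lam.
    apply: cdfB; first by case: (hF _ hx).
    by apply: cdf_proj; case: (hF _ (dom_proj r0 hx)).
pose K := 64 / r * (64 / r * (64 / r * M)).
(* [E] is holomorphic because the slices [q] and [q1] at 0 are, and [H - E] is quadratic in [lam].
   At a point with [lam x = 0] the derivative of [E] is therefore one of [H]. *)
pose E y := q (P y) 0 + lam y * q1 (P y) 0.
have dE : cdf E x by apply: cdfD; [exact: A0|apply: cdfM; [exact: cdf_lam|exact: A1]].
have HEx y : dom rho r y -> normc (H y - E y) <= K * normc (lam y) ^+ 2.
  move=> hy; have [hqy _] := qP y (dom_proj r0 hy); have [h1 h2] := hq1 _ hqy.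
  have [h3 h4] := hq2 _ h1; have ly : normc (lam y) < r by case: hy.
  rewrite /H /E h2 // h4 //.
  rewrite (_ : _ - _ = lam y ^+ 2 * q2 (P y) (lam y)); last by ring.
  by rewrite normcM normcX mulrC ler_wpM2r ?sqr_ge0 //; case: (h3 _ ly).
have EHx : H x = E x.
  apply/eqP; rewrite -subr_eq0; apply/eqP/eq0_normc/eqP; rewrite eq_le normc_ge0 andbT.
  by apply: le_trans (HEx x hx) _; rewrite l0 normc0 expr0n mulr0.
have [L [linL bL hL]] := dE; exists L; split => // e e0.
have [|d' d'0 hd'] := hL (e / 2); first by lra.
have K0 : 0 <= K by [].
pose B := `|Bl| + 1; have B0 : 0 < B by rewrite ltr_wpDl.
pose KB := K * B ^+ 2; have KB0 : 0 <= KB by rewrite mulr_ge0 ?sqr_ge0.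
exists (Num.min (Num.min d d') (e / 2 / (KB + 1))).
  by rewrite !lt_min d0 d'0 !divr_gt0 //; lra.
move=> h; rewrite !lt_min => /andP[/andP[h1 /hd' h2] h3].
have hxh : dom rho r (x + h) by apply: hd; rewrite addrDB.
have n0 := nm_ge0 h.
have lh : normc (lam (x + h)) <= B * nm h.
  by rewrite (clinearD _ _ lam_lin) l0 add0r; have := lam_bnd' h; rewrite /B; lra.
have {lh} lh2 : K * normc (lam (x + h)) ^+ 2 <= KB * nm h * nm h.
  have -> : KB * nm h * nm h = K * (B * nm h) ^+ 2 by rewrite /KB; ring.
  by rewrite ler_wpM2l // ler_sqr ?nnegrE ?normc_ge0 // mulr_ge0 // ltW.
move: h3; rewrite ltr_pdivlMr; last by lra.
move=> h3.
have lh3 : KB * nm h * nm h <= e / 2 * nm h by rewrite ler_wpM2r //; lra.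
rewrite EHx (_ : _ - _ - _ = (H (x + h) - E (x + h)) + (E (x + h) - E x - L h)); last by ring.
by apply: le_trans (le_normcD _ _) _; have := HEx _ hxh; lra.
Qed.

(** The restriction of [H j] to the hyperplane [lam = 0] is the [j]-th Taylor coefficient of [F] in
    the direction [v]. *)
Lemma dir_tower F rho r M : 0 < r -> holo_dom F rho r M ->
  exists H : nat -> V -> C, [/\ forall x, H 0%N x = F x,
    forall j, holo_dom (H j) rho r ((64 / r) ^+ j * M) &
    forall j x, dom rho r x -> H j x = H j (P x) + lam x * H j.+1 x].
Proof.
move=> r0 hF.
have Hn (s : nat * (V -> C)) : exists H, holo_dom s.2 rho r ((64 / r) ^+ s.1 * M) ->
   holo_dom H rho r ((64 / r) ^+ s.1.+1 * M) /\
   forall x, dom rho r x -> s.2 x = s.2 (P x) + lam x * H x.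
  have [h|] := pselect (holo_dom s.2 rho r ((64 / r) ^+ s.1 * M)); last by exists (fun _ => 0).
  have [H hH hE] := dir_factor r0 h; exists H => _; split => //.
  by rewrite exprS -mulrA.
have [nx hnx] := choice Hn.
pose H := fix H k := if k is k'.+1 then nx (k', H k') else F.
have hH j : holo_dom (H j) rho r ((64 / r) ^+ j * M).
  elim: j => [|j IH]; first by rewrite expr0 mul1r.
  by have [] := hnx (j, H j) IH.
exists H; split => // j x hx; have [_ h] := hnx (j, H j) (hH j); exact: h.
Qed.

Lemma tower_expand (H : nat -> V -> C) rho r :
  (forall j x, dom rho r x -> H j x = H j (P x) + lam x * H j.+1 x) ->
  forall b x, dom rho r x ->
    H 0%N x = \sum_(j < b) lam x ^+ j * H j (P x) + lam x ^+ b * H b x.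
Proof.
move=> hH b x hx; elim: b => [|b IH]; first by rewrite big_ord0 add0r mul1r.
by rewrite big_ord_recr /= IH (hH b x hx) exprSr; ring.
Qed.

Lemma geometric_limit (q : nat -> V -> C) rho r (B : R) : 0 <= B ->
  (forall k, holo_dom (q k) rho r (B / 2 ^+ k)) ->
  exists Q, forall x, dom rho r x -> cdf Q x /\
    forall n, normc (Q x - \sum_(k < n) q k x) <= 4 * B / 2 ^+ n.
Proof.
move=> B0 hq.
pose S n x := \sum_(k < n) q k x.
(* The sum of the bounds of all terms from index [n] on. *)
pose c n := 2 * B / 2 ^+ n.
have c2 n : c n = B / 2 ^+ n + c n.+1 by rewrite /c exprS; field; rewrite expf_neq0.
have c0 n : 0 <= c n by rewrite /c divr_ge0 ?exprn_ge0 ?mulr_ge0.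
have step x : dom rho r x -> forall j i, normc (S (i + j)%N x - S j x) <= c j - c (i + j)%N.
  move=> hx j; elim=> [|i IH]; first by rewrite add0n !subrr normc0.
  rewrite addSn {1}/S big_ord_recr /= -/(S (i + j)%N x) addrAC.
  apply: le_trans (le_normcD _ _) _; have [_] := hq (i + j)%N x hx.
  by have := c2 (i + j)%N; lra.
have dist x j k : dom rho r x -> normc (S j x - S k x) <= c j + c k.
  move=> hx; case: (leqP j k) => [jk|/ltnW kj].
    by have := step x hx j (k - j)%N; rewrite subnK // normcBC; have := c0 k; lra.
  by have := step x hx k (j - k)%N; rewrite subnK //; have := c0 j; lra.
have HQ x : exists l, dom rho r x -> forall n, normc (S n x - l) <= 2 * c n.
  have [hx|] := pselect (dom rho r x); last by exists 0.
  by have [l hl] := complex_dist_limit (fun j k => dist x j k hx); exists l.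
have [Q hQ] := choice HQ.
have hQ' x n : dom rho r x -> normc (Q x - S n x) <= 4 * B / 2 ^+ n.
  move=> hx; have := hQ x hx n; rewrite normcBC /c.
  by rewrite (_ : 4 * B / 2 ^+ n = 2 * (2 * B / 2 ^+ n)); last by ring.
exists Q => x hx; split; last by move=> n; exact: hQ'.
apply: (cdf_dom_limit hx) => e e0.
have [n hn] := exists_lt_exp2 (4 * B / e).
have n0 : 0 < 2 ^+ n :> R by rewrite exprn_gt0.
exists (S n), (2 * B); split=> y hy; last first.
  apply: le_trans (hQ' y n hy) _; rewrite ler_pdivrMr //.
  by move: hn; rewrite ltr_pdivrMr // [_ * e]mulrC => /ltW.
split; first by apply: cdf_sum => i; case: (hq i y hy).
have := step y hy 0%N n; rewrite addn0 /S big_ord0 subr0 /c expr0 divr1.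
by have := c0 n; rewrite /c; lra.
Qed.

End Direction.

Section Weierstrass.
Variable R : realType.
Local Notation C := R[i].
Variables (V : normedModType C) (lam : V -> C) (v : V) (Bl : R).
Hypothesis lam_lin : clinear (lam : V -> C^o).
Hypothesis lam_bnd : forall x, normc (lam x) <= Bl * nm x.
Hypothesis lam_v : lam v = 1.
Implicit Types (F G H : V -> C) (x y : V).
Local Notation P := (dirproj lam v).
Local Notation dom := (dom lam v).
Local Notation holo_dom := (holo_dom lam v).

Lemma holo_domS F rho r rho' r' M : rho' <= rho -> r' <= r ->
  holo_dom F rho r M -> holo_dom F rho' r' M.
Proof. by move=> h1 h2 hF x hx; apply: hF; exact: dom_sub hx. Qed.

Lemma dom0 rho r : 0 < rho -> 0 < r -> dom rho r 0.
Proof.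
by move=> h1 h2; split; rewrite ?(dirproj0 v lam_lin) ?(clinear0 lam_lin) ?nm0 ?normc0.
Qed.

Lemma dom_nm rho r x : dom rho r x -> nm x < rho + r * (nm v + 1).
Proof.
move=> [h1 h2]; rewrite -[x in nm x](dirprojE lam v).
apply: le_lt_trans (nmD _ _) _; rewrite nmZ; apply: ltr_leD => //.
have := nm_ge0 v; have := normc_ge0 (lam x); nra.
Qed.

(* Repeated approximate division: [t^b H / U] differs from [F H / U] by
   [p H / U], which is half as large as the dividend once [p] is small. *)
Theorem weierstrass_division F G (T : nat -> V -> C) (b : nat) (rho0 r0 MG : R) :
  0 < rho0 -> 0 < r0 ->
  (forall j, exists M, holo_dom (T j) rho0 r0 M) ->
  (forall j x, dom rho0 r0 x -> T j x = T j (P x) + lam x * T j.+1 x) ->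
  (forall x, T 0%N x = F x) ->
  (forall j, (j < b)%N -> T j 0 = 0) -> T b 0 != 0 ->
  holo_dom G rho0 r0 MG ->
  exists rho r Q (A : nat -> V -> C), [/\ 0 < rho, 0 < r,
    forall x, dom rho r x -> cdf Q x /\ forall j, cdf (A j) x &
    forall x, dom rho r x -> G x = F x * Q x + \sum_(j < b) lam x ^+ j * A j (P x)].
Proof.
move=> rho00 r00 hT TE T0F Tj0 Tb0 hG.
have d00 := dom0 rho00 r00.
have cT j : cdf (T j) 0 by have [M hM] := hT j; have [] := hM 0 d00.
pose c := normc (T b 0) / 2.
have cpos : 0 < c by rewrite /c divr_gt0 // normc_gt0.
have [d d0 hd] := cdf_cts (cT b) cpos.
have Uc x : nm x < d -> c <= normc (T b x).
  move=> /hd; rewrite add0r => h.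
  have := normc_sub_ge (T b 0) (T b x); rewrite normcBC /c in h *; lra.
have nv0 := nm_ge0 v.
(* The order of choices matters: [kap] and [eta] depend on [r], so [r] is fixed first. Only [rho]
   then shrinks, until the coefficients [T j (P x)] with [j < b], which vanish at 0, are below
   [eta]. *)
pose r := Num.min r0 (d / 2 / (nm v + 1)).
have r_gt0 : 0 < r by rewrite lt_min r00 !divr_gt0 //; lra.
have rr0 : r <= r0 by rewrite ge_min lexx.
have rv : r * (nm v + 1) <= d / 2.
  by rewrite -ler_pdivlMr; [rewrite ge_min lexx orbT|lra].
pose kap := (64 / r) ^+ b.
have kap0 : 0 < kap by rewrite exprn_gt0 // divr_gt0.
pose sr := \sum_(j < b) r ^+ j.
have sr0 : 0 <= sr by apply: sumr_ge0 => j _; rewrite exprn_ge0 // ltW.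
(* This makes [p] at most [c / (2 * kap)]. Multiplied by the cost [kap] of [b] divisions and divided
   by [T b], which is at least [c], it leaves the factor one half. *)
pose eta := c / (2 * kap) / (sr + 1).
have sr1 : 0 < sr + 1 by rewrite ltr_wpDl.
have ck0 : 0 < c / (2 * kap) by apply: divr_gt0 => //; exact: mulr_gt0.
have eta0 : 0 < eta by exact: divr_gt0.
have [d' d'0 hd'] : exists2 d' : R, 0 < d' & forall y, nm y < d' ->
    forall j : 'I_b, normc (T j y) <= eta.
  apply: near0_forall => j; have [d1 d10 h1] := cdf_cts (cT j) eta0.
  by exists d1 => // y /h1; rewrite add0r Tj0 // subr0 => /ltW.
pose rho := Num.min (Num.min rho0 (d / 2)) d'.
have rho_gt0 : 0 < rho by rewrite !lt_min rho00 d'0 andbT; lra.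
have [rho_1 rho_2 rho_3] : [/\ rho <= rho0, rho <= d / 2 & rho <= d'].
  by split; rewrite !ge_min lexx ?orbT.
have sub x : dom rho r x -> dom rho0 r0 x by exact: dom_sub.
have Ux x : dom rho r x -> c <= normc (T b x).
  by move=> /dom_nm h; apply: Uc; lra.
have Un x : dom rho r x -> T b x != 0.
  by move=> /Ux h; rewrite -normc_gt0; lra.
pose p x := \sum_(j < b) lam x ^+ j * T j (P x).
have pE x : dom rho r x -> F x = p x + lam x ^+ b * T b x.
  by move=> /sub hx; rewrite -T0F (tower_expand TE b hx).
have cTd j x : dom rho r x -> cdf (T j) x.
  by move=> /sub hx; have [M hM] := hT j; have [] := hM x hx.
have dproj x : dom rho r x -> dom rho r (P x) by exact: dom_proj.
have cp x : dom rho r x -> cdf p x.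
  move=> hx; apply: cdf_sum => j; apply: cdfM; first by apply: cdfX; exact: cdf_lam lam_bnd _.
  by apply: (cdf_proj lam_lin lam_bnd); apply: cTd; exact: dproj.
have p_le x : dom rho r x -> normc (p x) <= c / (2 * kap).
  move=> [h1 h2]; have H : normc (p x) <= sr * eta.
    rewrite /p /sr mulr_suml; elim/big_rec2: _ => [|j u w _ IH]; first by rewrite normc0.
    apply: le_trans (le_normcD _ _) _; apply: lerD => //.
    rewrite normcM normcX; apply: ler_pM; rewrite ?exprn_ge0 ?normc_ge0 //.
      by apply: lerXn2r; rewrite ?nnegrE ?normc_ge0 //; apply: ltW.
    by apply: hd' => //; exact: lt_le_trans rho_3.
  apply: le_trans H _; rewrite /eta mulrCA ger_pMr; first by rewrite ler_pdivrMr // mul1r lerDl.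
  by [].
have MG0 : 0 <= MG by have [_ h] := hG 0 d00; apply: le_trans h; exact: normc_ge0.
pose Mk k := MG / 2 ^+ k.
have Mk0 k : 0 <= Mk k by rewrite divr_ge0 ?exprn_ge0.
have step (s : nat * (V -> C)) : exists S : nat -> V -> C, holo_dom s.2 rho r (Mk s.1) ->
  [/\ forall x, S 0%N x = s.2 x, forall j, holo_dom (S j) rho r ((64 / r) ^+ j * Mk s.1) &
      forall j x, dom rho r x -> S j x = S j (P x) + lam x * S j.+1 x].
  have [h|] := pselect (holo_dom s.2 rho r (Mk s.1)); last by exists (fun _ _ => 0).
  by have [S hS] := dir_tower lam_lin lam_bnd lam_v r_gt0 h; exists S.
have [S hS] := choice step.
(* Substituting [lam ^+ b = (F - p) / T b] in the expansion of the dividend leaves this error, which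
   is the next dividend. *)
pose nxt s x := - (p x * S s b x / T b x).
pose g := fix g k := if k is k'.+1 then nxt (k', g k') else G.
have hg k : holo_dom (g k) rho r (Mk k).
  elim: k => [|k IH].
    by move=> x /sub/hG; rewrite /Mk expr0 divr1.
  have [s0 sj sE] := hS (k, g k) IH => x hx; split.
    apply: cdfN; apply: cdfM; last by apply: cdfV; [exact: Un|exact: cTd].
    by apply: cdfM; [exact: cp|case: (sj b x hx)].
  rewrite /= /nxt normcN !normcM normcV ler_pdivrMr; last by rewrite normc_gt0; exact: Un.
  apply: (@le_trans _ _ (c / (2 * kap) * (kap * Mk k))).
    by apply: ler_pM; rewrite ?normc_ge0 ?p_le //; case: (sj b x hx).
  rewrite (_ : _ * _ = Mk k.+1 * c); last first.
    by rewrite /Mk exprS; field; rewrite expf_neq0 // gt_eqF.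
  by rewrite ler_wpM2l ?Ux.
pose Sk (k : nat) := S (k, g k).
pose q k x := Sk k b x / T b x.
have bnd_q k : holo_dom (q k) rho r (kap * MG / c / 2 ^+ k).
  have [s0 sj sE] := hS (k, g k) (hg k) => x hx; split.
    by apply: cdfM; [case: (sj b x hx)|apply: cdfV; [exact: Un|exact: cTd]].
  rewrite normcM normcV ler_pdivrMr; last by rewrite normc_gt0; exact: Un.
  have [_ h] := sj b x hx; apply: le_trans h _.
  rewrite (_ : _ / 2 ^+ k * _ = kap * Mk k / c * normc (T b x)); last by rewrite /Mk; ring.
  rewrite -mulrA ler_peMr //; first by rewrite mulr_ge0 // ltW.
  by rewrite mulrC ler_pdivlMr // mul1r Ux.
have bq0 : 0 <= kap * MG / c by rewrite !mulr_ge0 ?invr_ge0 // ltW.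
have [Q hQ] := geometric_limit lam_lin lam_bnd bq0 bnd_q.
have bnd_A j k : holo_dom (Sk k j) rho r ((64 / r) ^+ j * MG / 2 ^+ k).
  by have [_ sj _] := hS (k, g k) (hg k); rewrite -mulrA; exact: sj.
have bA0 j : 0 <= (64 / r) ^+ j * MG.
  by rewrite mulr_ge0 // exprn_ge0 // divr_ge0 // ltW.
have HA j := geometric_limit lam_lin lam_bnd (bA0 j) (bnd_A j).
have [A hA] := choice HA.
exists rho, r, Q, A; split => //.
  by move=> x hx; split => [|j]; [case: (hQ x hx)|case: (hA j x hx)].
move=> x hx.
(* The division identity is exact after [n] rounds, with error [g n], bounded by [MG / 2 ^+ n]. *)
have part n : G x = F x * (\sum_(k < n) q k x) +
   \sum_(j < b) lam x ^+ j * (\sum_(k < n) Sk k j (P x)) + g n x.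
  elim: n => [|n IH].
    by rewrite big_ord0 mulr0 add0r big1 ?add0r // => j _; rewrite big_ord0 mulr0.
  rewrite [LHS]IH big_ord_recr /=.
  have -> : \sum_(j < b) lam x ^+ j * (\sum_(k < n.+1) Sk k j (P x)) =
      \sum_(j < b) lam x ^+ j * (\sum_(k < n) Sk k j (P x)) +
      \sum_(j < b) lam x ^+ j * Sk n j (P x).
    by rewrite -big_split; apply: eq_bigr => j _; rewrite big_ord_recr mulrDr.
  have [s0 _ sE] := hS (n, g n) (hg n).
  have := tower_expand sE b hx; rewrite s0 /=.
  rewrite /nxt /q -/(Sk n); set X := \sum_(j < b) _ * S _ _ _ => ->.
  rewrite pE //; have := Un x hx; set U := T b x; set s := Sk n b x => U0.
  by field.
apply/eqP; rewrite -subr_eq0; apply/eqP.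
pose KA := \sum_(j < b) r ^+ j * (4 * ((64 / r) ^+ j * MG)).
have KA0 : 0 <= KA.
  by apply: sumr_ge0 => j _; rewrite mulr_ge0 ?exprn_ge0 ?(ltW r_gt0) // mulr_ge0.
pose K := normc (F x) * (4 * (kap * MG / c)) + KA + MG.
have K0 : 0 <= K.
  apply: addr_ge0 => //; apply: addr_ge0 => //; apply: mulr_ge0; first exact: normc_ge0.
  exact: mulr_ge0.
apply: (@normc_small _ _ K K0) => e e0.
have [n hn] := exists_lt_exp2 e^-1.
have n0 : 0 < 2 ^+ n :> R by rewrite exprn_gt0.
have ne : (2 ^+ n)^-1 <= e by rewrite -(invrK e) lef_pV2 ?posrE ?invr_gt0 // ltW.
suff H : normc (G x - (F x * Q x + \sum_(j < b) lam x ^+ j * A j (P x))) <= K / 2 ^+ n.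
  by apply: le_trans H _; rewrite mulrC ler_wpM2r.
rewrite (part n).
rewrite (_ : _ - _ = F x * - (Q x - \sum_(k < n) q k x) +
  \sum_(j < b) lam x ^+ j * - (A j (P x) - \sum_(k < n) Sk k j (P x)) + g n x); last first.
  have -> : \sum_(j < b) lam x ^+ j * - (A j (P x) - \sum_(k < n) Sk k j (P x)) =
      \sum_(j < b) lam x ^+ j * (\sum_(k < n) Sk k j (P x)) - \sum_(j < b) lam x ^+ j * A j (P x).
    by rewrite -sumrB; apply: eq_bigr => j _; rewrite opprB mulrBr.
  by ring.
apply: le_trans (le_normcD _ _) _; rewrite /K mulrDl; apply: lerD; last by case: (hg n x hx).
apply: le_trans (le_normcD _ _) _; rewrite mulrDl; apply: lerD.
  rewrite normcM normcN -!mulrA ler_wpM2l ?normc_ge0 //.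
  by have [_ /(_ n)] := hQ x hx; rewrite !mulrA.
rewrite /KA mulr_suml; elim/big_rec2: _ => [|j u w _ IH]; first by rewrite normc0.
apply: le_trans (le_normcD _ _) _; apply: lerD => //.
rewrite normcM normcN normcX -mulrA; apply: ler_pM; rewrite ?exprn_ge0 ?normc_ge0 //.
  by apply: lerXn2r; rewrite ?nnegrE ?normc_ge0 // ltW //; case: hx.
by have [_ /(_ n)] := hA j _ (dproj x hx).
Qed.

Lemma near_holo_dom F : (exists2 d : R, 0 < d & forall x, nm x < d -> cdf F x) ->
  exists2 r : R, 0 < r & exists M, holo_dom F r r M.
Proof.
move=> [d d0 hd].
have [|d' d'0 hd'] := cdf_cts (hd 0 _) ltr01; first by rewrite nm0.
have nv0 := nm_ge0 v.
pose m := Num.min d d'; have m0 : 0 < m by rewrite lt_min d0.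
have [md md'] : m <= d /\ m <= d' by rewrite !ge_min !lexx orbT.
(* By [dom_nm] a polydisc with both radii [r] lies in the ball of radius [r * (nm v + 2)]. *)
exists (m / (nm v + 2)); first by rewrite divr_gt0 //; lra.
exists (normc (F 0) + 1) => x /dom_nm.
set r := m / _; have -> : r + r * (nm v + 1) = m by rewrite /r; field; rewrite gt_eqF //; lra.
move=> hx; split; first by apply: hd; exact: lt_le_trans md.
have := hd' x (lt_le_trans hx md'); rewrite add0r => h.
by have := le_normcD (F x - F 0) (F 0); rewrite subrK; lra.
Qed.

End Weierstrass.

(** * Germs of holomorphic functions *)

Section Flatness.
Variable R : realType.
Local Notation C := R[i].

(** Vanishing to order [k] at 0, phrased as growth so that it makes sense before any Taylor
    expansion exists. *)
Definition ord_ge (f : C -> C) (k : nat) := exists K : R, exists2 d : R, 0 < d &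
  forall t, normc t < d -> normc (f t) <= K * normc t ^+ k.

Lemma ord_geS f k : ord_ge f k.+1 -> ord_ge f k.
Proof.
move=> [K [d d0 hd]]; exists `|K|, (Num.min d 1); first by rewrite lt_min d0 ltr01.
move=> t; rewrite lt_min => /andP[/hd h1 h2]; apply: le_trans h1 _.
apply: le_trans (ler_norm _) _; rewrite normrM ler_wpM2l // exprS normrM.
have e0 : 0 <= normc t ^+ k by rewrite exprn_ge0 ?normc_ge0.
rewrite (ger0_norm e0) (ger0_norm (normc_ge0 t)) ler_piMl //; exact: ltW.
Qed.

Lemma ord_ge_near f g k (r : R) : 0 < r -> (forall t, normc t < r -> f t = g t) ->
  ord_ge f k -> ord_ge g k.
Proof.
move=> r0 fg [K [d d0 hd]]; exists K, (Num.min d r); first by rewrite lt_min d0.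
by move=> t; rewrite lt_min => /andP[/hd h /fg <-].
Qed.

(** Dividing the bound by the [k]-th power at small positive reals [s] shows that [q s] is of size
    at most [K * s]; continuity gives the value at 0. *)
Lemma ord_ge_lead0 (q : C -> C) k : zcts q 0 ->
  ord_ge (fun t => t ^+ k * q t) k.+1 -> q 0 = 0.
Proof.
move=> cq [K [d d0 hd]]; apply: (@normc_small _ _ (`|K| + 1)); first by rewrite addr_ge0.
move=> e e0; have [d' d'0 hd'] := cq e e0.
pose m := Num.min d (Num.min d' e); pose s := m / 2.
have m0 : 0 < m by rewrite !lt_min d0 d'0 e0.
have [m1 m2 m3] : [/\ m <= d, m <= d' & m <= e] by split; rewrite !ge_min lexx ?orbT.
have s0 : 0 < s by rewrite /s; lra.
have sm : s < m by rewrite /s; lra.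
have ns : normc (s%:C) = s by rewrite normcR ger0_norm // ltW.
have := hd s%:C; rewrite normcM normcX ns => /(_ (lt_le_trans sm m1)).
rewrite exprS (_ : K * _ = s ^+ k * (s * K)); last by ring.
rewrite ler_pM2l ?exprn_gt0 // => h1.
have := hd' s%:C; rewrite ns add0r => /(_ (lt_le_trans sm m2)) h2.
have := normc_sub_ge (q 0) (q s%:C); rewrite normcBC => h3.
have h4 : s * K <= e * `|K|.
  apply: (@le_trans _ _ (s * `|K|)); first by rewrite ler_wpM2l ?ler_norm // ltW.
  by rewrite ler_wpM2r //; apply: le_trans m3; exact: ltW.
by rewrite mulrDr mulr1; lra.
Qed.

Lemma disc_order f (r M : R) k : 0 < r -> holo_disc f r M -> ord_ge f k ->
  exists2 q, holo_disc q r ((64 / r) ^+ k * M) &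
    forall t, normc t < r -> f t = t ^+ k * q t.
Proof.
move=> r0 hf; elim: k => [|k IH] hk.
  by exists f => [|t _]; rewrite ?expr0 mul1r.
have [q hq fq] := IH (ord_geS hk).
have [q1 hq1 qq1] := disc_factor r0 hq.
have q0 : q 0 = 0.
  apply: (@ord_ge_lead0 q k); last exact: ord_ge_near fq hk.
  by apply: cdf_zcts; case: (hq 0 _); rewrite ?normc0.
exists q1; first by rewrite exprS -mulrA.
by move=> t ht; rewrite fq // qq1 // q0 add0r exprSr mulrA.
Qed.

Variable V : normedModType C.
Implicit Types (F G : V -> C) (x y : V).

Lemma holo_line0 F x (r M rho : R) : 0 < r -> 0 < rho -> rho * nm x <= r ->
  holo_ball F 0 r M -> holo_disc (fun t => F (t *: x)) rho M.
Proof.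
move=> r0 rho0 hr hF.
have -> : (fun t : C => F (t *: x)) = (fun t => F (0 + t *: x)).
  by apply/funext => t; rewrite add0r.
exact: holo_line hr hF.
Qed.

(** The point [x] is the parameter 1 on a disc of radius 128, twice the constant 64. Dividing [k]
    times by the parameter costs [(64 / 128) ^+ k], so [F x] is at most [M / 2 ^+ k] for every
    [k]. *)
Lemma line_flat F x (r M : R) : 0 < r -> holo_ball F 0 r M -> nm x < r / 128 ->
  (forall k, ord_ge (fun t => F (t *: x)) k) -> F x = 0.
Proof.
move=> r0 hF hx hk.
have hr : 128 * nm x <= r by move: hx; rewrite ltr_pdivlMr // mulrC => /ltW.
have p128 : (0 : R) < 128 by [].
have hd := holo_line0 r0 p128 hr hF.
have n1 : normc (1 : C) < 128 by rewrite normc1; lra.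
have M0 : 0 <= M.
  by have [_ h] := hd 1 n1; apply: le_trans h; exact: normc_ge0.
apply: (@normc_small _ _ M M0) => e e0.
have [k hke] := exists_lt_exp2 e^-1.
have [q hq fq] := disc_order p128 hd (hk k).
have := fq 1 n1; rewrite scale1r expr1n mul1r => ->.
have [_ h] := hq 1 n1; apply: le_trans h _; rewrite ler_wpM2r //.
have k0 : 0 < 2 ^+ k :> R by rewrite exprn_gt0.
rewrite (_ : 64 / 128 = 2^-1); last by field.
by rewrite exprVn -(invrK e) lef_pV2 ?posrE ?invr_gt0 // ltW.
Qed.

Definition hol F := exists2 d : R, 0 < d & forall x, nm x < d -> cdf F x.

Lemma hol_ball F : hol F -> exists2 r : R, 0 < r & exists M, holo_ball F 0 r M.
Proof.
move=> [d d0 hd].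
have [|d' d'0 hd'] := cdf_cts (hd 0 _) ltr01; first by rewrite nm0.
exists (Num.min d d'); first by rewrite lt_min d0.
exists (normc (F 0) + 1) => x; rewrite subr0 lt_min => /andP[hx /hd' h].
split; first exact: hd.
by have := le_normcD (F x - F 0) (F 0); rewrite subrK; move: h; rewrite add0r; lra.
Qed.

Definition eqnear F G := exists2 d : R, 0 < d & forall x, nm x < d -> F x = G x.

Definition vord (f : V -> R) (k : nat) := exists2 K : R, 0 <= K & exists2 d : R, 0 < d &
  forall x, nm x < d -> f x <= K * nm x ^+ k.

Lemma vord_ord_ge F k x : vord (fun x => normc (F x)) k -> ord_ge (fun t => F (t *: x)) k.
Proof.
move=> [K K0 [d d0 hd]]; have n0 := nm_ge0 x.
exists (K * nm x ^+ k), (d / (nm x + 1)); first by rewrite divr_gt0 //; lra.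
move=> t; rewrite ltr_pdivlMr; last by lra.
move=> ht; apply: le_trans (hd _ _) _.
  by rewrite nmZ; have := normc_ge0 t; nra.
by rewrite nmZ exprMn [normc t ^+ k * _]mulrC mulrA.
Qed.

Lemma flat F : hol F -> (forall k, vord (fun x => normc (F x)) k) -> eqnear F (fun _ => 0).
Proof.
move=> /hol_ball[r r0 [M hF]] hk; exists (r / 128); first exact: divr_gt0.
by move=> x hx; apply: (line_flat r0 hF hx) => k; exact: vord_ord_ge.
Qed.

Lemma holD F G : hol F -> hol G -> hol (fun x => F x + G x).
Proof.
move=> [d d0 hd] [d' d'0 hd']; exists (Num.min d d'); first by rewrite lt_min d0.
by move=> x; rewrite lt_min => /andP[/hd h1 /hd' h2]; exact: cdfD.
Qed.

Lemma holM F G : hol F -> hol G -> hol (fun x => F x * G x).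
Proof.
move=> [d d0 hd] [d' d'0 hd']; exists (Num.min d d'); first by rewrite lt_min d0.
by move=> x; rewrite lt_min => /andP[/hd h1 /hd' h2]; exact: cdfM.
Qed.

Lemma hol_cst (c : C) : hol (fun _ => c).
Proof. by exists 1 => // x _; exact: cdf_cst. Qed.

Lemma hol_cts F : hol F -> forall e : R, 0 < e -> exists2 d : R, 0 < d &
  forall x, nm x < d -> normc (F x - F 0) < e.
Proof.
move=> [d d0 hd] e e0; have [|d' d'0 hd'] := cdf_cts (hd 0 _) e0; first by rewrite nm0.
by exists d' => // x /hd'; rewrite add0r.
Qed.

Lemma holV F : hol F -> F 0 != 0 -> hol (fun x => (F x)^-1).
Proof.
move=> hF F0; have [|d' d'0 hd'] := hol_cts hF (e := normc (F 0)); first by rewrite normc_gt0.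
have [d d0 hd] := hF; exists (Num.min d d'); first by rewrite lt_min d0.
move=> x; rewrite lt_min => /andP[/hd h1 /hd' h2]; apply: cdfV => //.
by apply/eqP => E; move: h2; rewrite E sub0r normcN ltxx.
Qed.

Lemma hol_lin (L : V -> C) (B : R) : clinear (L : V -> C^o) ->
  (forall h, normc (L h) <= B * nm h) -> hol L.
Proof. by move=> lL hB; exists 1 => // x _; exact: cdf_lin lL hB. Qed.

End Flatness.

Lemma hol_comp (R : realType) (V W : normedModType R[i]) (T : V -> W) (F : W -> R[i]) (B : R) :
  clinear T -> (forall h, nm (T h) <= B * nm h) -> hol F -> hol (fun x => F (T x)).
Proof.
move=> lT hB [d d0 hd].
have B0 : 0 < `|B| + 1 by rewrite ltr_wpDl.
exists (d / (`|B| + 1)); first exact: divr_gt0.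
move=> x; rewrite ltr_pdivlMr // => hx.
apply: (cdf_affine lT hB) => [h|]; first exact: clinearD.
apply: hd; apply: le_lt_trans (hB x) _; apply: le_lt_trans hx.
by rewrite mulrC ler_wpM2l ?nm_ge0 //; have := ler_norm B; lra.
Qed.

Lemma eqnear_comp (R : realType) (V W : normedModType R[i]) (T : V -> W) (F G : W -> R[i]) (B : R) :
  (forall h, nm (T h) <= B * nm h) -> eqnear F G -> eqnear (fun x => F (T x)) (fun x => G (T x)).
Proof.
move=> hB [d d0 hd].
have B0 : 0 < `|B| + 1 by rewrite ltr_wpDl.
exists (d / (`|B| + 1)); first exact: divr_gt0.
move=> x; rewrite ltr_pdivlMr // => hx; apply: hd.
apply: le_lt_trans (hB x) _; apply: le_lt_trans hx.
by rewrite mulrC ler_wpM2l ?nm_ge0 //; have := ler_norm B; lra.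
Qed.

Section Germs.
Variables (R : realType) (n : nat).
Local Notation C := R[i].
Local Notation Cn := 'rV[C]_n.
Local Notation germ := (germ C n).
Implicit Types (F G : Cn -> C) (g : germ).

Lemma hol_holo0 F : hol F <-> F \in @holo0 C n.
Proof.
split=> [[d d0 hd]|/asboolP/near0P[d d0 hd]]; last by exists d => // x /hd/cdfP.
by apply/asboolP/near0P; exists d => // x /hd/cdfP.
Qed.

(** Total in [F]: a function that is not holomorphic near 0 is sent to the germ 0, hence the [hol]
    hypotheses in the calculation rules. *)
Definition germF F : germ := germ_of (insubd 0 F).

Lemma insubd_hol F : hol F -> (insubd (0 : holoFun C n) F : Cn -> C) = F.
Proof. by move=> /hol_holo0 h; exact: insubdK. Qed.

Lemma holoFun_hol (f : holoFun C n) : hol f.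
Proof. by apply/hol_holo0; exact: (valP f). Qed.

Lemma germF_holo (f : holoFun C n) : germF f = germ_of f.
Proof. by congr germ_of; apply: val_inj; rewrite /= insubd_hol //; exact: holoFun_hol. Qed.

Lemma germF_surj g : exists2 F, hol F & g = germF F.
Proof.
have [f ->] := germ_ofP g; exists f; first exact: holoFun_hol.
by rewrite germF_holo.
Qed.

Lemma germF_eq F G : hol F -> hol G -> germF F = germF G <-> eqnear F G.
Proof.
move=> hF hG; rewrite /germF; split.
  by move=> /germ_of_eq/near0P[d d0 hd]; exists d => // x /hd; rewrite !insubd_hol.
by move=> [d d0 hd]; apply/germ_of_eq/near0P; exists d => // x /hd; rewrite !insubd_hol.
Qed.

Lemma germFD F G : hol F -> hol G -> germF (fun x => F x + G x) = germF F + germF G.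
Proof.
move=> hF hG; rewrite /germF -rmorphD; congr germ_of; apply: val_inj.
by rewrite /= insubd_hol; [rewrite /= !insubd_hol|exact: holD].
Qed.

Lemma germFM F G : hol F -> hol G -> germF (fun x => F x * G x) = germF F * germF G.
Proof.
move=> hF hG; rewrite /germF -rmorphM; congr germ_of; apply: val_inj.
by rewrite /= insubd_hol; [rewrite /= !insubd_hol|exact: holM].
Qed.

Lemma germF0 : germF (fun _ => 0) = 0.
Proof.
rewrite -(rmorph0 (@germ_of C n)); congr germ_of; apply: val_inj.
by rewrite /= insubd_hol //; exact: hol_cst.
Qed.

Lemma germF1 : germF (fun _ => 1) = 1.
Proof.
rewrite -(rmorph1 (@germ_of C n)); congr germ_of; apply: val_inj.
by rewrite /= insubd_hol //; exact: hol_cst.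
Qed.

Lemma holX F k : hol F -> hol (fun x => F x ^+ k).
Proof. by move=> [d d0 hd]; exists d => // x /hd; exact: cdfX. Qed.

Lemma germFX F k : hol F -> germF (fun x => F x ^+ k) = germF F ^+ k.
Proof.
move=> hF; elim: k => [|k IH]; first exact: germF1.
rewrite exprS -IH -germFM //; last exact: holX.
by congr germF; apply/funext => x; rewrite exprS.
Qed.

Lemma hol_sum (I : Type) (s : seq I) (f : I -> Cn -> C) (p : pred I) :
  (forall i, hol (f i)) -> hol (fun x => \sum_(i <- s | p i) f i x).
Proof.
move=> hf; have -> : (fun x => \sum_(i <- s | p i) f i x) = \sum_(i <- s | p i) f i.
  by apply/funext => x; rewrite fct_sumE.
by elim/big_ind: _ => [|F G hF hG|i _] //; [exact: hol_cst|exact: holD].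
Qed.

Lemma germF_sum (I : Type) (s : seq I) (f : I -> Cn -> C) (p : pred I) :
  (forall i, hol (f i)) ->
  germF (fun x => \sum_(i <- s | p i) f i x) = \sum_(i <- s | p i) germF (f i).
Proof.
move=> hf; have -> : (fun x => \sum_(i <- s | p i) f i x) = \sum_(i <- s | p i) f i.
  by apply/funext => x; rewrite fct_sumE.
suff [] : hol (\sum_(i <- s | p i) f i) /\
  germF (\sum_(i <- s | p i) f i) = \sum_(i <- s | p i) germF (f i) by [].
elim/big_ind2: _ => [|F a G b [hF <-] [hG <-]|i _] //.
  by split; [exact: hol_cst|exact: germF0].
by split; [exact: holD|exact: germFD].
Qed.

Lemma germF_unit F : hol F -> F 0 != 0 -> exists g, g * germF F = 1.
Proof.
move=> hF F0; exists (germF (fun x => (F x)^-1)).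
have hV := holV hF F0; rewrite -germFM // -germF1; apply/germF_eq.
- exact: holM.
- exact: hol_cst.
have [|d d0 hd] := hol_cts hF (e := normc (F 0)); first by rewrite normc_gt0.
exists d => // x /hd h; rewrite mulVf //.
by apply/eqP => E; move: h; rewrite E sub0r normcN ltxx.
Qed.

End Germs.

(** * Noetherian rings and syzygies *)

Section Noetherian.
Variable O : comNzRingType.

Definition ideal_pred (J : O -> Prop) :=
  [/\ J 0, forall a b, J a -> J b -> J (a + b) & forall a b, J b -> J (a * b)].

Definition fin_gen (J : O -> Prop) := exists k (g : 'I_k -> O),
  (forall i, J (g i)) /\ forall x, J x -> exists c : 'I_k -> O, x = \sum_i c i * g i.

Definition noetherian := forall J, ideal_pred J -> fin_gen J.

Lemma fin_gen0 (J : O -> Prop) : (forall x, J x -> x = 0) -> fin_gen J.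
Proof.
move=> hz; exists 0%N, (fun _ => 0); split=> [[]|x /hz ->] //.
by exists (fun _ => 0); rewrite big_ord0.
Qed.

Lemma fin_gen1 (J : O -> Prop) : J 1 -> fin_gen J.
Proof.
move=> h1; exists 1%N, (fun _ => 1); split=> // x _; exists (fun _ => x).
by rewrite big_ord1 mulr1.
Qed.

Definition submod m (K : 'rV[O]_m -> Prop) :=
  [/\ K 0, forall x y, K x -> K y -> K (x + y) & forall a x, K x -> K (a *: x)].

Definition rowgen m (K : 'rV[O]_m -> Prop) k (E : 'M[O]_(k, m)) :=
  forall x, K x <-> exists c : 'rV[O]_k, x = c *m E.

Lemma submod_sum m (K : 'rV[O]_m -> Prop) (I : Type) (s : seq I) (p : pred I) (f : I -> 'rV[O]_m) :
  submod K -> (forall i, p i -> K (f i)) -> K (\sum_(i <- s | p i) f i).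
Proof. by move=> [K0 KD KZ] hf; elim/big_ind: _ => //. Qed.

Lemma submod_mul m (K : 'rV[O]_m -> Prop) k (c : 'rV[O]_k) (E : 'M[O]_(k, m)) :
  submod K -> (forall i, K (row i E)) -> K (c *m E).
Proof.
move=> sK hE; rewrite mulmx_sum_row; apply: submod_sum => // i _.
by have [_ _ KZ] := sK; exact: KZ.
Qed.

Lemma rowgen_row m (K : 'rV[O]_m -> Prop) k (E : 'M[O]_(k, m)) i : rowgen K E -> K (row i E).
Proof. by move=> hE; apply/hE; exists (delta_mx 0 i); rewrite -rowE. Qed.

(** Induction on the rank: first entries of elements of [K] form an ideal, and elements with first
    entry 0 a submodule of smaller rank. Lifts of generators of the former ([E1]) and generators of
    the latter ([E2]) suffice. *)
Lemma noetherian_submod : noetherian ->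
  forall m (K : 'rV[O]_m -> Prop), submod K -> exists k (E : 'M[O]_(k, m)), rowgen K E.
Proof.
move=> hO; elim=> [|m IH] K sK; have [K0 KD KZ] := sK.
  exists 0%N, 0 => x; rewrite [x]thinmx0; split => // _.
  by exists 0; rewrite mul0mx.
pose mk (a : O) (y : 'rV[O]_m) : 'rV[O]_m.+1 := row_mx (a%:M : 'M[O]_1) y.
have mkD a b y w : mk (a + b) (y + w) = mk a y + mk b w.
  by rewrite /mk (raddfD (@scalar_mx _ 1)) -(add_row_mx (n1 := 1)).
have mkZ a b y : mk (a * b) (a *: y) = a *: mk b y.
  by rewrite /mk (scale_row_mx (n1 := 1)) scale_scalar_mx.
have mk0 : mk 0 0 = 0 by apply/rowP => i; rewrite !mxE; case: splitP => j _; rewrite !mxE ?mul0rn.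
have mkE x : exists a y, x = mk a y.
  exists ((lsubmx (x : 'rV_(1 + m))) 0 0), (rsubmx (x : 'rV_(1 + m))).
  by rewrite /mk -mx11_scalar hsubmxK.
pose J a := exists y, K (mk a y).
have [|k [g [Jg gJ]]] := hO J.
  split; first by exists 0; rewrite mk0.
    by move=> a b [y hy] [w hw]; exists (y + w); rewrite mkD; exact: KD.
  by move=> a b [y hy]; exists (a *: y); rewrite mkZ; exact: KZ.
have [y hy] := choice Jg.
pose K' w := K (mk 0 w).
have [|k' [E' hE']] := IH K'.
  split; first by rewrite /K' mk0.
    by move=> u w hu hw; rewrite /K' -[0]addr0 mkD; exact: KD.
  by move=> a w hw; rewrite /K' -(mulr0 a) mkZ; exact: KZ.
pose E1 : 'M[O]_(k, m.+1) := \matrix_(i < k) mk (g i) (y i).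
pose E2 : 'M[O]_(k', m.+1) := \matrix_(i < k') mk 0 (row i E').
have E2E c : c *m E2 = mk 0 (c *m E').
  have mksum (I : Type) (s : seq I) (f : I -> 'rV[O]_m) :
      mk 0 (\sum_(i <- s) f i) = \sum_(i <- s) mk 0 (f i).
    elim: s => [|i s IHs]; first by rewrite !big_nil mk0.
    by rewrite !big_cons -IHs -mkD addr0.
  rewrite !mulmx_sum_row mksum; apply: eq_bigr => i _.
  by rewrite rowK -mkZ mulr0.
have E1K c : K (c *m E1) by apply: submod_mul => // i; rewrite rowK.
have E2K c : K (c *m E2) by apply: submod_mul => // i; rewrite rowK; exact: (rowgen_row i hE').
exists (k + k')%N, (col_mx E1 E2) => x; split; last first.
  by move=> [c ->]; rewrite -[c]hsubmxK mul_row_col; exact: KD.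
have [a [w ->]] := mkE x => Kx.
have [c hc] := gJ a (ex_intro _ w Kx).
pose cv : 'rV[O]_k := \row_i c i.
have E1E : cv *m E1 = mk a (\sum_i c i *: y i).
  rewrite mulmx_sum_row hc.
  elim/big_rec3: _ => [|i u v t _ ->]; first by rewrite mk0.
  by rewrite rowK mxE -mkZ -mkD.
have : K' (w - \sum_i c i *: y i).
  rewrite /K' -(subrr a) -[- a]mulN1r -[- (\sum_i _)]scaleN1r mkD mkZ -E1E.
  by apply: KD => //; apply: KZ.
move=> /hE'[d hd]; exists (row_mx cv d).
by rewrite mul_row_col E1E E2E -hd -mkD addr0 subrKC.
Qed.

End Noetherian.

(** The algebraic half of Rueckert's basis theorem. Modulo [f] every element is a combination of [b]
    powers of [tau] with coefficients from [O]. The coefficient vectors whose combination lies in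
    [J] form a submodule of a free module over the Noetherian ring [O]; its generators and [f]
    generate [J]. *)
Lemma fin_gen_transfer (O O' : comNzRingType) (phi : O -> O') (J : O' -> Prop) f tau b :
  (forall x y, phi (x + y) = phi x + phi y) -> (forall x y, phi (x * y) = phi x * phi y) ->
  noetherian O -> ideal_pred J -> J f ->
  (forall g, exists q (a : 'rV[O]_b), g = q * f + \sum_j phi (a 0 j) * tau ^+ j) ->
  fin_gen J.
Proof.
move=> phiD phiM hO [J0 JD JM] Jf hdiv.
have phi0 : phi 0 = 0 by apply: (addrI (phi 0)); rewrite -phiD !addr0.
pose ev (a : 'rV[O]_b) := \sum_j phi (a 0 j) * tau ^+ j.
have evD a a' : ev (a + a') = ev a + ev a'.
  by rewrite -big_split; apply: eq_bigr => j _; rewrite mxE phiD mulrDl.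
have evZ c a : ev (c *: a) = phi c * ev a.
  by rewrite mulr_sumr; apply: eq_bigr => j _; rewrite mxE phiM mulrA.
have ev0 : ev 0 = 0 by rewrite /ev big1 // => j _; rewrite mxE phi0 mul0r.
have [|k [E hE]] := noetherian_submod hO (K := fun a => J (ev a)).
  split; first by rewrite ev0.
    by move=> x y hx hy; rewrite evD; exact: JD.
  by move=> a x hx; rewrite evZ; exact: JM.
pose g (i : 'I_k.+1) := if unlift ord0 i is Some i' then ev (row i' E) else f.
exists k.+1, g; split=> [i|x Jx].
  by rewrite /g; case: unliftP => [i' _|_] //; exact: (rowgen_row i' hE).
have [q [a xE]] := hdiv x.
have : J (ev a).
  have -> : ev a = x + - q * f by rewrite xE /ev mulNr addrC addKr.
  by apply: JD => //; exact: JM.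
move=> /hE[c hc].
exists (fun i => if unlift ord0 i is Some i' then phi (c 0 i') else q).
rewrite big_ord_recl /g unlift_none xE -/(ev a) hc; congr (_ + _).
rewrite mulmx_sum_row.
elim/big_rec2: _ => [|i u v _ <-]; first by rewrite ev0.
by rewrite liftK evD evZ.
Qed.

Definition in_idl (O : comNzRingType) (n : nat) (z : 'I_n -> O) (l : nat) (g : O) :=
  exists y : 'I_n -> O, g = \sum_(i < n | (i < l)%N) z i * y i.

Section Syzygies.
Variables (O : comNzRingType) (n : nat) (z : 'I_n -> O).
Local Notation in_idl := (in_idl z).

(** Membership in the product of the ideal of the first [l] elements [z i] with [K]. *)
Definition in_mod m (l : nat) (K : 'rV[O]_m -> Prop) (x : 'rV[O]_m) :=
  exists y : 'I_n -> 'rV[O]_m, (forall i, K (y i)) /\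
    x = \sum_(i < n | (i < l)%N) z i *: y i.

(** The first [l] elements form a weakly regular sequence on [K]: each is a nonzerodivisor modulo
    its predecessors, and the quotients may vanish. *)
Definition regular_upto m (l : nat) (K : 'rV[O]_m -> Prop) :=
  forall i : 'I_n, (i < l)%N -> forall x, K x -> in_mod i K (z i *: x) -> in_mod i K x.

Lemma sum_ltS (M : zmodType) (i : 'I_n) (f : 'I_n -> M) :
  \sum_(j < n | (j < i.+1)%N) f j = f i + \sum_(j < n | (j < i)%N) f j.
Proof.
rewrite (bigD1 i) //=; congr (_ + _); apply: eq_bigl => j.
by rewrite ltnS [(j <= i)%N]leq_eqVlt -(inj_eq val_inj) /=; case: ltngtP.
Qed.

Lemma in_idlD l a b : in_idl l a -> in_idl l b -> in_idl l (a + b).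
Proof.
move=> [y ->] [w ->]; exists (fun i => y i + w i).
by rewrite -big_split; apply: eq_bigr => i _; rewrite mulrDr.
Qed.

Lemma in_idlM l a b : in_idl l b -> in_idl l (a * b).
Proof.
move=> [y ->]; exists (fun i => a * y i).
by rewrite mulr_sumr; apply: eq_bigr => i _; rewrite mulrCA.
Qed.

Lemma in_modD m l (K : 'rV[O]_m -> Prop) a b : submod K ->
  in_mod l K a -> in_mod l K b -> in_mod l K (a + b).
Proof.
move=> [_ KD _] [y [hy ->]] [w [hw ->]]; exists (fun i => y i + w i); split.
  by move=> i; exact: KD.
by rewrite -big_split; apply: eq_bigr => i _; rewrite scalerDr.
Qed.

Lemma in_modS m (i : 'I_n) (K : 'rV[O]_m -> Prop) x : submod K ->
  in_mod i K x -> in_mod i.+1 K x.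
Proof.
move=> [K0 _ _] [y [hy ->]]; exists (fun j : 'I_n => if (j < i)%N then y j else 0); split.
  by move=> j; case: ifP.
by rewrite sum_ltS ltnn scaler0 add0r; apply: eq_bigr => j ->.
Qed.

Hypothesis z_regular : forall (i : 'I_n) g, in_idl i (z i * g) -> in_idl i g.
(** This takes the place of Krull's intersection theorem: modulo the earlier elements, [O] is
    separated for the topology given by the powers of [z i]. *)
Hypothesis z_separated : forall (i : 'I_n) g,
  (forall k : nat, exists h, in_idl i (g - z i ^+ k * h)) -> in_idl i g.
Hypothesis z_local : forall g, in_idl n g \/ exists h, h * g = 1.

Lemma in_mod_coord m l (x : 'rV[O]_m) :
  in_mod l (fun _ => True) x <-> forall j, in_idl l (x 0 j).
Proof.
split=> [[y [_ ->]] j|hx].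
  exists (fun i => y i 0 j); rewrite summxE; apply: eq_bigr => i _; by rewrite mxE.
have [y hy] := choice hx.
exists (fun i => \row_j y j i); split => //; apply/rowP => j.
by rewrite summxE hy; apply: eq_bigr => i _; rewrite !mxE.
Qed.

Lemma regular_full m l : regular_upto l (fun _ : 'rV[O]_m => True).
Proof.
move=> i _ x _ /in_mod_coord h; apply/in_mod_coord => j; apply: z_regular.
by have := h j; rewrite mxE.
Qed.

Lemma rowgen_submod m (K : 'rV[O]_m -> Prop) k (E : 'M[O]_(k, m)) : rowgen K E -> submod K.
Proof.
move=> hE; split.
- by apply/hE; exists 0; rewrite mul0mx.
- by move=> x y /hE[c ->] /hE[d ->]; apply/hE; exists (c + d); rewrite mulmxDl.
- by move=> a x /hE[c ->]; apply/hE; exists (a *: c); rewrite scalemxAl.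
Qed.

Definition mxker k m (E : 'M[O]_(k, m)) (c : 'rV[O]_k) := c *m E = 0.

Lemma mxker_submod k m (E : 'M[O]_(k, m)) : submod (mxker E).
Proof.
split; rewrite /mxker.
- exact: mul0mx.
- by move=> x y hx hy; rewrite mulmxDl hx hy addr0.
- by move=> a x hx; rewrite -scalemxAl hx scaler0.
Qed.

(* Koszul relations on [K] lift to the kernel of a presentation of [K]. *)
Lemma mxker_in_mod m (K : 'rV[O]_m -> Prop) k (E : 'M[O]_(k, m)) l :
  rowgen K E -> regular_upto l K -> forall i, (i <= l)%N -> (i <= n)%N ->
  forall x, mxker E x -> in_mod i (fun _ => True) x -> in_mod i (mxker E) x.
Proof.
move=> hE hK; have sK := rowgen_submod hE; have sk := mxker_submod E.
elim=> [|i IH] il iN x xE [y [_ xy]].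
  exists (fun _ => 0); split; first by move=> _; case: sk.
  by rewrite xy !big_pred0.
pose i0 := Ordinal iN.
rewrite (@sum_ltS _ i0) in xy.
have : in_mod i0 K (y i0 *m E).
  apply: hK => //; first by apply/hE; exists (y i0).
  exists (fun a => - y a *m E); split; first by move=> a; apply/hE; exists (- y a).
  have := xE; rewrite /mxker xy mulmxDl mulmx_suml => /eqP; rewrite addr_eq0.
  rewrite -scalemxAl => /eqP ->; rewrite -sumrN; apply: eq_bigr => a _.
  by rewrite -scalemxAl mulNmx scalerN.
move=> [w [hw wE]].
have /choice[W hW] : forall a, exists W : 'rV[O]_k, w a = W *m E.
  by move=> a; apply/hE.
(* Subtracting a lift of the relation found in [K] turns the last coefficient [y i0] into a syzygy,
   and what remains of [x] involves only earlier elements, as the induction requires. *)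
pose y' := y i0 - \sum_(a < n | (a < i)%N) z a *: W a.
have y'K : mxker E y'.
  rewrite /mxker mulmxBl wE mulmx_suml -sumrB big1 // => a _.
  by rewrite -scalemxAl hW subrr.
have x'K : mxker E (x - z i0 *: y').
  by rewrite /mxker mulmxBl xE -scalemxAl y'K scaler0 subrr.
have : in_mod i (mxker E) (x - z i0 *: y').
  apply: IH => //; [exact: ltnW|exact: ltnW|].
  exists (fun a => y a + z i0 *: W a); split => //.
  rewrite xy /y' scalerBr opprB [LHS]addrC addrA subrK scaler_sumr.
  rewrite -big_split; apply: eq_bigr => a _.
  by rewrite /= addrC scalerDr !scalerA mulrC.
move=> [u [hu uE]]; exists (fun a => if a == i0 then y' else u a); split.
  by move=> a; case: eqP.
rewrite (@sum_ltS _ i0) eqxx -[LHS](subrKC (z i0 *: y')) uE; congr (_ + _).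
apply: eq_bigr => a ai; rewrite (_ : (a == i0) = false) //.
by apply/negbTE; rewrite -(inj_eq val_inj) /= ltn_eqF.
Qed.

(** The whole sequence is regular on the ambient free module, so [x] has coefficients there;
    [mxker_in_mod] replaces them by syzygies as long as [i <= l]. This is the gain of one in depth
    at each syzygy. *)
Lemma regular_mxker m (K : 'rV[O]_m -> Prop) k (E : 'M[O]_(k, m)) l :
  rowgen K E -> regular_upto l K -> regular_upto l.+1 (mxker E).
Proof.
move=> hE hK i il x xE [y [hy xy]].
apply: (mxker_in_mod hE hK) => //; first exact: ltnW.
by apply: (regular_full (l := l.+1)) => //; exists y.
Qed.

Lemma rowgen_reduce m (K : 'rV[O]_m -> Prop) k (E : 'M[O]_(k.+1, m)) (c : 'rV[O]_k.+1) j h :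
  rowgen K E -> c *m E = 0 -> h * c 0 j = 1 -> rowgen K (row' j E).
Proof.
move=> hE cE hc x.
have key (d : 'rV[O]_k.+1) : d 0 j = 0 -> d *m E = col' j d *m row' j E.
  move=> d0; rewrite !mulmx_sum_row (bigD1_ord j) //= d0 scale0r add0r.
  apply: eq_bigr => i _; rewrite mxE; congr (_ *: _).
  by apply/rowP => u; rewrite !mxE.
split=> [/hE[d ->]|[d ->]].
  pose d' := d - (d 0 j * h) *: c.
  have -> : d *m E = d' *m E by rewrite mulmxBl -scalemxAl cE scaler0 subr0.
  exists (col' j d'); apply: key.
  by rewrite !mxE -mulrA hc mulr1 subrr.
apply/hE; exists (\row_i if unlift j i is Some i' then d 0 i' else 0).
rewrite key; last by rewrite mxE unlift_none.
by congr (_ *m _); apply/rowP => i; rewrite !mxE liftK.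
Qed.

(** A minimal generating family is shown to be free. Its relations have coefficients in the maximal
    ideal, generated by all [n] elements; regularity and separatedness then remove these elements
    one after the other, until the coefficients lie in the zero ideal. *)
Theorem regular_free m (K : 'rV[O]_m -> Prop) k0 (E0 : 'M[O]_(k0, m)) :
  rowgen K E0 -> regular_upto n K ->
  exists k (E : 'M[O]_(k, m)), rowgen K E /\ forall c : 'rV[O]_k, c *m E = 0 -> c = 0.
Proof.
move=> hE0 hK.
have ex : exists k, `[< exists E : 'M[O]_(k, m), rowgen K E >].
  by exists k0; apply/asboolP; exists E0.
(* Minimality is used through [rowgen_reduce]: a relation with an invertible coefficient would allow
   dropping a generator. *)
case: (ex_minnP ex) => k /asboolP[E hE] kmin.
exists k, E; split => //.
have sK := rowgen_submod hE.
have rel (c : 'rV[O]_k) : c *m E = 0 -> forall j, in_idl n (c 0 j).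
  move=> cE j; case: (z_local (c 0 j)) => // -[h hc]; exfalso.
  have k_gt0 : (0 < k)%N by apply: leq_ltn_trans (ltn_ord j).
  have := kmin k.-1; case: k k_gt0 E hE c cE j hc {kmin} => [//|k] _ E hE c cE j hc /= kmin.
  by have := kmin (asboolT (ex_intro _ _ (rowgen_reduce hE cE hc))); rewrite ltnn.
(* The induction descends from [l = n] to [l = 0], where the claim says that relations are trivial.
   For [l = n], subtracting a combination with coefficients in the ideal reduces to a genuine
   relation. *)
have P l : (l <= n)%N -> forall c : 'rV[O]_k, in_mod l K (c *m E) -> forall j, in_idl l (c 0 j).
  move=> ln; rewrite -(subKn ln); move: (n - l)%N (leq_subr l n) => i.
  elim: i => [|i IH] iN c; last first.
    have iN' := ltnW iN; have {}IH := IH iN'.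
    have e : (n - i = (n - i.+1).+1)%N by rewrite subnSK.
    have li : (n - i.+1 < n)%N by rewrite ltn_subrL (leq_ltn_trans _ iN).
    pose a := Ordinal li; rewrite e in IH.
    move=> hc j; apply: (z_separated (i := a)) => k1.
    (* Writing [c = z a *: c' + d] with [d] in the ideal of the elements before [z a], regularity
       shows that [c'] satisfies the same hypothesis as [c]. So the division by [z a] can be
       repeated, and [z_separated] applies. *)
    elim: k1 c hc j => [|k1 IHk] c hc j.
      exists (c 0 j); exists (fun _ => 0); rewrite expr0 mul1r subrr big1 // => b _.
      by rewrite mulr0.
    have hc1 : in_mod a.+1 K (c *m E) by apply: in_modS.
    have hy : forall j, exists y : 'I_n -> O, c 0 j = \sum_(b < n | (b < a.+1)%N) z b * y b.
      by move=> j'; exact: IH.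
    have {hy} [y hy] := choice hy.
    pose c' : 'rV[O]_k := \row_j y j a.
    pose d : 'rV[O]_k := \row_j \sum_(b < n | (b < a)%N) z b * y j b.
    have cE : c = z a *: c' + d.
      by apply/rowP => j'; rewrite hy sum_ltS !mxE.
    have hd : in_mod a K (- (d *m E)).
      exists (fun b => - (\row_j y j b) *m E); split.
        by move=> b; apply/hE; exists (- \row_j y j b).
      have -> : d = \sum_(b < n | (b < a)%N) z b *: \row_j y j b.
        apply/rowP => j'; rewrite mxE summxE; apply: eq_bigr => b _; by rewrite !mxE.
      rewrite mulmx_suml -sumrN; apply: eq_bigr => b _.
      by rewrite -scalemxAl mulNmx scalerN.
    have hc' : in_mod a K (c' *m E).
      apply: hK => //; first by apply/hE; exists c'.
      have -> : z a *: (c' *m E) = c *m E + - (d *m E).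
        by rewrite cE mulmxDl addrK scalemxAl.
      exact: in_modD.
    have [h hh] := IHk c' hc' j; exists h.
    have -> : c 0 j - z a ^+ k1.+1 * h = z a * (c' 0 j - z a ^+ k1 * h) + d 0 j.
      by rewrite cE !mxE exprS; ring.
    apply: in_idlD; first exact: in_idlM.
    by rewrite mxE; exists (y j).
  rewrite subn0 => -[y [hy cy]] j.
  have /choice[d hd] : forall b, exists d : 'rV[O]_k, y b = d *m E.
    by move=> b; apply/hE.
  pose c' := c - \sum_(b < n | (b < n)%N) z b *: d b.
  have c'E : c' *m E = 0.
    rewrite mulmxBl cy mulmx_suml -sumrB big1 // => b _.
    by rewrite -scalemxAl hd subrr.
  have -> : c 0 j = c' 0 j + \sum_(b < n | (b < n)%N) z b * d b 0 j.
    rewrite !mxE summxE -[LHS]addr0 -addrA; congr (_ + _).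
    rewrite -sumrN -big_split big1 //= => b _; by rewrite mxE addNr.
  by apply: in_idlD; [exact: rel|exists (fun b => d b 0 j)].
move=> c cE; apply/rowP => j; rewrite mxE.
have [|y ->] := P 0%N (leq0n n) c _ j; last by rewrite big_pred0.
exists (fun _ => 0); split; first by move=> _; case: sK.
by rewrite cE big_pred0.
Qed.

End Syzygies.

(** * The coordinate germs: regularity, separatedness and the maximal ideal *)

Section Coordinates.
Variables (R : realType) (n : nat).
Local Notation C := R[i].
Local Notation Cn := 'rV[C]_n.
Implicit Types (F G : Cn -> C) (x y : Cn).

Lemma nm_coord x i : normc (x ord0 i) <= nm x.
Proof.
rewrite -lecR -nmE -[(normc _)%:C]/(nm (x ord0 i : C^o))%:C.
have -> : (normc (x ord0 i))%:C = `|x ord0 i| by rewrite normc_def; case: (x _ _).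
change (`|x ord0 i| <= mx_norm x); rewrite mx_normE -[leLHS]nngE num_le.
exact: (le_bigmax _ (fun ij => `|x ij.1 ij.2|%:nng) (ord0, i)).
Qed.

Lemma nm_row_le x (B : R) : 0 <= B -> (forall i, normc (x ord0 i) <= B) -> nm x <= B.
Proof.
move=> B0 hB; have [x0|x0] := eqVneq (nm x) 0; first by rewrite x0.
have : mx_norm x != 0.
  by apply: contra x0 => /eqP h; rewrite nm_eq0 -normr_eq0; apply/eqP.
move=> /mx_norm_neq0[[i j] /= h].
rewrite -lecR -nmE -[leLHS]/(mx_norm x) h (ord1 i).
have -> : `|x ord0 j| = (normc (x ord0 j))%:C by rewrite normc_def; case: (x _ _).
by rewrite lecR.
Qed.

Definition coord (i : 'I_n) x : C := x ord0 i.

Lemma coord_lin i : clinear (coord i : Cn -> C^o).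
Proof. by move=> a x y; rewrite /coord !mxE. Qed.

Lemma coord_bnd i x : normc (coord i x) <= 1 * nm x.
Proof. by rewrite mul1r nm_coord. Qed.

Definition ev (i : 'I_n) : Cn := delta_mx ord0 i.

Lemma coord_ev i j : coord i (ev j) = (i == j)%:R.
Proof. by rewrite /coord mxE eqxx. Qed.

Lemma coord_line i (t : C) : coord i (t *: ev i) = t.
Proof. by rewrite (clinearZ _ _ (coord_lin i)) coord_ev eqxx [LHS]mulr1. Qed.

Lemma coord_cfder i x : cfder (coord i) x (coord i).
Proof. exact: cfder_lin (coord_lin i) (coord_bnd i). Qed.

Definition zproj (l : nat) x : Cn := \row_i (if (i < l)%N then 0 else x ord0 i).

Lemma zproj_lin l : clinear (zproj l).
Proof.
by move=> a x y; apply/rowP => i; rewrite !mxE; case: ifP => _; rewrite ?mulr0 ?addr0.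
Qed.

Lemma zproj_bnd l x : nm (zproj l x) <= 1 * nm x.
Proof.
rewrite mul1r; apply: nm_row_le => [|i]; first exact: nm_ge0.
by rewrite mxE; case: ifP => _; rewrite ?normc0 ?nm_ge0 ?nm_coord.
Qed.

Lemma zproj_coord l i x : coord i (zproj l x) = if (i < l)%N then 0 else coord i x.
Proof. by rewrite /coord mxE. Qed.

Lemma zproj0 x : zproj 0 x = x.
Proof. by apply/rowP => i; rewrite mxE. Qed.

Lemma zprojS (i : 'I_n) x : zproj i.+1 x = zproj i (dirproj (coord i) (ev i) x).
Proof.
apply/rowP => j; rewrite !mxE /coord ltnS leq_eqVlt eqxx /=.
case: ltnP => //= ij; first by rewrite orbT.
rewrite orbF; case: (eqVneq j i) => [->|ne]; first by rewrite eqxx mulr1 subrr.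
rewrite (_ : (j == i :> nat) = false) ?mulr0 ?subr0 //.
by apply/negbTE.
Qed.

Lemma zproj_n x : zproj n x = 0.
Proof. by apply/rowP => i; rewrite !mxE ltn_ord. Qed.

End Coordinates.

Lemma dir_factor_near (R : realType) (V : normedModType R[i]) (lam : V -> R[i]) (v : V) (Bl : R)
  (F : V -> R[i]) : clinear (lam : V -> R[i]^o) -> (forall x, normc (lam x) <= Bl * nm x) ->
  lam v = 1 -> hol F -> exists2 H, hol H & eqnear F (fun x => F (dirproj lam v x) + lam x * H x).
Proof.
move=> l1 l2 l3 hF; have [r r0 [M hM]] := near_holo_dom lam v hF.
have [H hH HE] := dir_factor l1 l2 l3 r0 hM.
have [d d0 hd] := dom_open l1 l2 (dom0 v l1 r0 r0).
exists H; exists d => // x hx; first by case: (hH x (hd x _)); rewrite ?subr0.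
by apply: HE; apply: hd; rewrite subr0.
Qed.

Section GermIdeals.
Variables (R : realType) (n : nat).
Local Notation C := R[i].
Local Notation Cn := 'rV[C]_n.
Local Notation germ := (germ C n).
Implicit Types (F G : Cn -> C) (g : germ).

Lemma hol_coord (i : 'I_n) : hol (coord i : Cn -> C).
Proof. exact: hol_lin (@coord_lin R n i) (coord_bnd i). Qed.

Definition zgerm (i : 'I_n) : germ := germF (@coord R n i).

Lemma hol_zproj l F : hol F -> hol (fun x => F (zproj l x)).
Proof. exact: hol_comp (zproj_lin l) (zproj_bnd l). Qed.

(** Coordinates are set to 0 one at a time, each time by [dir_factor] along the corresponding
    axis. *)
Lemma germ_split F l : hol F -> (l <= n)%N -> exists y : 'I_n -> germ,
  germF F = germF (fun x => F (zproj l x)) + \sum_(i < n | (i < l)%N) zgerm i * y i.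
Proof.
move=> hF; elim: l => [|l IH] ln.
  exists (fun _ => 0); rewrite big1 => [|i]; last by rewrite ltn0.
  by rewrite addr0; congr germF; apply/funext => x; rewrite zproj0.
have [y yE] := IH (ltnW ln); pose i0 := Ordinal ln.
have e1 : coord i0 (ev R i0) = 1 by rewrite coord_ev eqxx.
have hQ := hol_zproj l hF.
have [H hH HE] := dir_factor_near (@coord_lin R n i0) (coord_bnd i0) e1 hQ.
exists (fun i => if i == i0 then germF H else y i).
rewrite (bigD1 i0) /=; last by rewrite ltnSn.
rewrite eqxx -germFM //; last exact: hol_coord.
rewrite addrA -germFD; [|exact: hol_zproj|by apply: holM => //; exact: hol_coord].
rewrite yE; congr (_ + _).
  apply/germF_eq => //.
    by apply: holD; [exact: hol_zproj|apply: holM => //; exact: hol_coord].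
  move: HE => [d d0 hd]; exists d => // x /hd ->.
  by rewrite -[l]/(i0 : nat) -zprojS.
apply: eq_big => i; first by rewrite ltnS [(i <= l)%N]leq_eqVlt (_ : (i == i0) = (i == l :> nat)) //; case: ltngtP.
by move=> il; rewrite (_ : (i == i0) = (i == l :> nat)) // ltn_eqF.
Qed.

(** The ideal of the first [l] coordinates is the vanishing ideal of the subspace they cut out. This
    turns the three algebraic hypotheses on the coordinates into statements about functions. *)
Lemma in_idl_germP F l : hol F -> (l <= n)%N ->
  in_idl zgerm l (germF F) <-> eqnear (fun x => F (zproj l x)) (fun _ => 0).
Proof.
move=> hF ln; have hQ := hol_zproj l hF; split.
  move=> [y yE].
  have /choice[Y hY] : forall i, exists G, hol G /\ y i = germF G.
    by move=> i; have [G hG ->] := germF_surj (y i); exists G.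
  have hS : hol (fun x => \sum_(i < n | (i < l)%N) coord i x * Y i x).
    by apply: hol_sum => i; apply: holM; [exact: hol_coord|case: (hY i)].
  have : germF F = germF (fun x => \sum_(i < n | (i < l)%N) coord i x * Y i x).
    rewrite germF_sum; last by move=> i; apply: holM; [exact: hol_coord|case: (hY i)].
    rewrite yE; apply: eq_bigr => i _; have [hi ->] := hY i.
    by rewrite germFM //; exact: hol_coord.
  move=> /(germF_eq hF hS)/(eqnear_comp (zproj_bnd l))[d d0 hd].
  exists d => // x /hd ->; rewrite big1 // => i il.
  by rewrite zproj_coord il mul0r.
move=> hz; have [y ->] := germ_split hF ln; exists y.
rewrite (_ : germF _ = 0) ?add0r // -germF0; apply/germF_eq => //.
exact: hol_cst.
Qed.

(** Where the coordinate is nonzero it cancels. At its zeros, the function vanishes at all nearby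
    parameters [t != 0] of the line parallel to the axis, hence by continuity at [t = 0]. *)
Lemma zgerm_regular (i : 'I_n) g : in_idl zgerm i (zgerm i * g) -> in_idl zgerm i g.
Proof.
have [F hF ->] := germF_surj g.
have hc := hol_coord i; rewrite -germFM //.
have ln : (i <= n)%N by exact: ltnW.
move=> /(in_idl_germP (holM hc hF) ln)[d d0 hd].
apply/in_idl_germP => //; have [d' d'0 hd'] := hol_zproj i hF.
exists (Num.min (d / 2) d'); first by rewrite lt_min d'0 andbT; lra.
move=> x; rewrite lt_min => /andP[h1 h2].
have [xi|xi] := eqVneq (coord i x) 0; last first.
  have /hd : nm x < d by lra.
  by rewrite zproj_coord ltnn => /eqP; rewrite mulf_eq0 (negPf xi) /= => /eqP.
have [L hL] := hd' x h2; have n0 := nm_ge0 (ev R i).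
have cq : zcts (fun t => F (zproj i (x + t *: ev R i))) 0.
  have := @cfder_line R _ (fun y => F (zproj i y)) x (ev R i) 0 L.
  by rewrite scale0r addr0 => /(_ hL)/cder_zcts.
have := ord_ge_lead0 (k := 1) cq; rewrite scale0r addr0; apply.
exists 0, (d / 2 / (nm (ev R i) + 1)); first by rewrite !divr_gt0 //; lra.
move=> t; rewrite ltr_pdivlMr; last by lra.
move=> ht; have /hd : nm (x + t *: ev R i) < d.
  by apply: le_lt_trans (nmD _ _) _; rewrite nmZ; have := normc_ge0 t; nra.
rewrite zproj_coord ltnn (clinearD _ _ (@coord_lin R n i)) xi add0r coord_line expr1 => ->.
by rewrite normc0 mul0r.
Qed.

Lemma germFN1 : germF (fun _ : Cn => -1) = -1 :> germ.
Proof.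
apply/eqP; rewrite -addr_eq0 -germF1 -germFD; [|exact: hol_cst|exact: hol_cst].
by rewrite -(germF0 R n); apply/eqP; congr germF; apply/funext => x; rewrite addNr.
Qed.

(** On the subspace, [F] coincides for each [k] with a multiple of the [k]-th power of the
    coordinate, hence is flat and vanishes by [flat]. *)
Lemma zgerm_separated (i : 'I_n) g :
  (forall k : nat, exists h, in_idl zgerm i (g - zgerm i ^+ k * h)) -> in_idl zgerm i g.
Proof.
have [F hF ->] := germF_surj g => hk.
have ln : (i <= n)%N by exact: ltnW.
have hQ := hol_zproj i hF.
apply/in_idl_germP => //; apply: flat => // k.
have [h] := hk k; have [H hH ->] := germF_surj h.
have hcX : hol (fun x : Cn => coord i x ^+ k) by apply: holX; exact: hol_coord.
have hZ : hol (fun x => F x + -1 * (coord i x ^+ k * H x)).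
  by apply: holD => //; apply: holM; [exact: hol_cst|exact: holM].
have -> : germF F - zgerm i ^+ k * germF H = germF (fun x => F x + -1 * (coord i x ^+ k * H x)).
  rewrite germFD //; last by apply: holM; [exact: hol_cst|exact: holM].
  rewrite germFM; [|exact: hol_cst|exact: holM]; rewrite germFM // germFX; last exact: hol_coord.
  by rewrite germFN1 mulN1r.
move=> /(in_idl_germP hZ ln)[d d0 hd].
have [d' d'0 hd'] := hol_cts (hol_zproj i hH) ltr01.
exists (normc (H (zproj i 0)) + 1); first by rewrite addr_ge0 ?normc_ge0.
exists (Num.min d d'); first by rewrite lt_min d0.
move=> x; rewrite lt_min => /andP[/hd h1 /hd' h2].
have -> : F (zproj i x) = coord i x ^+ k * H (zproj i x).
  move: h1; rewrite zproj_coord ltnn mulN1r => /eqP; rewrite subr_eq0 => /eqP; exact.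
rewrite normcM normcX mulrC; apply: ler_pM; rewrite ?normc_ge0 ?exprn_ge0 ?normc_ge0 //.
  have := le_normcD (H (zproj i x) - H (zproj i 0)) (H (zproj i 0)); rewrite subrK; lra.
by apply: lerXn2r; rewrite ?nnegrE ?normc_ge0 ?nm_ge0 // nm_coord.
Qed.

Lemma germ_local g : in_idl zgerm n g \/ exists h, h * g = 1.
Proof.
have [F hF ->] := germF_surj g.
have [F0|F0] := eqVneq (F 0) 0; last by right; exact: germF_unit.
left; apply/in_idl_germP => //; exists 1 => // x _.
by rewrite zproj_n.
Qed.

End GermIdeals.

Section Pullback.
Variables (R : realType) (m n : nat).
Local Notation C := R[i].
Variables (T : 'rV[C]_m -> 'rV[C]_n) (B : R).
Hypothesis T_lin : clinear T.
Hypothesis T_bnd : forall x, nm (T x) <= B * nm x.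

Definition germ_rep (g : germ C n) : 'rV[C]_n -> C := s2val (cid2 (germF_surj g)).

Lemma germ_repP g : hol (germ_rep g) /\ g = germF (germ_rep g).
Proof. by rewrite /germ_rep; case: cid2. Qed.

Definition germ_pull (g : germ C n) : germ C m := germF (fun x => germ_rep g (T x)).

Lemma germ_pullE F : hol F -> germ_pull (germF F) = germF (fun x => F (T x)).
Proof.
move=> hF; have [h1 h2] := germ_repP (germF F).
apply/germF_eq; [exact: hol_comp T_lin T_bnd h1|exact: hol_comp T_lin T_bnd hF|].
by apply: (eqnear_comp T_bnd); apply/germF_eq.
Qed.

Lemma germ_pullD a b : germ_pull (a + b) = germ_pull a + germ_pull b.
Proof.
have [F hF ->] := germF_surj a; have [H hH ->] := germF_surj b.
rewrite -germFD // !germ_pullE //; last exact: holD.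
by rewrite germFD //; exact: hol_comp T_lin T_bnd _.
Qed.

Lemma germ_pullM a b : germ_pull (a * b) = germ_pull a * germ_pull b.
Proof.
have [F hF ->] := germF_surj a; have [H hH ->] := germF_surj b.
rewrite -germFM // !germ_pullE //; last exact: holM.
by rewrite germFM //; exact: hol_comp T_lin T_bnd _.
Qed.

End Pullback.

(** * The ring of germs is Noetherian *)

Section GermNoetherian.
Variable R : realType.
Local Notation C := R[i].

(** The values [T j 0] are the Taylor coefficients of [F] along the line spanned by [v], and [b] is
    the index of the first nonzero one, the Weierstrass order. *)
Lemma finite_order (V : normedModType C) (lam : V -> C) (Bl : R) (F : V -> C) (v : V) :
  clinear (lam : V -> C^o) -> (forall x, normc (lam x) <= Bl * nm x) -> lam v = 1 -> hol F ->
  ~ (forall k, ord_ge (fun t => F (t *: v)) k) ->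
  exists r, 0 < r /\ exists T : nat -> V -> C, exists b : nat,
   [/\ forall j, exists M, holo_dom lam v (T j) r r M,
       forall j x, dom lam v r r x -> T j x = T j (dirproj lam v x) + lam x * T j.+1 x,
       forall x, T 0%N x = F x,
       forall j, (j < b)%N -> T j 0 = 0 & T b 0 != 0].
Proof.
move=> l1 l2 l3 hF nflat.
have [r r0 [M hM]] := near_holo_dom lam v hF.
have [T [T0 hT TE]] := dir_tower l1 l2 l3 r0 hM.
have ex : exists b, T b 0 != 0.
  apply: contrapT => nex; apply: nflat => k.
  have T00 j : T j 0 = 0 by apply/eqP/negPn/negP => h; apply: nex; exists j.
  exists ((64 / r) ^+ k * M), r => // t ht.
  have Pt : dirproj lam v (t *: v) = 0.
    by rewrite /dirproj (clinearZ _ _ l1) l3 [t *: 1]mulr1 subrr.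
  have lt : lam (t *: v) = t by rewrite (clinearZ _ _ l1) l3 [LHS]mulr1.
  have dt : dom lam v r r (t *: v) by split; rewrite ?Pt ?lt ?nm0.
  rewrite -T0 (tower_expand TE k dt) big1 ?add0r => [|j _]; last by rewrite Pt T00 mulr0.
  rewrite lt normcM normcX mulrC ler_wpM2r ?exprn_ge0 ?normc_ge0 //.
  by have [_] := hT k _ dt.
case: (ex_minnP ex) => b Tb bmin.
exists r; split => //; exists T, b; split => //; first by move=> j; exists ((64 / r) ^+ j * M).
move=> j jb; apply/eqP/negPn/negP => h; have := bmin j h; by rewrite leqNgt jb.
Qed.

Lemma weierstrass_near (V : normedModType C) (lam : V -> C) (Bl : R) (F G : V -> C) (v : V) r T b :
  clinear (lam : V -> C^o) -> (forall x, normc (lam x) <= Bl * nm x) -> lam v = 1 -> 0 < r ->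
  (forall j, exists M, holo_dom lam v (T j) r r M) ->
  (forall j x, dom lam v r r x -> T j x = T j (dirproj lam v x) + lam x * T j.+1 x) ->
  (forall x, T 0%N x = F x) ->
  (forall j, (j < b)%N -> T j 0 = 0) -> T b 0 != 0 -> hol G ->
  exists Q (A : nat -> V -> C), [/\ hol Q, forall j, hol (A j) &
    eqnear G (fun x => F x * Q x + \sum_(j < b) lam x ^+ j * A j (dirproj lam v x))].
Proof.
move=> l1 l2 l3 r0 hT TE T0 Tj Tb hG.
have [s s0 [M hM]] := near_holo_dom lam v hG.
pose q := Num.min r s; have q0 : 0 < q by rewrite lt_min r0.
have [qr qs] : q <= r /\ q <= s by rewrite !ge_min !lexx orbT.
have hT' j : exists M, holo_dom lam v (T j) q q M.
  by have [M' h] := hT j; exists M'; exact: holo_domS h.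
have TE' j x : dom lam v q q x -> T j x = T j (dirproj lam v x) + lam x * T j.+1 x.
  by move=> hx; apply: TE; exact: dom_sub hx.
have hM' : holo_dom lam v G q q M by exact: holo_domS hM.
have [rho [r' [Q [A [h1 h2 h3 h4]]]]] := weierstrass_division l1 l2 l3 q0 q0 hT' TE' T0 Tj Tb hM'.
have [d d0 hd] := dom_open l1 l2 (dom0 v l1 h1 h2).
exists Q, A; split.
- by exists d => // x hx; have [|hc _] := h3 x _; first by apply: hd; rewrite subr0.
- by move=> j; exists d => // x hx; have [|_ hc] := h3 x _; first by apply: hd; rewrite subr0.
- by exists d => // x hx; apply: h4; apply: hd; rewrite subr0.
Qed.

(** By [line_flat] a direction in which [F] has finite order exists arbitrarily close to 0. It takes
    the place of the linear change of coordinates that usually precedes Weierstrass division. *)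
Lemma nonzero_germ_line n (F : 'rV[C]_n -> C) : hol F -> ~ eqnear F (fun _ => 0) ->
  F 0 != 0 \/ exists2 x, x != 0 & ~ (forall k, ord_ge (fun t => F (t *: x)) k).
Proof.
move=> hF nz; have [r r0 [M hM]] := hol_ball hF.
have [x [hx Fx]] : exists x, nm x < r / 128 /\ F x <> 0.
  apply: contrapT => nex; apply: nz; exists (r / 128); first exact: divr_gt0.
  by move=> x hx; apply: contrapT => h; apply: nex; exists x.
have [x0|x0] := eqVneq x 0; first by left; rewrite -x0; apply/eqP.
by right; exists x => // h; apply: Fx; exact: line_flat hM hx h.
Qed.

Section Insert.
Variables (n : nat) (i : 'I_n.+1).

Definition insert0 (w : 'rV[C]_n) : 'rV[C]_n.+1 :=
  \row_k if unlift i k is Some k' then w 0 k' else 0.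

Definition delete_coord (y : 'rV[C]_n.+1) : 'rV[C]_n := \row_k y 0 (lift i k).

Lemma insert0_lin : clinear insert0.
Proof.
by move=> a x y; apply/rowP => k; rewrite !mxE; case: unliftP => *; rewrite ?mxE ?mulr0 ?addr0.
Qed.

Lemma insert0_bnd w : nm (insert0 w) <= 1 * nm w.
Proof.
rewrite mul1r; apply: nm_row_le => [|k]; first exact: nm_ge0.
by rewrite mxE; case: unliftP => *; rewrite ?normc0 ?nm_ge0 ?nm_coord.
Qed.

Lemma delete_lin : clinear delete_coord.
Proof. by move=> a x y; apply/rowP => k; rewrite !mxE. Qed.

Lemma delete_bnd y : nm (delete_coord y) <= nm y.
Proof. by apply: nm_row_le => [|k]; rewrite ?mxE ?nm_ge0 ?nm_coord. Qed.

Lemma insert0K (y : 'rV[C]_n.+1) : y 0 i = 0 -> insert0 (delete_coord y) = y.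
Proof.
by move=> y0; apply/rowP => k; rewrite !mxE; case: unliftP => [k' ->|->]; rewrite ?mxE.
Qed.

End Insert.

(** Induction on the dimension: a nonzero germ [g] of [J] that is not a unit is used as divisor, and
    the remainders have coefficients in one variable less. In dimension 0 there is no nonzero
    direction, so a nonzero germ is a unit. *)
Theorem germ_noetherian n : noetherian (germ C n).
Proof.
elim: n => [|n IH] J hJ; have [J0 JD JM] := hJ.
  have [hz|] := pselect (forall x, J x -> x = 0); first exact: fin_gen0.
  move=> /existsNP[g /not_implyP[Jg g0]]; apply: fin_gen1.
  have [F hF gF] := germF_surj g.
  have nz : ~ eqnear F (fun _ => 0).
    by move=> h; apply: g0; rewrite gF -(germF0 R 0); apply/germF_eq => //; exact: hol_cst.
  have [F0|[x]] := nonzero_germ_line hF nz.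
  - by have [h <-] := germF_unit hF F0; apply: JM; rewrite -gF.
  - by rewrite [x]thinmx0 eqxx.
have [hz|] := pselect (forall x, J x -> x = 0); first exact: fin_gen0.
move=> /existsNP[g /not_implyP[Jg g0]].
have [F hF gF] := germF_surj g.
have nz : ~ eqnear F (fun _ => 0).
  by move=> h; apply: g0; rewrite gF -(germF0 R n.+1); apply/germF_eq => //; exact: hol_cst.
have [F0|[x x0 nflat]] := nonzero_germ_line hF nz.
  by apply: fin_gen1; have [h <-] := germF_unit hF F0; apply: JM; rewrite -gF.
have [i xi] : exists i, x 0 i != 0.
  apply: contrapT => nex; case/negP: x0; apply/eqP/rowP => i; rewrite mxE.
  by apply/eqP/negPn/negP => h; apply: nex; exists i.
(* Normalised so that [lam x = 1], with kernel the coordinate hyperplane where entry [i] is 0.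
   Deleting that entry identifies the kernel with the space of dimension [n]. *)
pose lam (y : 'rV[C]_n.+1) : C := (x 0 i)^-1 * y 0 i.
have l1 : clinear (lam : 'rV[C]_n.+1 -> C^o).
  by move=> a u w; rewrite /lam !mxE /GRing.scale /=; ring.
have l2 y : normc (lam y) <= (normc (x 0 i))^-1 * nm y.
  by rewrite normcM normcV ler_wpM2l ?invr_ge0 ?normc_ge0 ?nm_coord.
have l3 : lam x = 1 by rewrite /lam mulVf.
have [r [r0 [T [b [hT TE T0 Tj Tb]]]]] := finite_order l1 l2 l3 hF nflat.
pose pi y := delete_coord i (dirproj lam x y).
have pi_lin : clinear pi.
  by move=> a u w; rewrite /pi (dirproj_lin x l1) delete_lin.
have pi_bnd y : nm (pi y) <= (1 + `|(normc (x 0 i))^-1| * nm x) * nm y.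
  by apply: le_trans (delete_bnd _ _) _; exact: dirproj_bnd.
have sp y : insert0 i (pi y) = dirproj lam x y.
  by apply: insert0K; rewrite !mxE /lam; field.
have hlam : hol lam by exact: hol_lin l1 l2.
apply: (@fin_gen_transfer _ _ (germ_pull pi) J g (germF lam) b) => //.
- exact: germ_pullD pi_lin pi_bnd.
- exact: germ_pullM pi_lin pi_bnd.
move=> g'; have [H hH ->] := germF_surj g'.
have [Q [A [hQ hA HE]]] := weierstrass_near l1 l2 l3 r0 hT TE T0 Tj Tb hH.
have hAs j : hol (fun w => A j (insert0 i w)).
  exact: hol_comp (insert0_lin i) (insert0_bnd i) (hA j).
have hAp j : hol (fun y => A j (dirproj lam x y)).
  exact: hol_comp (dirproj_lin x l1) (dirproj_bnd x l2) (hA j).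
have hs (j : 'I_b) : hol (fun y => lam y ^+ j * A j (dirproj lam x y)).
  by apply: holM => //; exact: holX.
have hsum : hol (fun y => \sum_(j < b) lam y ^+ j * A j (dirproj lam x y)).
  exact: (@hol_sum R n.+1 _ _ (fun (j : 'I_b) y => lam y ^+ j * A j (dirproj lam x y)) xpredT hs).
exists (germF Q), (\row_j germF (fun w => A j (insert0 i w))).
have -> : germF H = germF (fun y => F y * Q y + \sum_(j < b) lam y ^+ j * A j (dirproj lam x y)).
  by apply/germF_eq => //; apply: holD => //; exact: holM.
rewrite germFD //; last exact: holM.
rewrite germFM // gF mulrC; congr (_ + _).
rewrite (@germF_sum R n.+1 _ _ (fun (j : 'I_b) y => lam y ^+ j * A j (dirproj lam x y))) //.
apply: eq_bigr => j _; rewrite mxE (germ_pullE pi_lin pi_bnd) // germFM //; last exact: holX.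
rewrite germFX // mulrC; congr (_ * _); congr germF.
by apply/funext => y; rewrite sp.
Qed.

End GermNoetherian.

(** * The maximum principle and Cartan's uniqueness theorem *)

Section Orders.
Variable R : realType.
Local Notation C := R[i].
Implicit Types (f e : C -> C).

Lemma ord_ge_pos f k : ord_ge f k -> exists2 K : R, 0 <= K & exists2 d : R, 0 < d &
  forall t, normc t < d -> normc (f t) <= K * normc t ^+ k.
Proof.
move=> [K [d d0 hd]]; exists `|K| => //; exists d => // t /hd h; apply: le_trans h _.
by rewrite ler_wpM2r ?ler_norm // exprn_ge0 ?normc_ge0.
Qed.

Lemma ord_geD f e k : ord_ge f k -> ord_ge e k -> ord_ge (fun t => f t + e t) k.
Proof.
move=> [K [d d0 hd]] [K' [d' d'0 hd']]; exists (K + K'), (Num.min d d').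
  by rewrite lt_min d0.
move=> t; rewrite lt_min => /andP[/hd h1 /hd' h2].
by apply: le_trans (le_normcD _ _) _; rewrite mulrDl lerD.
Qed.

Lemma ord_geM f e k l : ord_ge f k -> ord_ge e l -> ord_ge (fun t => f t * e t) (k + l).
Proof.
move=> /ord_ge_pos[K K0 [d d0 hd]] /ord_ge_pos[K' K'0 [d' d'0 hd']].
exists (K * K'), (Num.min d d'); first by rewrite lt_min d0.
move=> t; rewrite lt_min => /andP[/hd h1 /hd' h2].
rewrite normcM exprD mulrACA; apply: ler_pM; rewrite ?normc_ge0 //.
Qed.

Lemma ord_geZ c f k : ord_ge f k -> ord_ge (fun t => c * f t) k.
Proof.
move=> h; rewrite -[k]add0n; apply: (@ord_geM (fun _ => c)) => //.
by exists (normc c), 1 => // t _; rewrite mulr1.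
Qed.

Lemma ord_ge_factor f (q : C -> C) r M k : 0 < r -> holo_disc q r M ->
  (forall t, normc t < r -> f t = t ^+ k * q t) -> ord_ge f k.
Proof.
move=> r0 hq hf; exists M, r => // t ht; rewrite hf // normcM normcX mulrC.
by rewrite ler_wpM2r ?exprn_ge0 ?normc_ge0 //; case: (hq t ht).
Qed.

Lemma holo_discB f e (r M M' : R) : holo_disc f r M -> holo_disc e r M' ->
  holo_disc (fun t => f t - e t) r (M + M').
Proof.
move=> hf he t ht; have [h1 h2] := hf t ht; have [h3 h4] := he t ht.
by split; [exact: cdfB|apply: le_trans (le_normcB _ _) _; exact: lerD].
Qed.

(* The k-th Taylor coefficient of [e] is [1/m] times that of [p m], which is
   bounded independently of [m]. *)
Lemma order_improve e (p : nat -> C -> C) (r Me M : R) k : 0 < r ->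
  holo_disc e r Me -> (forall m, holo_disc (p m) r M) -> ord_ge e k ->
  (forall m, ord_ge (fun t => p m t - m%:R * e t) k.+1) -> ord_ge e k.+1.
Proof.
move=> r0 he hp ek pk.
have [q hq eq] := disc_order r0 he ek.
have n0r : normc (0 : C) < r by rewrite normc0.
have q0 : q 0 = 0.
  pose B := (64 / r) ^+ k * M.
  suff H m : m%:R * normc (q 0) <= B.
    apply: eq0_normc; apply/eqP; rewrite eq_le normc_ge0 andbT.
    apply: (@le_eps_nat _ _ _ B) => m; rewrite add0r.
    by rewrite ler_pdivlMr ?ltr0n // mulrC.
  have pmk : ord_ge (p m) k.
    have -> : p m = (fun t => (p m t - m%:R * e t) + m%:R * e t).
      by apply/funext => t; rewrite subrK.
    by apply: ord_geD; [exact: ord_geS|exact: ord_geZ].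
  have [pq hpq peq] := disc_order r0 (hp m) pmk.
  suff E : pq 0 = m%:R * q 0.
    by rewrite -(normc_nat R m) -normcM -E; have [] := hpq 0 n0r.
  have cq := cdf_zcts (hq 0 n0r).1; have cpq := cdf_zcts (hpq 0 n0r).1.
  apply/eqP; rewrite -subr_eq0; apply/eqP.
  apply: (@ord_ge_lead0 R (fun t => pq t - m%:R * q t) k).
    by apply: zctsB => //; apply: zctsM => //; exact: zcts_cst.
  by apply: (ord_ge_near r0 _ (pk m)) => t ht; rewrite (peq _ ht) (eq _ ht); ring.
have [q1 hq1 qq1] := disc_factor r0 hq.
apply: (ord_ge_factor r0 hq1) => t ht.
by rewrite eq // qq1 // q0 add0r exprSr mulrA.
Qed.

Lemma holo_discX f (r : R) m : holo_disc f r 1 -> holo_disc (fun t => f t ^+ m) r 1.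
Proof.
move=> hf t ht; have [h1 h2] := hf t ht; split; first exact: cdfX.
by rewrite normcX exprn_ile1 ?normc_ge0.
Qed.

Lemma ord_ge1 f (r M : R) : 0 < r -> holo_disc f r M -> f 0 = 0 -> ord_ge f 1.
Proof.
move=> r0 hf f0; have [q hq fq] := disc_factor r0 hf.
by apply: (ord_ge_factor r0 hq) => t ht; rewrite fq // f0 add0r.
Qed.

(** The powers of [f] are bounded by 1, while [f ^+ m - 1] and [m * (f - 1)] differ by a term of
    higher order; [order_improve] then raises the order of [f - 1] indefinitely. *)
Lemma max_flat f (r : R) : 0 < r -> holo_disc f r 1 -> f 0 = 1 ->
  forall k, ord_ge (fun t => f t - 1) k.
Proof.
move=> r0 hf f0.
have h1 : holo_disc (fun _ : C => 1 : C) r 1.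
  by move=> t _; split; [exact: cdf_cst|rewrite normc1].
have he := holo_discB hf h1.
have ord1 : ord_ge (fun t => f t - 1) 1 by apply: (ord_ge1 r0 he); rewrite f0 subrr.
elim=> [|k IH]; first exact: ord_geS ord1.
case: k IH => [//|k] IH.
apply: (@order_improve _ (fun m t => f t ^+ m - 1) r _ (1 + 1) _ r0 he _ IH).
  by move=> m; apply: holo_discB => //; exact: holo_discX.
elim=> [|m IHm].
  exists 0, 1 => // t _; by rewrite expr0 mul0r subrr subr0 normc0 mul0r.
have -> : (fun t => f t ^+ m.+1 - 1 - m.+1%:R * (f t - 1)) =
   (fun t => (f t ^+ m - 1 - m%:R * (f t - 1)) + (f t - 1) * (f t ^+ m - 1)).
  by apply/funext => t; rewrite exprS -natr1; ring.
apply: ord_geD => //.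
have ordm : ord_ge (fun t => f t ^+ m - 1) 1.
  apply: (ord_ge1 r0 (holo_discB (holo_discX m hf) h1)).
  by rewrite f0 expr1n subrr.
by have := ord_geM IH ordm; rewrite addn1.
Qed.

Variable V : normedModType C.
Implicit Types (F : V -> C) (x : V).

(** After division by [F 0], [max_flat] applies on every line through 0, and [line_flat] turns
    flatness into constancy on a ball. *)
Lemma hol_max_const F : hol F ->
  (exists2 d : R, 0 < d & forall x, nm x < d -> normc (F x) <= normc (F 0)) ->
  exists2 d : R, 0 < d & forall x, nm x < d -> F x = F 0.
Proof.
move=> hF [d d0 hd].
have [F0|F0] := eqVneq (F 0) 0.
  exists d => // x /hd; rewrite F0 normc0 => h; apply: eq0_normc.
  by apply/eqP; rewrite eq_le h normc_ge0.
have [r r0 [M hM]] := hol_ball hF.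
pose s := Num.min r d; have s0 : 0 < s by rewrite lt_min r0.
have [sr sd] : s <= r /\ s <= d by rewrite !ge_min !lexx orbT.
have F0' : 0 < normc (F 0) by rewrite normc_gt0.
pose G x := F x / F 0.
have hG : holo_ball G 0 s 1.
  move=> x hx; split.
    by apply: cdfM; [case: (hM x (lt_le_trans hx sr))|exact: cdf_cst].
  rewrite normcM normcV ler_pdivrMr // mul1r; apply: hd.
  by rewrite subr0 in hx; exact: lt_le_trans sd.
have hG1 : holo_ball (fun x => G x - 1) 0 s (1 + 1).
  move=> x hx; have [g1 g2] := hG x hx; split; first by apply: cdfB => //; exact: cdf_cst.
  by apply: le_trans (le_normcB _ _) _; rewrite normc1 lerD.
exists (s / 128); first exact: divr_gt0.
move=> x hx; have := line_flat s0 hG1 hx; have n0 := nm_ge0 x.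
have hr : 128 * nm x <= s by move: hx; rewrite ltr_pdivlMr // mulrC => /ltW.
have p128 : (0 : R) < 128 by [].
have G0 : G ((0 : C) *: x) = 1 by rewrite scale0r /G divff.
have h := max_flat p128 (holo_line0 s0 p128 hr hG) G0.
move=> /(_ h) /eqP; rewrite subr_eq0 => /eqP.
by rewrite /G => /(congr1 (fun z => z * F 0)); rewrite divfK // mul1r.
Qed.

End Orders.

Section Cartan.
Variables (R : realType) (n : nat).
Local Notation C := R[i].
Local Notation Cn := 'rV[C]_n.
Implicit Types (f g : Cn -> R) (x y z w : Cn).

Lemma vordD f g k : vord f k -> vord g k -> vord (fun x => f x + g x) k.
Proof.
move=> [K K0 [d d0 hd]] [K' K'0 [d' d'0 hd']]; exists (K + K'); first exact: addr_ge0.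
exists (Num.min d d'); first by rewrite lt_min d0.
by move=> x; rewrite lt_min mulrDl => /andP[/hd h1 /hd' h2]; exact: lerD.
Qed.

Lemma vordZ (c : R) f k : 0 <= c -> vord f k -> vord (fun x => c * f x) k.
Proof.
move=> c0 [K K0 [d d0 hd]]; exists (c * K); first exact: mulr_ge0.
by exists d => // x /hd h; rewrite -mulrA ler_wpM2l.
Qed.

Lemma vord_le f g k (d : R) : 0 < d -> (forall x, nm x < d -> f x <= g x) ->
  vord g k -> vord f k.
Proof.
move=> d0 fg [K K0 [d' d'0 hd']]; exists K => //; exists (Num.min d d').
  by rewrite lt_min d0.
by move=> x; rewrite lt_min => /andP[/fg h /hd' h']; exact: le_trans h h'.
Qed.

Lemma vordS f k : vord f k.+1 -> vord f k.
Proof.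
move=> [K K0 [d d0 hd]]; exists K => //; exists (Num.min d 1); first by rewrite lt_min d0 ltr01.
move=> x; rewrite lt_min => /andP[/hd h1 h2]; apply: le_trans h1 _; rewrite ler_wpM2l //.
by rewrite exprS ler_piMl ?exprn_ge0 ?nm_ge0 // ltW.
Qed.

Lemma vord_row (f : Cn -> Cn) k : (forall i, vord (fun x => normc (coord i (f x))) k) ->
  vord (fun x => nm (f x)) k.
Proof.
move=> hf.
have /choice[K hK] : forall i, exists K : R, 0 <= K /\ exists2 d : R, 0 < d &
    forall x, nm x < d -> normc (coord i (f x)) <= K * nm x ^+ k.
  by move=> i; have [K K0 hd] := hf i; exists K.
exists (\sum_i K i); first by apply: sumr_ge0 => i _; case: (hK i).
have [d d0 hd] := near0_forall (fun i => (hK i).2).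
exists d => // x hx.
have e0 : 0 <= nm x ^+ k by rewrite exprn_ge0 ?nm_ge0.
apply: nm_row_le => [|i].
  by rewrite mulr_ge0 //; apply: sumr_ge0 => i _; case: (hK i).
apply: le_trans (hd x hx i) _.
rewrite ler_wpM2r // (bigD1 i) //= lerDl; apply: sumr_ge0 => j _; by case: (hK j).
Qed.

(** The constants of [ord_ge] may vary from line to line, but the bound of [disc_order] depends only
    on the radius and on [M], so it is uniform. *)
Lemma ord_ge_vord (F : Cn -> C) (r M : R) k : 0 < r -> holo_ball F 0 r M ->
  (forall z, ord_ge (fun t => F (t *: z)) k) -> vord (fun x => normc (F x)) k.
Proof.
move=> r0 hF hk.
have M0 : 0 <= M.
  have [|_ h] := hF 0; first by rewrite subrr nm0.
  by apply: le_trans h; exact: normc_ge0.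
exists ((64 / r * 2) ^+ k * M); first by rewrite mulr_ge0 // exprn_ge0 // mulr_ge0 // divr_ge0 // ltW.
exists (r / 2); first by lra.
move=> x hx; have [x0|x0] := eqVneq x 0.
  subst x; have := hk 0 => -[K [d d0 hd]].
  have [k0|k0] := posnP k.
    rewrite k0 expr0 mul1r mulr1; have [|_ h] := hF 0; first by rewrite subrr nm0.
    exact: h.
  have := hd 0; rewrite normc0 scaler0 nm0 !expr0n (gtn_eqF k0) !mulr0; exact.
have n0 : 0 < nm x by rewrite nm_gt0.
pose rho := r / 2 / nm x; have rho0 : 0 < rho by rewrite !divr_gt0.
have hr : rho * nm x <= r by rewrite /rho divfK ?gt_eqF //; lra.
have [q hq fq] := disc_order rho0 (holo_line0 r0 rho0 hr hF) (hk x).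
have n1 : normc (1 : C) < rho by rewrite normc1 /rho ltr_pdivlMr // mul1r.
have := fq 1 n1; rewrite scale1r expr1n mul1r => ->.
have [_ h] := hq 1 n1; apply: le_trans h _.
rewrite (_ : 64 / rho = 64 / r * 2 * nm x); last by rewrite /rho; field; rewrite !gt_eqF.
by rewrite [X in X * M <= _]exprMn mulrAC.
Qed.

(** On the disc of radius [nm z / nm w] the function [F (z + t *: w)] is at most
    [4 * K * nm z ^+ 2], since the argument has norm below [2 * nm z]. One division costs 64 times
    the inverse radius, hence the constant 256. *)
Lemma vord_lipschitz (F : Cn -> C) (r M : R) : 0 < r -> holo_ball F 0 r M ->
  vord (fun x => normc (F x)) 2 -> exists2 K : R, 0 <= K & exists2 d : R, 0 < d &
    forall z w, nm z < d -> nm w < nm z -> normc (F (z + w) - F z) <= K * nm z * nm w.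
Proof.
move=> r0 hF [K K0 [d d0 hd]].
exists (256 * K); first exact: (mulr_ge0 (ler0n R 256)).
exists (Num.min r d / 2); first by rewrite divr_gt0 // lt_min r0.
move=> z w hz hw; have [w0|w0] := eqVneq w 0.
  by rewrite w0 addr0 subrr normc0 nm0 mulr0.
have [md mr] : Num.min r d <= d /\ Num.min r d <= r by rewrite !ge_min !lexx orbT.
have n0 : 0 < nm w by rewrite nm_gt0.
pose s := nm z / nm w.
have s1 : 1 < s by rewrite /s ltr_pdivlMr // mul1r.
have s0 : 0 < s by lra.
have hs : holo_disc (fun t => F (z + t *: w)) s (4 * K * nm z ^+ 2).
  move=> t ht; have tz : nm (z + t *: w) < 2 * nm z.
    apply: le_lt_trans (nmD _ _) _; rewrite nmZ.
    by move: ht; rewrite /s ltr_pdivlMr //; lra.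
  have [[L hL] _] := hF (z + t *: w) (ltac:(rewrite subr0; lra)).
  split; first by apply/cder_cdf; exists (L w); exact: cfder_line hL.
  apply: le_trans (hd _ _) _; first by lra.
  have -> : 4 * K * nm z ^+ 2 = K * (2 * nm z) ^+ 2 by ring.
  rewrite ler_wpM2l //; apply: lerXn2r; rewrite ?nnegrE ?nm_ge0 ?mulr_ge0 ?nm_ge0 //.
  exact: ltW.
have [q hq fq] := disc_factor s0 hs.
have n1 : normc (1 : C) < s by rewrite normc1.
have := fq 1 n1; rewrite scale1r scale0r addr0 mul1r => ->; rewrite addrDB.
have [_ h] := hq 1 n1; apply: le_trans h _.
rewrite le_eqVlt; apply/orP; left; apply/eqP; rewrite /s; field.
by rewrite !gt_eqF //; lra.
Qed.

Lemma vordM_nm f k : vord f k -> vord (fun x => nm x * f x) k.+1.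
Proof.
move=> [K K0 [d d0 hd]]; exists K => //; exists d => // x /hd h.
by rewrite exprS mulrCA ler_wpM2l ?nm_ge0.
Qed.

(** [Phi m] is the [m]-th iterate, known only as a germ: the neighbourhood in the composition law
    may depend on [m], while [r] and [M] may not. If [E = Phi 1 - id] has order [k >= 2], then
    [Phi m - id] agrees with [m * E] up to order [k + 1], and boundedness of the iterates raises the
    order of [E]. *)
Theorem cartan_uniqueness (Phi : nat -> Cn -> Cn) (r M : R) : 0 < r ->
  (forall m i, holo_ball (fun z => coord i (Phi m z)) 0 r M) ->
  (exists2 d : R, 0 < d & forall z, nm z < d -> Phi 0%N z = z) ->
  (forall m, exists2 d : R, 0 < d & forall z, nm z < d -> Phi m.+1 z = Phi 1%N (Phi m z)) ->
  (forall m, Phi m 0 = 0) ->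
  (forall i, cfder (fun z => coord i (Phi 1%N z)) 0 (coord i)) ->
  exists2 d : R, 0 < d & forall z, nm z < d -> Phi 1%N z = z.
Proof.
move=> r0 hPhi hid hcomp hfix hder.
pose E i z := coord i (Phi 1%N z) - coord i z.
have hc i : holo_ball (coord i) (0 : Cn) r r.
  move=> z; rewrite subr0 => hz; split; first by eexists; exact: coord_cfder.
  by apply: le_trans (coord_bnd i z) _; rewrite mul1r ltW.
have hE i : holo_ball (E i) 0 r (M + r).
  move=> z hz; have [h1 h2] := hPhi 1%N i z hz; have [h3 h4] := hc i z hz; split.
    exact: cdfB.
  by apply: le_trans (le_normcB _ _) _; exact: lerD.
have E2 i : vord (fun z => normc (E i z)) 2.
  have K0 : 0 <= (64 / r) ^+ 2 * (M + r).
    have [|_ h] := hE i 0; first by rewrite subrr nm0.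
    by rewrite mulr_ge0 ?sqr_ge0 //; apply: le_trans h; exact: normc_ge0.
  exists ((64 / r) ^+ 2 * (M + r)) => //; exists r => // z hz.
  have dE : cfder (E i) 0 (fun h => coord i h - coord i h).
    by apply: cfderB => //; exact: coord_cfder.
  have [_] := second_order r0 (hE i) dE hz.
  by rewrite add0r subrr subr0 {2}/E hfix /coord !mxE subrr subr0.
(* Passing from [m] to [m + 1] adds the error [E (Phi m z) - E z]. By [vord_lipschitz] it is of size
   [nm z * nm (Phi m z - z)], of order [k + 1]. *)
have step k : (1 < k)%N -> (forall i, vord (fun z => normc (E i z)) k) ->
    forall m i, vord (fun z => normc (coord i (Phi m z) - coord i z - m%:R * E i z)) k.+1.
  move=> k1 Ek; elim=> [|m IH] i.
    have [d d0 hd] := hid; exists 0 => //; exists d => // z /hd ->.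
    by rewrite subrr mul0r subr0 normc0 mul0r.
  have dk : vord (fun z => nm (Phi m z - z)) k.
    apply: vord_row => j.
    have := vordD (vordS (IH j)) (vordZ (ler0n R m) (Ek j)).
    apply: (@vord_le _ _ _ 1) => // z _.
    rewrite -(normc_nat R m) -normcM -[X in X <= _](_ : normc (coord j (Phi m z) - coord j z) = _); last first.
      by rewrite /coord !mxE.
    by have := le_normcD (coord j (Phi m z) - coord j z - m%:R * E j z) (m%:R * E j z); rewrite subrK.
  have [KL KL0 [dL dL0 hL]] := vord_lipschitz r0 (hE i) (E2 i).
  (* [vord_lipschitz] requires an increment shorter than [z]; here the increment has order at least
     2. *)
  have small : exists2 d : R, 0 < d & forall z, nm z < d -> z != 0 -> nm (Phi m z - z) < nm z.
    have [K K0 [d d0 hd]] := dk; exists (Num.min d (Num.min 1 (K + 1)^-1)).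
      by rewrite !lt_min d0 ltr01 invr_gt0; lra.
    move=> z; rewrite !lt_min => /and3P[/hd h1 h2 h3] z0.
    have nz : 0 < nm z by rewrite nm_gt0.
    apply: le_lt_trans h1 _.
    have -> : nm z ^+ k = nm z * (nm z * nm z ^+ (k - 2)).
      by rewrite -!exprS -[in LHS](subnK k1) addn2.
    rewrite mulrCA -[X in _ < X]mulr1 ltr_pM2l //.
    have p1 : nm z ^+ (k - 2) <= 1 by rewrite exprn_ile1 ?nm_ge0 // ltW.
    have p0 : 0 <= nm z ^+ (k - 2) by rewrite exprn_ge0 ?nm_ge0.
    have K1 : nm z * (K + 1) < 1 by move: h3; rewrite -[_^-1]mul1r ltr_pdivlMr //; lra.
    have : K * (nm z * nm z ^+ (k - 2)) <= K * (nm z * 1).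
      by rewrite ler_wpM2l // ler_wpM2l // ltW.
    by rewrite mulr1; lra.
  have [ds ds0 hs] := small.
  have [dc dc0 hdc] := hcomp m.
  have := vordD (IH i) (vordZ KL0 (vordM_nm dk)).
  apply: (@vord_le _ _ _ (Num.min dL (Num.min ds dc))); first by rewrite !lt_min dL0 ds0.
  move=> z; rewrite !lt_min => /and3P[z1 z2 z3].
  have [->|z0] := eqVneq z 0.
    rewrite !hfix /E hfix /coord !mxE !subrr !mulr0 subrr normc0 nm0 mul0r mulr0 addr0.
    by rewrite ?normc0 ?lexx.
  have h4 := hL z (Phi m z - z) z1 (hs z z2 z0); rewrite subrKC in h4.
  rewrite hdc // mulrA.
  have -> : coord i (Phi 1%N (Phi m z)) - coord i z - m.+1%:R * E i z =
    (coord i (Phi m z) - coord i z - m%:R * E i z) + (E i (Phi m z) - E i z).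
    by rewrite /E -natr1; ring.
  by apply: le_trans (le_normcD _ _) _; exact: lerD.
(* [order_improve] concerns one variable, so it is applied on each line, and [ord_ge_vord] makes the
   result uniform again. *)
have all k : forall i, vord (fun z => normc (E i z)) k.+2.
  elim: k => [|k IH] i; first exact: E2.
  apply: (ord_ge_vord r0 (hE i)) => z.
  have hline F Mf : holo_ball F 0 r Mf ->
      holo_disc (fun t => F (t *: z)) (r / (nm z + 1)) Mf.
    have n0 := nm_ge0 z; apply: holo_line0 => //; first by rewrite divr_gt0 //; lra.
    rewrite mulrAC ler_pdivrMr; last by lra.
    by rewrite ler_wpM2l //; lra.
  have rz : 0 < r / (nm z + 1) by rewrite divr_gt0 //; have := nm_ge0 z; lra.
  apply: (@order_improve _ _ (fun m t => coord i (Phi m (t *: z)) - coord i (t *: z)) _ _ (M + r) _ rz).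
  - exact: hline (hE i).
  - move=> m; apply: holo_discB; first exact: (hline (fun z => coord i (Phi m z))).
    exact: hline (hc i).
  - exact: (vord_ord_ge z (IH i)).
  - move=> m; exact: (vord_ord_ge z (step k.+2 isT IH m i)).
have flatE i : eqnear (E i) (fun _ => 0).
  apply: flat; first by exists r => // x hx; case: (hE i x _); rewrite ?subr0.
  case=> [|[|k]]; last exact: all.
    exact: vordS (vordS (all 0%N i)).
  exact: vordS (all 0%N i).
have [d d0 hd] := near0_forall flatE.
exists d => // z hz; apply/rowP => i.
by have /eqP := hd z hz i; rewrite subr_eq0 => /eqP.
Qed.

End Cartan.

(** * Equivariant resolutions *)

Section Resolution.
Variables (G : groupType) (O : comNzRingType) (rho : ringAction G O).

Definition acts_trivially (g : G) := forall f, rho g f = f.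

Lemma rhoD g a b : rho g (a + b) = rho g a + rho g b.
Proof.
have rN u : rho g (- u) = - rho g u.
  have := ractB rho g 0 u; rewrite !sub0r => ->.
  by rewrite -{1}(subrr 0) (ractB rho) subrr sub0r.
by rewrite -{1}[b]opprK (ractB rho) rN opprK.
Qed.

Lemma rhoM g a b : rho g (a * b) = rho g a * rho g b.
Proof. exact: (ract_mul rho g).2. Qed.

Lemma acts_triviallyV g : acts_trivially g -> acts_trivially g^-1%g.
Proof. by move=> hg f; rewrite -{1}(hg f) -ractM mulVg ract1. Qed.

(* [st_ker] plays the role of the kernel of the map out of this module in the
   resolution. *)
Record stage := Stage {
  st_rank : nat;
  st_act : G -> 'rV[O]_st_rank -> 'rV[O]_st_rank;
  st_act1 : forall e, st_act 1%g e = e;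
  st_actM : forall g h e, st_act (g * h)%g e = st_act g (st_act h e);
  st_actD : forall g e e', st_act g (e + e') = st_act g e + st_act g e';
  st_actZ : forall g f e, st_act g (f *: e) = rho g f *: st_act g e;
  st_triv : forall g, acts_trivially g -> forall e, st_act g e = e;
  st_ker : 'rV[O]_st_rank -> Prop;
  st_sub : submod st_ker;
  st_stable : forall g x, st_ker x -> st_ker (st_act g x)
}.

Definition st_mod (s : stage) : equivModule rho :=
  @EquivModule G O rho 'rV[O]_(st_rank s) (@st_act s) (@st_act1 s) (@st_actM s)
    (@st_actD s) (@st_actZ s).

Definition free_gen m (K : 'rV[O]_m -> Prop) k (E : 'M[O]_(k, m)) :=
  rowgen K E /\ forall c : 'rV[O]_k, c *m E = 0 -> c = 0.

(** The last clause, injectivity over a free kernel, is what makes the resolution stop: the next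
    kernel is then 0. *)
Definition covers (s s' : stage) (E : 'M[O]_(st_rank s', st_rank s)) :=
  [/\ rowgen (@st_ker s) E, forall g c, st_act g c *m E = st_act g (c *m E),
      forall c, st_ker c <-> mxker E c &
      (exists k (E' : 'M[O]_(k, st_rank s)), free_gen (@st_ker s) E') ->
        forall c : 'rV[O]_(st_rank s'), c *m E = 0 -> c = 0].

Lemma st_act0 (s : stage) g : st_act g (0 : 'rV[O]_(st_rank s)) = 0.
Proof. by apply: (addrI (st_act g 0)); rewrite -st_actD !addr0. Qed.

Lemma st_act_sum (s : stage) g (I : Type) (r : seq I) (f : I -> 'rV[O]_(st_rank s)) :
  st_act g (\sum_(i <- r) f i) = \sum_(i <- r) st_act g (f i).
Proof.
elim: r => [|i r IH]; first by rewrite !big_nil st_act0.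
by rewrite !big_cons st_actD IH.
Qed.

(** A free basis makes [E] a bijection onto the kernel, so the action, its laws and its triviality
    on trivially acting elements are all read off through [E]. *)
Lemma free_cover (s : stage) k (E : 'M[O]_(k, st_rank s)) :
  free_gen (@st_ker s) E -> exists s' E', @covers s s' E'.
Proof.
move=> [hE injE].
have inj (c d : 'rV[O]_k) : c *m E = d *m E -> c = d.
  by move=> h; apply/eqP; rewrite -subr_eq0; apply/eqP/injE; rewrite mulmxBl h subrr.
have /choice[a ha] : forall gc : G * 'rV[O]_k, exists c, st_act gc.1 (gc.2 *m E) = c *m E.
  by move=> [g c] /=; apply/hE; apply: st_stable; apply/hE; exists c.
have {ha} aE g c : a (g, c) *m E = st_act g (c *m E) by rewrite -ha.
unshelve eexists (@Stage k (fun g c => a (g, c)) _ _ _ _ _ (mxker E) (mxker_submod E) _).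
- by move=> e; apply: inj; rewrite aE st_act1.
- by move=> g h e; apply: inj; rewrite !aE st_actM.
- by move=> g e e'; apply: inj; rewrite !mulmxDl !aE mulmxDl st_actD.
- by move=> g f e; apply: inj; rewrite -scalemxAl !aE -scalemxAl st_actZ.
- by move=> g hg e; apply: inj; rewrite !aE st_triv.
- by move=> g x; rewrite /mxker aE => ->; rewrite st_act0.
by exists E; split.
Qed.

(* [G] permutes the finite set of translates of a generating family, so the free
   module on that set covers equivariantly. *)
Lemma perm_cover (s : stage) p (rep : 'I_p -> G) k (E : 'M[O]_(k, st_rank s)) :
  (forall g, exists i h, acts_trivially h /\ g = (rep i * h)%g) ->
  rowgen (@st_ker s) E ->
  ~ (exists k (E' : 'M[O]_(k, st_rank s)), free_gen (@st_ker s) E') ->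
  exists s' E', @covers s s' E'.
Proof.
move=> hrep hE nfree.
(* Repetitions are removed so that indexing is injective, which turns the action on vectors into an
   action on indices. One representative per coset gives all translates by [st_triv]. *)
pose L := undup [seq st_act (rep i) (row j E) | i <- enum 'I_p, j <- enum 'I_k].
have LP x : reflect (exists i j, x = st_act (rep i) (row j E)) (x \in L).
  rewrite mem_undup; apply: (iffP allpairsP) => [[[i j] [_ _ ->]]|[i [j ->]]].
    by exists i, j.
  by exists (i, j); rewrite !mem_enum.
have Lstab g x : x \in L -> st_act g x \in L.
  move=> /LP[i [j ->]]; apply/LP; have [i' [h [th e]]] := hrep (g * rep i)%g.
  by exists i', j; rewrite -st_actM e st_actM (st_triv th).
have rowL j : row j E \in L.
  apply/LP; have [i [h [th e]]] := hrep 1%g; exists i, j.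
  by rewrite -[row j E in RHS](st_triv th) -st_actM -e st_act1.
pose q := size L; pose t := in_tuple L.
have tL (i : 'I_q) : tnth t i \in L by exact: mem_tnth.
have tinj : injective (tnth t) by apply/tuple_uniqP; exact: undup_uniq.
have /choice[sg hsg] : forall gi : G * 'I_q, exists j, st_act gi.1 (tnth t gi.2) = tnth t j.
  by move=> [g i] /=; have [j ->] := elimT (tnthP t _) (Lstab g _ (tL i)); exists j.
have {hsg} sgE g i : tnth t (sg (g, i)) = st_act g (tnth t i) by rewrite -hsg.
have sg1 i : sg (1%g, i) = i by apply: tinj; rewrite sgE st_act1.
have sgM g h i : sg ((g * h)%g, i) = sg (g, sg (h, i)).
  by apply: tinj; rewrite !sgE st_actM.
pose E' : 'M[O]_(q, st_rank s) := \matrix_(i < q) tnth t i.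
have E'row i : row i E' = tnth t i by rewrite rowK.
(* The semilinear permutation action: [g] sends the basis vector [i] to [sg (g, i)] and acts on
   coefficients through [rho]. *)
pose act g (c : 'rV[O]_q) : 'rV[O]_q := \row_j rho g (c 0 (sg (g^-1%g, j))).
have actE g c : act g c *m E' = st_act g (c *m E').
  rewrite !mulmx_sum_row st_act_sum.
  rewrite (reindex (fun i => sg (g, i))) /=; last first.
    by exists (fun i => sg (g^-1%g, i)) => i _; rewrite -sgM ?mulVg ?mulgV sg1.
  apply: eq_bigr => i _; rewrite mxE -sgM mulVg sg1 !E'row sgE.
  by rewrite st_actZ.
have genE' : rowgen (@st_ker s) E'.
  move=> x; split=> [/hE[c ->]|[c ->]]; last first.
    apply: submod_mul; first exact: st_sub.
    move=> i; rewrite E'row; have /LP[a [j ->]] := tL i.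
    by apply: st_stable; exact: rowgen_row hE.
  have /choice[u hu] : forall j : 'I_k, exists i : 'I_q, row j E = tnth t i.
    by move=> j; have [i ->] := elimT (tnthP t _) (rowL j); exists i.
  exists (\sum_j c 0 j *: delta_mx 0 (u j)).
  rewrite mulmx_suml mulmx_sum_row; apply: eq_bigr => j _.
  by rewrite -scalemxAl -rowE E'row hu.
unshelve eexists (@Stage q act _ _ _ _ _ (mxker E') (mxker_submod E') _).
- by move=> e; apply/rowP => j; rewrite mxE ract1 invg1 sg1.
- by move=> g h e; apply/rowP => j; rewrite !mxE ractM invgM sgM.
- by move=> g e e'; apply/rowP => j; rewrite !mxE rhoD.
- by move=> g f e; apply/rowP => j; rewrite !mxE rhoM.
- move=> g hg e; apply/rowP => j; rewrite mxE hg; congr (e 0 _).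
  by apply: tinj; rewrite sgE st_triv //; exact: acts_triviallyV.
- by move=> g x; rewrite /mxker actE => ->; rewrite st_act0.
by exists E'; split.
Qed.

Variables (p : nat) (rep : 'I_p -> G).
Hypothesis rep_cover : forall g, exists i h, acts_trivially h /\ g = (rep i * h)%g.
Hypothesis O_noeth : noetherian O.

Lemma exists_cover (s : stage) : exists s' E', @covers s s' E'.
Proof.
have [[k [E hE]]|nfree] := pselect (exists k (E' : 'M[O]_(k, st_rank s)), free_gen (@st_ker s) E').
  exact: free_cover hE.
have [k [E hE]] := noetherian_submod O_noeth (st_sub s).
exact: perm_cover rep_cover hE nfree.
Qed.

Variables (n : nat) (z : 'I_n -> O).
Hypothesis z_regular : forall (i : 'I_n) g, in_idl z i (z i * g) -> in_idl z i g.
Hypothesis z_separated : forall (i : 'I_n) g,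
  (forall k : nat, exists h, in_idl z i (g - z i ^+ k * h)) -> in_idl z i g.
Hypothesis z_local : forall g, in_idl z n g \/ exists h, h * g = 1.
Variables (I : idealr O) (stI : stable_ideal I rho).

Definition unit_act g (x : 'rV[O]_1) : 'rV[O]_1 := \row_j rho g (x 0 j).

Definition stage0 : stage.
Proof.
unshelve refine (@Stage 1 unit_act _ _ _ _ _ (fun x => x 0 0 \in (I : pred O)) _ _).
- by move=> e; apply/rowP => j; rewrite mxE ract1.
- by move=> g h e; apply/rowP => j; rewrite !mxE ractM.
- by move=> g e e'; apply/rowP => j; rewrite !mxE rhoD.
- by move=> g f e; apply/rowP => j; rewrite !mxE rhoM.
- by move=> g hg e; apply/rowP => j; rewrite mxE hg.
- split=> [|x y|a x]; rewrite !mxE; first exact: rpred0.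
    exact: rpredD.
  exact: idealMr.
- by move=> g x; rewrite mxE; exact: stI.
Defined.

Definition aug (x : 'rV[O]_1) : quot_mod I := quot_of I (x 0 0).

Lemma aug_linear : linear aug.
Proof.
by move=> a x y; rewrite /aug !mxE rmorphD; congr (_ + _); rewrite rmorphM.
Qed.

HB.instance Definition _ := GRing.isLinear.Build O 'rV[O]_1 (quot_mod I) *:%R aug aug_linear.

Theorem equiv_free_resolution_exists :
  exists (r : nat) (m : nat -> nat) (F : nat -> equivModule rho)
         (phi : forall i, {linear F i.+1 -> F i})
         (pi : {linear F 0%N -> quot_equivModule stI}),
    is_equiv_free_resolution r m phi pi.
Proof.
have /choice[nx hnx] : forall s, exists s', exists E, @covers s s' E by exact: exists_cover.
have [Em hE] : exists Em : forall s, 'M[O]_(st_rank (nx s), st_rank s), forall s, covers (Em s).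
  exists (fun s => projT1 (cid (hnx s))) => s; exact: (projT2 (cid (hnx s))).
pose st := fix st k := if k is k'.+1 then nx (st k') else stage0.
have gen k : rowgen (@st_ker (st k)) (Em (st k)) by have [] := hE (st k).
have kerS k c : @st_ker (st k.+1) c <-> mxker (Em (st k)) c by have [_ _ h _] := hE (st k).
(* The first kernel is the ideal itself, with nothing known about it, so regularity starts at 0 and
   reaches all [n] coordinates at stage [n]. *)
have reg k : (k <= n)%N -> regular_upto z k (@st_ker (st k)).
  elim: k => [_ i|k IH kn]; first by rewrite ltn0.
  have -> : @st_ker (st k.+1) = mxker (Em (st k)).
    by apply/funext => c; apply/propext; exact: kerS.
  by apply: (regular_mxker z_regular (gen k)); apply: IH; exact: ltnW.
(* The kernel at stage [n] is free, so module [n + 1] maps isomorphically onto it: this is the last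
   module, whence the length [n + 1]. *)
have injn : forall c : 'rV[O]_(st_rank (st n.+1)), c *m Em (st n) = 0 -> c = 0.
  have [_ _ _] := hE (st n); apply.
  by apply: (regular_free z_separated z_local (gen n)); exact: reg.
have ker0 k : (n < k)%N -> forall c, @st_ker (st k) c -> c = 0.
  elim: k => [//|k IH]; rewrite ltnS leq_eqVlt => /orP[/eqP <- c /kerS|nk c /kerS]; first exact: injn.
  have [_ _ _ h] := hE (st k); apply: h.
  exists 0%N, 0; split=> [x|c' _]; last by rewrite [c']thinmx0.
  split=> [/(IH nk) ->|[c' ->]]; first by exists 0; rewrite mul0mx.
  by rewrite mulmx0; have [] := st_sub (st k).
(* From index [n + 2] on, the kernel to be covered is 0, free on no generators; the cover is then
   injective into 0. *)
have zero k : (n.+1 < k)%N -> forall x : 'rV[O]_(st_rank (st k)), x = 0.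
  case: k => [//|k]; rewrite ltnS => nk x.
  have [hg _ _ h] := hE (st k); apply: h.
    exists 0%N, 0; split=> [y|c' _]; last by rewrite [c']thinmx0.
    split=> [/(ker0 _ nk) ->|[c' ->]]; first by exists 0; rewrite mul0mx.
    by rewrite mulmx0; have [] := st_sub (st k).
  by apply: (ker0 _ nk); apply/hg; exists x.
pose F k := st_mod (st k).
pose phi k : {linear F k.+1 -> F k} := (mulmxr (Em (st k)) : {linear 'rV[O]_(st_rank (st k.+1)) -> 'rV[O]_(st_rank (st k))}).
pose pi : {linear F 0%N -> quot_equivModule stI} := (aug : {linear 'rV[O]_1 -> quot_mod I}).
exists n.+1, (fun k => st_rank (st k)), F, phi, pi; split.
- by move=> i _; exists (idfun : {linear 'rV[O]_(st_rank (st i)) -> 'rV[O]_(st_rank (st i))}); exists id.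
- exact: zero.
- by move=> i g e; have [_ h _ _] := hE (st i); exact: h.
- by move=> g e; rewrite /= /aug mxE quot_actE.
- move=> x; have [f ->] := quot_ofP x; exists (\row_j f : 'rV[O]_1).
  by rewrite /= /aug mxE.
- have aug0 x : aug x = 0 <-> x 0 0 \in (I : pred O).
    rewrite /aug -(rmorph0 (quot_of I)); split=> [/quot_of_eq|h].
      by rewrite subr0.
    by apply/quot_of_eq; rewrite subr0.
  move=> x; apply: iff_trans (aug0 x) _; apply: iff_trans (gen 0%N x) _.
  by split=> -[c h]; exists c; exact: esym h.
- move=> i x; apply: iff_trans (iff_sym (kerS i x)) _.
  apply: iff_trans (gen i.+1 x) _.
  by split=> -[c h]; exists c; exact: esym h.
Qed.

End Resolution.

(** * Compact group actions *)

Section Products.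
Variable R : realType.
Local Notation C := R[i].
Variables V W : normedModType C.

Lemma nm_pair (x : V) (y : W) : nm ((x, y) : V * W) = Num.max (nm x) (nm y).
Proof.
apply: complexI; rewrite -nmE prod_normE /= !nmE /Num.max /Order.max ltcR.
by case: ifP.
Qed.

Lemma inl_lin : clinear (fun x : V => (x, 0) : V * W).
Proof. by move=> a u v; congr pair; rewrite /= scaler0 addr0. Qed.

Lemma inr_lin : clinear (fun y : W => (0, y) : V * W).
Proof. by move=> a u v; congr pair; rewrite /= scaler0 addr0. Qed.

Lemma inl_bnd (x : V) : nm ((x, 0) : V * W) <= 1 * nm x.
Proof. by rewrite nm_pair nm0 mul1r ge_max lexx nm_ge0. Qed.

Lemma inr_bnd (y : W) : nm ((0, y) : V * W) <= 1 * nm y.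
Proof. by rewrite nm_pair nm0 mul1r ge_max lexx nm_ge0. Qed.

Lemma snd_bnd (x : V * W) : nm x.2 <= 1 * nm x.
Proof. by case: x => x y; rewrite nm_pair mul1r le_max lexx orbT. Qed.

End Products.

Section CompactGroups.
Variable R : realType.
Local Notation C := R[i].

Lemma compact_open_cover (T : topologicalType) (t0 : T) :
  compact [set: T] -> cover_compact [set: T].
Proof.
pose PT : ptopologicalType := HB.pack T (isPointed.Build T t0).
have h : compact [set: PT] -> cover_compact [set: PT] by rewrite compact_cover.
exact: h.
Qed.

(** Radii of the form [1 / (k + 1)] turn the local hypothesis into a statement for large [k], to
    which compactness applies at once. *)
Lemma compact_uniform (X : topologicalType) (P : R -> X -> Prop) :
  compact [set: X] -> (forall r r' x, 0 < r' -> r' <= r -> P r x -> P r' x) ->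
  (forall x0 : X, exists2 r : R, 0 < r & \forall x \near x0, P r x) ->
  exists2 r : R, 0 < r & forall x, P r x.
Proof.
move=> /compact_near_coveringP cX mono loc.
have H : forall x : X, [set: X] x -> \forall x' \near x & k \near \oo, P k.+1%:R^-1 x'.
  move=> x _; have [r r0 hr] := loc x.
  have hk := near_infty_natSinv_lt (PosNum r0).
  exists ([set y | P r y], [set k : nat | k.+1%:R^-1 < r]) => //=.
  move=> [y k] /= [hy hk']; apply: mono hy; last exact: ltW.
  by rewrite invr_gt0 ltr0n.
have [k hk] := filter_ex (cX _ _ _ _ H).
by exists k.+1%:R^-1; [rewrite invr_gt0 ltr0n|move=> x; exact: hk].
Qed.

(** The functions are treated one by one on a shrinking clopen set [W]. Closedness makes [W]
    compact, so the modulus of the next one attains a maximum. Openness makes it a local maximum, so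
    the set where the maximal value is taken is open; continuity makes it closed. *)
Lemma locally_const_open (T : topologicalType) N (u : 'I_N -> T -> C) (t0 : T) :
  compact [set: T] ->
  (forall i (g0 : T) (e : R), 0 < e -> \forall g \near g0, normc (u i g - u i g0) < e) ->
  (forall i (g0 : T), (\forall g \near g0, normc (u i g) <= normc (u i g0)) ->
      \forall g \near g0, u i g = u i g0) ->
  exists2 W : set T, open W & W !=set0 /\ forall i x y, W x -> W y -> u i x = u i y.
Proof.
move=> cT uc umax.
suff H k : (k <= N)%N -> exists W : set T, [/\ open W, closed W, W !=set0 &
    forall i : 'I_N, (i < k)%N -> forall x y, W x -> W y -> u i x = u i y].
  have [W [oW _ W0 hW]] := H N (leqnn N); exists W => //; split => // i x y.
  exact: hW.
elim: k => [_|k IH kN].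
  by exists setT; split; [exact: openT|exact: closedT|exists t0|move=> i; rewrite ltn0].
have [W [oW cW W0 hW]] := IH (ltnW kN); pose i0 := Ordinal kN.
have cptW : compact W by apply: subclosed_compact cT _.
have nc (g0 : T) : {for g0, continuous (fun g => normc (u i0 g))}.
  apply/cvgrPdist_lt => e e0; apply: filterS (uc i0 g0 e e0) => g hg.
  apply: le_lt_trans hg; rewrite ler_norml.
  have h1 := normc_sub_ge (u i0 g) (u i0 g0); have h2 := normc_sub_ge (u i0 g0) (u i0 g).
  by rewrite [normc (_ - u i0 g)]normcBC in h2; lra.
have [g0 + gmax] := compact_EVT_max W0 cptW (continuous_subspaceT nc).
rewrite inE => Wg0.
exists (W `&` [set g | u i0 g = u i0 g0]); split.
- rewrite openE => g [Wg ug].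
  have near_max : \forall g' \near g, normc (u i0 g') <= normc (u i0 g).
    apply: filterS (open_nbhs_nbhs (conj oW Wg)) => g' Wg'.
    by rewrite ug; apply: gmax; rewrite inE.
  apply: filterS2 (open_nbhs_nbhs (conj oW Wg)) (umax i0 g near_max) => g' Wg' e.
  by split => //; rewrite /= e.
- apply: closedI => //; rewrite -openC openE => g /= ug.
  have e0 : 0 < normc (u i0 g - u i0 g0) by rewrite normc_gt0 subr_eq0; apply/eqP.
  apply: filterS (uc i0 g _ e0) => g' /= hg' E; move: hg'.
  by rewrite E normcBC ltxx.
- by exists g0.
- move=> i; rewrite ltnS leq_eqVlt => /orP[/eqP ik|ik] x y [Wx ux] [Wy uy].
    have -> : i = i0 by exact: val_inj.
    by rewrite ux uy.
  exact: hW.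
Qed.

End CompactGroups.

Section ChartExpression.
Variables (K : numFieldType) (d n : nat) (G : complexLieGroupType K d) (Phi : germAction G n).
Local Notation Kn := 'rV[K]_n.
Local Notation Kd := 'rV[K]_d.

Lemma gact_chart_differentiable (g0 : G) a : atlas G a -> cdom a g0 ->
  \forall q \near ((cfun a g0, 0) : Kd * Kn),
    differentiable (fun q : Kd * Kn => Phi (cinv a q.1) q.2) q.
Proof.
move=> atl_a ag; set w0 := cfun a g0.
have h := gact_holomorphic Phi g0.
have himg : \forall w \near w0, (cfun a @` cdom a) w.
  by apply: open_nbhs_nbhs; split; [exact: cimg_open|exists g0].
have hc : \forall q \near ((w0, 0) : Kd * Kn),
   cdifferentiable_at (prod_atlas (atlas G) (model_atlas Kn))
      (model_atlas Kn) (fun q => Phi q.1 q.2) (cinv a q.1, q.2).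
  have c1 : cinv a w @[w --> w0] --> g0.
    by have := cinv_cts ag; rewrite /prop_for /continuous_at cfunK.
  have : (cinv a q.1, q.2) @[q --> ((w0, 0) : Kd * Kn)] --> ((g0, 0) : G * Kn).
    apply: (@cvg_pair _ _ _ _ (nbhs g0) (nbhs (0 : Kn))).
      exact: (cvg_comp fst (cinv a) cvg_fst c1).
    exact: cvg_snd.
  by move=> /(_ _ h).
have himg' : \forall q \near ((w0, 0) : Kd * Kn), (cfun a @` cdom a) q.1.
  exact: (@cvg_fst _ _ (nbhs w0) (nbhs (0 : Kn)) _ _ himg).
apply: filterS2 hc himg' => -[w z] /= [_ hz] [g cg gw].
rewrite -gw cfunK // in hz.
have /= := hz _ _ (ex_intro _ a (ex_intro _ (model_chart Kn)
  (And3 atl_a erefl erefl))) erefl (conj cg I) I.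
by rewrite gw.
Qed.

End ChartExpression.

Section ChartNeighbourhoods.
Variables (R : realType) (V : normedModType R[i]) (M : topologicalType) (a : chart M V).

Lemma chart_near (g0 : M) : cdom a g0 -> forall e : R, 0 < e ->
  \forall g \near g0, cdom a g /\ nm (cfun a g - cfun a g0) < e.
Proof.
move=> ag e e0.
have h : \forall w \near cfun a g0, nm (w - cfun a g0) < e.
  by apply/near_nmP; exists e.
have h' := open_nbhs_nbhs (conj (cdom_open a) ag).
by apply: filterS2 h' (cfun_cts ag h) => g.
Qed.

Lemma chart_inv_near (g0 : M) (P : M -> Prop) : cdom a g0 ->
  (\forall g \near g0, P g) ->
  exists2 e : R, 0 < e & forall w : V, nm w < e -> P (cinv a (w + cfun a g0)).
Proof.
move=> ag hP; have := cinv_cts ag; rewrite /prop_for /continuous_at cfunK // => /(_ _ hP).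
move=> /near_nmP[e e0 he]; exists e => // w hw; apply: he.
by rewrite addrK.
Qed.

End ChartNeighbourhoods.

(** * The differential of the action at the origin *)

Section GroupAction.
Variables (R : realType) (n d : nat).
Local Notation C := R[i].
Local Notation Cn := 'rV[C]_n.
Local Notation Cd := 'rV[C]_d.
(* Canonical structures do not find the topology of 'rV[R[i]]_n from a point alone. *)
Local Notation Vn := ('rV[C]_n : normedModType C).
Variables (G : complexLieGroupType C d) (Phi : germAction G n).

Lemma coord_differentiable i (x : Vn) : differentiable (coord i : Cn -> C^o) x.
Proof. by apply/cdfP; eexists; exact: coord_cfder. Qed.

Lemma diff_coord i (x : Vn) : 'd (coord i : Cn -> C^o) x = coord i :> (Cn -> C^o).
Proof.
have h := differentiable_cfder (coord_differentiable i x).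
exact: cfder_uniq h (coord_cfder i x).
Qed.

Lemma hol_chart (g0 : G) a : atlas G a -> cdom a g0 ->
  forall i, hol (fun x : Cd * Cn => coord i (Phi (cinv a (x.1 + cfun a g0)) x.2)).
Proof.
move=> atl_a ag i; set w0 := cfun a g0.
have := gact_chart_differentiable Phi atl_a ag => /near_nmP[e e0 he].
exists e => // x hx; have wE (y : Cd * Cn) : (y.1 + w0, y.2) = y + (w0, 0).
  by case: y => y1 y2; congr pair; rewrite /= addr0.
apply: (@cdf_affine R _ _ (fun y : Cd * Cn => (y.1 + w0, y.2)) id
  (fun q => coord i (Phi (cinv a q.1) q.2)) x 1) => [//|h|h|].
- by rewrite mul1r.
- by rewrite !wE addrAC.
- apply/cdfP; apply: (@differentiable_comp _ _ _ _
    (fun q : Cd * Cn => Phi (cinv a q.1) q.2) (coord i : Cn -> C^o)).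
    by apply: he; rewrite wE addrK.
  exact: coord_differentiable.
Qed.

(** Each action map fixes 0, so it is bounded by 1 near 0, locally uniformly in [g]. Compactness
    gives a ball for all of [G], in particular for all powers of one element. *)
Lemma uniform_holo_ball : compact [set: G] ->
  exists2 r : R, 0 < r & forall g i, holo_ball (fun z => coord i (Phi g z)) 0 r 1.
Proof.
move=> cG.
apply: (@compact_uniform R G (fun r g => forall i, holo_ball (fun z => coord i (Phi g z)) 0 r 1)) => //.
  by move=> r r' g r'0 r'r h i; exact: holo_ballS (h i).
move=> g0; have [a atl_a ag] := @atlas_cover C d G g0.
pose F i (x : Cd * Cn) := coord i (Phi (cinv a (x.1 + cfun a g0)) x.2).
have hF i : hol (F i) by exact: hol_chart.
have [e e0 he] : exists2 e : R, 0 < e & forall x, nm x < e -> forall i, cdf (F i) x /\ normc (F i x) <= 1.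
  apply: near0_forall => i; have [e1 e10 h1] := hF i; have [e2 e20 h2] := hol_cts (hF i) ltr01.
  exists (Num.min e1 e2) => [|x]; first by rewrite lt_min e10.
  rewrite lt_min => /andP[/h1 c /h2 b]; split => //; apply: ltW.
  by move: b; rewrite [F i 0]/F /= gact_fix0 /coord mxE subr0.
exists e => //; apply: filterS (chart_near ag e0) => g [cg hg] i z.
rewrite subr0 => hz.
have hx : nm ((cfun a g - cfun a g0, z) : Cd * Cn) < e by rewrite nm_pair gt_max hg.
have [h1 h2] := he _ hx i.
have FE y : F i (cfun a g - cfun a g0, y) = coord i (Phi g y).
  by rewrite /F /= subrK cfunK.
split; last by rewrite -FE.
have := @cdf_affine R _ _ (fun y => (cfun a g - cfun a g0, y)) (fun y => (0, y)) (F i) z 1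
  (@inr_lin R _ _) (@inr_bnd R _ _).
have -> : (fun y => F i (cfun a g - cfun a g0, y)) = (fun y => coord i (Phi g y)).
  by apply/funext => y; exact: FE.
by apply => // h; congr pair; rewrite /= addr0.
Qed.

Fact dact_key : unit. Proof. exact: tt. Qed.
(** The isotropy representation on the tangent space at 0, locked so that conversion does not unfold
    the differential. *)
Definition dact : G -> Cn -> Cn :=
  locked_with dact_key (fun g => 'd (Phi g : Vn -> Vn) (0 : Vn)).

Lemma dactE g : dact g = 'd (Phi g : Vn -> Vn) (0 : Vn) :> (Cn -> Cn).
Proof. by rewrite /dact locked_withE. Qed.

Lemma dact_cfder g i : cfder (fun z => coord i (Phi g z)) 0 (fun h => coord i (dact g h)).
Proof.
have dP := nbhs_singleton (gact_differentiable Phi g).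
have dc := coord_differentiable i (Phi g 0).
have := differentiable_cfder (differentiable_comp dP dc).
by rewrite (diff_comp dP dc) diff_coord -dactE.
Qed.

Lemma dact_lin g : clinear (dact g).
Proof. by move=> a u v; rewrite dactE linearP. Qed.

Lemma coord_inj (x y : Cn) : (forall i, coord i x = coord i y) -> x = y.
Proof. by move=> h; apply/rowP => i; exact: h. Qed.

Lemma dact_uniq g (f : Cn -> Cn) L : (\forall z \near (0 : Vn), Phi g z = f z) ->
  (forall i, cfder (fun z => coord i (f z)) 0 (fun h => coord i (L h))) -> dact g = L.
Proof.
move=> /near_nmP[e e0 he] hf; apply/funext => h; apply: coord_inj => i.
have ef y : nm (y - 0) < e -> coord i (Phi g y) = coord i (f y) by move=> /he ->.
by have /(congr1 (fun k => k h)) := cfder_uniq (cfder_near e0 ef (dact_cfder g i)) (hf i).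
Qed.

Lemma dact1 : dact 1%g = id.
Proof.
apply: (@dact_uniq _ id) => [|i]; first exact: gact_id.
exact: coord_cfder.
Qed.

Lemma dactM g h : dact (g * h)%g = dact g \o dact h.
Proof.
apply: (@dact_uniq _ (Phi g \o Phi h)) => [|i]; first exact: gact_mul.
have dh := nbhs_singleton (gact_differentiable Phi h).
have dg : differentiable (Phi g) (Phi h 0).
  by rewrite gact_fix0; exact: nbhs_singleton (gact_differentiable Phi g).
have dgh := differentiable_comp dh dg.
have dc := coord_differentiable i (Phi g (Phi h 0)).
have H := differentiable_cfder (differentiable_comp dgh dc).
rewrite (diff_comp dgh dc) (diff_comp dh dg) diff_coord gact_fix0 in H.
by rewrite (dactE g) (dactE h).
Qed.

Definition dcoef (i j : 'I_n) g := coord i (dact g (ev R j)).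

Lemma dact_dcoef g h : (forall i j, dcoef i j g = dcoef i j h) -> dact g = dact h.
Proof.
move=> e; apply/funext => x.
have lin k : dact k x = \sum_j x ord0 j *: dact k (ev R j).
  rewrite {1}[x]row_sum_delta.
  rewrite (big_morph (dact k) (fun u v => clinearD u v (dact_lin k)) (clinear0 (dact_lin k))).
  by apply: eq_bigr => j _; rewrite (clinearZ _ _ (dact_lin k)).
rewrite (lin g) (lin h); apply: eq_bigr => j _; congr (_ *: _).
by apply: coord_inj => i; exact: e.
Qed.

(** The partial derivative in the direction [j] is the value at [(w, 0)] of the quotient of the
    action by the coordinate [j], and [dir_factor] makes this quotient holomorphic in [w] and the
    point jointly. *)
Lemma dcoef_chart i j (g0 : G) a : atlas G a -> cdom a g0 ->
  exists2 H : Cd -> C, hol H &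
    exists2 e : R, 0 < e & forall w, nm w < e -> dcoef i j (cinv a (w + cfun a g0)) = H w.
Proof.
move=> atl_a ag; set w0 := cfun a g0.
pose F (x : Cd * Cn) := coord i (Phi (cinv a (x.1 + w0)) x.2).
have hF : hol F by exact: hol_chart.
pose lam (x : Cd * Cn) := coord j x.2.
have lam_lin : clinear (lam : _ -> C^o) by move=> c u v; exact: coord_lin.
have lam_bnd x : normc (lam x) <= 1 * nm x.
  by apply: le_trans (coord_bnd j _) _; rewrite mul1r; exact: snd_bnd.
have lam1 : lam (0, ev R j) = 1 by rewrite /lam coord_ev eqxx.
have [H hH [e e0 he]] := dir_factor_near lam_lin lam_bnd lam1 hF.
exists (fun w => H (w, 0)); first exact: hol_comp (@inl_lin R _ _) (@inl_bnd R _ _) hH.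
have [e' e'0 he'] := hH.
pose s := Num.min e e'; have s0 : 0 < s by rewrite lt_min e0.
exists s => // w; rewrite lt_min => /andP[we we'].
set g := cinv a (w + w0).
have hD : cder (fun t => coord i (Phi g (t *: ev R j))) 0 (dcoef i j g).
  have := @cfder_line R _ (fun z => coord i (Phi g z)) 0 (ev R j) 0 (fun h => coord i (dact g h)).
  rewrite scale0r addr0 => /(_ (dact_cfder g i)); congr cder.
  by apply/funext => t; rewrite add0r.
pose q t := H (w, t *: ev R j).
have hq : cdf (q : C^o -> C) 0.
  have [L hL] : cdf H ((w, 0) + 0 *: (0, ev R j)).
    by rewrite scale0r addr0; apply: he'; rewrite nm_pair nm0 gt_max we'.
  apply/cder_cdf; exists (L (0, ev R j)); have := cfder_line hL; congr cder; apply/funext => t.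
  by rewrite /q; congr H; congr pair; rewrite /= ?scaler0 ?addr0 ?add0r.
have q0 : q 0 = H (w, 0) by rewrite /q scale0r.
rewrite -q0; symmetry; pose c := nm (ev R j) + 1.
have c0 : 0 < c by rewrite ltr_wpDl ?nm_ge0.
apply: (disc_factor_der (r := e / c) _ hD hq); first exact: divr_gt0.
move=> t; rewrite ltr_pdivlMr // => ht; rewrite scale0r gact_fix0.
have hx : nm ((w, t *: ev R j) : Cd * Cn) < e.
  rewrite nm_pair gt_max we /= nmZ; apply: le_lt_trans ht.
  by rewrite ler_wpM2l ?normc_ge0 // lerDl.
have Pw : dirproj lam (0, ev R j) (w, t *: ev R j) = (w, 0).
  by congr pair; rewrite /lam /= coord_line ?scaler0 ?subr0 ?subrr.
have := he _ hx; rewrite Pw /F /= -/g gact_fix0 => ->; congr (_ + _ * _).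
by rewrite /lam /= coord_line.
Qed.

Lemma dcoef_cts i j (g0 : G) (e : R) : 0 < e ->
  \forall g \near g0, normc (dcoef i j g - dcoef i j g0) < e.
Proof.
move=> e0; have [a atl_a ag] := @atlas_cover C d G g0.
have [H hH [r r0 hr]] := dcoef_chart i j atl_a ag.
have [s s0 hs] := hol_cts hH e0.
have m0 : 0 < Num.min r s by rewrite lt_min r0.
apply: filterS (chart_near ag m0) => g [cg]; rewrite lt_min => /andP[/hr h1 /hs].
by rewrite -h1 subrK cfunK // -hr ?nm0 // add0r cfunK.
Qed.

Lemma dcoef_max i j (g0 : G) :
  (\forall g \near g0, normc (dcoef i j g) <= normc (dcoef i j g0)) ->
  \forall g \near g0, dcoef i j g = dcoef i j g0.
Proof.
move=> hmax; have [a atl_a ag] := @atlas_cover C d G g0.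
have [H hH [r r0 hr]] := dcoef_chart i j atl_a ag.
have H0 : H 0 = dcoef i j g0 by rewrite -hr ?nm0 // add0r cfunK.
have [s s0 hs] := chart_inv_near ag hmax.
have [e e0 he] : exists2 e : R, 0 < e & forall w, nm w < e -> H w = H 0.
  apply: hol_max_const => //; exists (Num.min r s); first by rewrite lt_min r0.
  by move=> w; rewrite lt_min => /andP[/hr <- /hs]; rewrite H0.
have m0 : 0 < Num.min r e by rewrite lt_min r0.
apply: filterS (chart_near ag m0) => g [cg]; rewrite lt_min => /andP[/hr h1 /he].
by rewrite -h1 subrK cfunK // H0.
Qed.

Lemma mulg_left_open (c : G) (W : set G) : open W -> open [set y | W (c * y)%g].
Proof.
rewrite !openE => oW y /= Wy.
have h : nbhs ((c, y) : G * G) [set q : G * G | W (q.1 * q.2)%g].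
  exact: (proj1 (mulg_holomorphic (c, y))) (oW _ Wy).
exact: (cvg_pair (cvg_cst c) (@cvg_id _ (nbhs y))) h.
Qed.

Lemma finite_cosets : compact [set: G] ->
  exists (p : nat) (rep : 'I_p -> G), forall g, exists i h, dact h = id /\ g = (rep i * h)%g.
Proof.
move=> cG; pose pr (k : 'I_#|{: 'I_n * 'I_n}|) := enum_val k.
have [W oW [[x Wx] hW]] := @locally_const_open R G _ (fun k => dcoef (pr k).1 (pr k).2) 1%g cG
  (fun k g0 e => @dcoef_cts _ _ g0 e) (fun k g0 => @dcoef_max _ _ g0).
have dW y : W y -> dact y = dact x.
  move=> Wy; apply: dact_dcoef => i j; have := hW (enum_rank (i, j)) y x Wy Wx.
  by rewrite /pr enum_rankK.
have dWx h : W (x * h)%g -> dact h = id.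
  move=> /dW; rewrite dactM => /(congr1 (comp (dact x^-1%g))).
  by rewrite compA -dactM mulVg dact1.
have := compact_open_cover 1%g cG.
(* The set attached to [g] is the translate of [W] by [g * x^-1]; it contains [g], and each [y] in
   it differs from [g] by the factor [g^-1 * y], whose differential is the identity by [dWx]. *)
move=> /(_ G setT (fun g => [set y | W (x * (g^-1 * y))%g])).
have opn g : [set: G] g -> open [set y | W (x * (g^-1 * y))%g].
  by move=> _; apply: (@mulg_left_open g^-1%g [set y | W (x * y)%g]); exact: mulg_left_open.
move=> /(_ opn)[|D' _ hD'].
  by move=> y _; exists y => //=; rewrite mulVg mulg1.
pose s : seq G := finmap.enum_fset D'; exists (size s), (fun i => nth 1%g s i) => y.
have [g gD Wg] := hD' y I; have gs : (index g s < size s)%N by rewrite index_mem.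
exists (Ordinal gs), (g^-1 * y)%g; split; first exact: dWx.
by rewrite /= nth_index // mulgA mulgV mul1g.
Qed.

(** Cartan's theorem for the powers of [h], which are bounded on one ball because they all lie in
    [G]. *)
Lemma dact_id_trivial h : compact [set: G] -> dact h = id ->
  \forall z \near (0 : Vn), Phi h z = z.
Proof.
move=> cG hh; have [r r0 hr] := uniform_holo_ball cG.
suff [e e0 he] : exists2 e : R, 0 < e & forall z, nm z < e -> Phi (h ^+ 1)%g z = z.
  by apply/near0P; exists e => // z /he; rewrite expg1.
apply: (@cartan_uniqueness R n (fun m => Phi (h ^+ m)%g) r 1 r0 (fun m => hr _)).
- by rewrite expg0; apply/near0P; exact: gact_id.
- by move=> m; rewrite expgS expg1; apply/near0P; exact: gact_mul.
- by move=> m; exact: gact_fix0.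
- by move=> i; rewrite expg1; have := dact_cfder h i; rewrite hh.
Qed.

Lemma dact_id_acts_trivially h : compact [set: G] -> dact h = id ->
  acts_trivially (germ_ringAction Phi) h.
Proof.
(* An element acts on germs by composition with its inverse, so the claim is proved for [h^-1],
   which composes with [Phi h]. *)
move=> cG hh; rewrite -[h]invgK; apply: acts_triviallyV => f.
have [u ->] := germ_ofP f; rewrite /= germ_actE invgK; apply/germ_of_eq.
by apply: filterS (dact_id_trivial cG hh) => z /= ->.
Qed.

End GroupAction.

Theorem theorem2p1 (R : realType) (n d : nat)
    (G : complexLieGroupType R[i] d) (G_compact : compact [set: G])
    (Phi : germAction G n)
    (I_X : idealr (germ R[i] n))
    (X_invariant : stable_ideal I_X (germ_ringAction Phi)) :
  exists (r : nat) (m : nat -> nat)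
         (F : nat -> equivModule (germ_ringAction Phi))
         (phi : forall i, {linear F i.+1 -> F i})
         (pi : {linear F 0%N -> quot_equivModule X_invariant}),
    is_equiv_free_resolution r m phi pi.
Proof.
have [p [rep hrep]] := finite_cosets Phi G_compact.
have cov g : exists i h, acts_trivially (germ_ringAction Phi) h /\ g = (rep i * h)%g.
  have [i [h [hh ->]]] := hrep g; exists i, h; split => //.
  exact: dact_id_acts_trivially.
exact: (equiv_free_resolution_exists cov (@germ_noetherian R n)
  (@zgerm_regular R n) (@zgerm_separated R n) (@germ_local R n)).
Qed.
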